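(* Let $d\in\{1,2,3\}$, $\alpha>d/2$ and $0\le\gamma\le1$. Let $u$ be the solution of $i\partial_tu=-\Delta u+\mu|u|^2u$ on $\mathbb{T}^d$, $u(0)=u_0$, let $T>0$ be smaller than its maximal existence time, and suppose $M_{\alpha+1+2\gamma}<\infty$. Let $u^n$ be computed by the scheme sLRI1: $$u^{n+1}=e^{2i\tau\Delta}u^{n-1}-2i\mu\tau e^{i\tau\Delta}\bigl((u^n)^2\varphi_s(2\tau\Delta)\overline{u^n}\bigr)\ (n\ge1),$$ $$u^1=e^{i\tau\Delta}u_0-i\mu\tau e^{i\tau\Delta}\bigl(u_0^2\,\varphi_1(-2i\tau\Delta)\overline{u_0}\bigr),\qquad u^0=u_0.$$ Then for all $0<\tau\le\tau_0$ with $\tau_0>0$ depending on $M_{\alpha+1+2\gamma}$ and $T$, $$\|u(t_n)-u^n\|_{H^\alpha}\le C(M_{\alpha+1+2\gamma})\,\tau^{1+\gamma},\qquad 0\le n\le T/\tau,\quad t_n=n\tau.$$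
   Context: $\mathbb{T}^d$ is the $2\pi$-periodic torus, $\mu$ a nonzero real constant; $H^\alpha=H^\alpha(\mathbb{T}^d)$ is the periodic Sobolev space with norm $\|u\|_{H^\alpha}^2=\sum_{\mathbf{k}\in\mathbb{Z}^d}(1+|\mathbf{k}|^2)^\alpha|\hat u_{\mathbf{k}}|^2$. $M_\delta:=\sup_{0\le t\le T}\|u(t)\|_{H^\delta}$. $\varphi_s(x)=\sin(x)/x$ and $\varphi_1(z)=(e^z-1)/z$ (with value $1$ at $0$). Functions of $\Delta$ are Fourier multipliers: $f(\Delta)$ has symbol $f(-|\mathbf{k}|^2)$. $C(M_\delta)$ denotes a positive constant depending on $M_\delta$ and on the fixed data ($T$, $\mu$, $d$, $\alpha$, $\gamma$), but independent of $\tau$ and $n$; likewise $\tau_0$ may depend on the fixed data. *)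

(* Defs.v *)
From Stdlib Require Export Reals.
From Coquelicot Require Export Coquelicot.

Open Scope R_scope.

(** Points of R^d and frequencies of Z^d are iterated pairs [Tn d R], [Tn d Z].
    A function on the torus of period 2 pi is a periodic function on R^d. *)

Definition unit_UniformSpace_mixin : UniformSpace.mixin_of unit.
Proof. now refine (UniformSpace.Mixin unit tt (fun _ _ _ => True) _ _ _). Defined.

Fixpoint Rn_UniformSpace_mixin (d : nat) : UniformSpace.mixin_of (Tn d R) :=
  match d with
  | O => unit_UniformSpace_mixin
  | S d' =>
      prod_UniformSpace_mixin R_UniformSpace
        (UniformSpace.Pack (Tn d' R) (Rn_UniformSpace_mixin d') (Tn d' R))
  end.

Canonical Rn_UniformSpace (d : nat) : UniformSpace :=
  UniformSpace.Pack (Tn d R) (Rn_UniformSpace_mixin d) (Tn d R).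

Fixpoint translate {d : nat} : Tn d R -> Tn d Z -> Tn d R :=
  match d with
  | O => fun _ _ => tt
  | S d' => fun x k =>
      (fst x + 2 * PI * IZR (fst k), translate (snd x) (snd k))
  end.

Fixpoint dot {d : nat} : Tn d Z -> Tn d R -> R :=
  match d with
  | O => fun _ _ => 0
  | S d' => fun k x => IZR (fst k) * fst x + dot (snd k) (snd x)
  end.

Fixpoint sqnorm {d : nat} : Tn d Z -> R :=
  match d with
  | O => fun _ => 0
  | S d' => fun k => IZR (fst k) ^ 2 + sqnorm (snd k)
  end.

(** (2 pi)^(-d) times the integral over [0, 2 pi]^d. *)
Fixpoint torus_mean {d : nat} : (Tn d R -> C) -> C :=
  match d with
  | O => fun f => f tt
  | S d' => fun f =>
      Cmult (RtoC (/ (2 * PI)))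
        (RInt (V := C_R_CompleteNormedModule)
           (fun t => torus_mean (fun y : Tn d' R => f (t, y))) 0 (2 * PI))
  end.

(** The sum of [f k] over the cube of all k whose entries lie in [-N, N]. *)
Fixpoint box_sum {G : AbelianGroup} {d : nat} (N : nat) : (Tn d Z -> G) -> G :=
  match d with
  | O => fun f => f tt
  | S d' => fun f =>
      sum_n (fun j =>
        box_sum N (fun k : Tn d' Z => f ((Z.of_nat j - Z.of_nat N)%Z, k))) (2 * N)
  end.

Definition cexp (z : C) : C :=
  (RtoC (exp (Re z)) * (cos (Im z), sin (Im z)))%C.

Definition fourier_coef {d : nat} (u : Tn d R -> C) (k : Tn d Z) : C :=
  torus_mean (fun x => (u x * cexp (- Ci * dot k x))%C).

(** The terms are nonnegative, so the limit over cubes is the sum over Z^d,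
    possibly [p_infty]. *)
Definition sobolev_sqnorm {d : nat} (s : R) (u : Tn d R -> C) : Rbar :=
  Lim_seq (fun N => box_sum N
    (fun k => Rpower (1 + sqnorm k) s * Cmod (fourier_coef u k) ^ 2)).

Definition sobolev_norm {d : nat} (s : R) (u : Tn d R -> C) : Rbar :=
  match sobolev_sqnorm s u with
  | Finite r => Finite (sqrt r)
  | _ => p_infty
  end.

(** H^s for s > d/2, where by Sobolev embedding every class has a unique
    continuous representative. *)
Definition in_H {d : nat} (s : R) (u : Tn d R -> C) : Prop :=
  (forall (x : Tn d R) (k : Tn d Z), u (translate x k) = u x) /\
  (forall x : Tn d R,
     continuous (T := Rn_UniformSpace d) (U := C_UniformSpace) u x) /\
  is_finite (sobolev_norm s u).

Definition lap_symbol {d : nat} (k : Tn d Z) : R := - sqnorm k.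

(** [f(Delta) v], as the sum of its Fourier series.  This limit over cubes is
    meaningful when the coefficients are absolutely summable, as they are for a
    bounded symbol and v in H^s, s > d/2. *)
Definition lap_mult {d : nat} (f : R -> C) (v : Tn d R -> C) : Tn d R -> C :=
  fun x =>
    let partial N := box_sum (G := C_AbelianGroup) N (fun k =>
      (f (lap_symbol k) * fourier_coef v k * cexp (Ci * dot k x))%C) in
    (real (Lim_seq (fun N => Re (partial N))), real (Lim_seq (fun N => Im (partial N)))).

Definition phi_s (x : R) : R := if Req_EM_T x 0 then 1 else sin x / x.

Definition phi_1 (z : C) : C :=
  if Ceq_dec z 0 then RtoC 1 else ((cexp z - 1) / z)%C.

(** u in C([0, Tend); H^alpha) with u(0) = u0 and
    i u_t = - Delta u + mu |u|^2 u on (0, Tend) in the sense of distributions,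
    i.e. after pairing with each character exp(- i k.x).  The case t = 0
    (one-sided derivative) then follows by continuity. *)
Definition NLS_solution {d : nat} (alpha mu : R) (u0 : Tn d R -> C)
    (Tend : Rbar) (u : R -> Tn d R -> C) : Prop :=
  Rbar_lt 0 Tend /\
  (forall x, u 0 x = u0 x) /\
  (forall t : R, 0 <= t -> Rbar_lt t Tend -> in_H alpha (u t)) /\
  (forall t : R, 0 <= t -> Rbar_lt t Tend ->
     forall eps : posreal, exists delta : posreal,
     forall s : R, 0 <= s -> Rbar_lt s Tend -> Rabs (s - t) < delta ->
       Rbar_lt (sobolev_norm alpha (fun x => (u s x - u t x)%C)) eps) /\
  (forall t : R, 0 < t -> Rbar_lt t Tend -> forall k : Tn d Z,
     exists w : C,
       is_derive (V := C_R_NormedModule)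
         (fun s => fourier_coef (u s) k : C) t w /\
       (Ci * w = - (lap_symbol k * fourier_coef (u t) k)
                 + mu * fourier_coef (fun x => (Cmod (u t x) ^ 2)%R * u t x) k)%C).

Definition NLS_maximal_solution {d : nat} (alpha mu : R) (u0 : Tn d R -> C)
    (Tmax : Rbar) (u : R -> Tn d R -> C) : Prop :=
  NLS_solution alpha mu u0 Tmax u /\
  forall (Tend : Rbar) (v : R -> Tn d R -> C),
    NLS_solution alpha mu u0 Tend v -> Rbar_le Tend Tmax.

Definition sup_sobolev_norm {d : nat} (s T : R) (u : R -> Tn d R -> C) : Rbar :=
  Rbar_lub (fun y => exists t : R, 0 <= t <= T /\ y = sobolev_norm s (u t)).

Definition exp_i_lap {d : nat} (a : R) : (Tn d R -> C) -> Tn d R -> C :=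
  lap_mult (fun l => cexp (Ci * (a * l)%R)).

Definition sLRI1_start {d : nat} (mu tau : R) (u0 : Tn d R -> C) : Tn d R -> C :=
  fun x =>
    (exp_i_lap tau u0 x
     - Ci * mu * tau *
       exp_i_lap tau (fun y =>
         u0 y * u0 y *
         lap_mult (fun l => phi_1 (- (2) * Ci * (tau * l)%R))
           (fun z => Cconj (u0 z)) y) x)%C.

Definition sLRI1_step {d : nat} (mu tau : R) (uprev ucur : Tn d R -> C) :
    Tn d R -> C :=
  fun x =>
    (exp_i_lap (2 * tau) uprev x
     - 2 * Ci * mu * tau *
       exp_i_lap tau (fun y =>
         ucur y * ucur y *
         lap_mult (fun l => RtoC (phi_s (2 * tau * l)))
           (fun z => Cconj (ucur z)) y) x)%C.

Fixpoint sLRI1 {d : nat} (mu tau : R) (u0 : Tn d R -> C) (n : nat) :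
    Tn d R -> C :=
  match n with
  | O => u0
  | S O => sLRI1_start mu tau u0
  | S (S m as p) =>
      sLRI1_step mu tau (sLRI1 mu tau u0 m) (sLRI1 mu tau u0 p)
  end.

(* Main.v *)
(** In Fourier coefficients [H^alpha], [alpha > d/2], is an algebra under convolution.
    Around time [t] the exact flow satisfies
    [u(t + s) = exp(i s Delta) u(t) - i mu s N(u(t)) + O(|s|^(1 + gamma))], [N(u) = |u|^2 u],
    so the nonlinear part of the local error is odd in [s] up to [O(|s|^(1 + gamma))] and
    cancels in the symmetric two-step formula.  What remains is the free part: for
    [k = k1 + k2 + k3] (with [k3] a frequency of the conjugate) the exact phase is
    [exp(i s (2 |k3|^2 + psi))], [psi = 2 (k1.k2 + k1.k3 + k2.k3)], and the scheme keeps only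
    [exp(2 i s |k3|^2)].  The difference summed over [s] and [-s] is a product of two sines,
    of size [s^(1 + gamma) |psi| (|k3|^2 + |psi|)^gamma], which costs [1 + 2 gamma]
    derivatives and no more.  Hence local errors are [O(tau^(2 + gamma))]; the local
    Lipschitz bound of the scheme in [H^alpha] and a discrete Gronwall argument, which also
    keeps the numerical solution bounded, give the global rate. *)

Require Import Defs.
From Stdlib Require Import Reals.
From Coquelicot Require Import Coquelicot.
From Stdlib Require Import Lra Lia List Permutation ZArith ClassicalEpsilon.

(** A norm bound is the predicate [HB s x B] on coefficient families, tested on finite lists of
    frequencies. No vector-valued integral appears: the Duhamel integral is replaced by the mean
    value inequality [HB_mvt], which asks only for differentiability frequency by frequency. The
    equation holds at interior times, while steps may begin at 0 or end at T; this is why continuity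
    is taken relative to a closed interval.

    The loss 1 + 2 gamma reflects how weights are shared. |psi| is at most a product of one weight
    per frequency, and the remaining weight can be put on a single frequency. In each Young
    inequality two factors therefore lie in l1 with one derivative each, which alpha + 1 affords,
    and one lies in l2 with the full weight alpha + 1 + 2 gamma.

    Passing from functions to coefficients requires products to become convolutions. This rests on
    Fourier inversion, hence on the uniqueness of Fourier coefficients for continuous periodic
    functions, proved by testing against powers of a trigonometric polynomial. *)

(** * Arithmetic of the frequency lattice *)

Fixpoint kadd {d} : Tn d Z -> Tn d Z -> Tn d Z :=
  match d with
  | O => fun _ _ => tt
  | S d' => fun a b => ((fst a + fst b)%Z, kadd (snd a) (snd b))
  end.

Fixpoint kopp {d} : Tn d Z -> Tn d Z :=
  match d with
  | O => fun _ => tt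
  | S d' => fun a => ((- fst a)%Z, kopp (snd a))
  end.

Definition ksub {d} (a b : Tn d Z) : Tn d Z := kadd a (kopp b).

Fixpoint kzero {d} : Tn d Z :=
  match d with O => tt | S d' => (0%Z, kzero) end.

Fixpoint kip {d} : Tn d Z -> Tn d Z -> R :=
  match d with
  | O => fun _ _ => 0
  | S d' => fun a b => IZR (fst a) * IZR (fst b) + kip (snd a) (snd b)
  end.

Lemma freq_eq_dec {d} (a b : Tn d Z) : {a = b} + {a <> b}.
Proof.
  revert a b; induction d as [|d IH]; simpl; intros a b.
  - left; destruct a, b; reflexivity.
  - destruct a as [a a'], b as [b b'].
    destruct (Z.eq_dec a b) as [E|E], (IH a' b') as [E'|E']; subst;
      try (left; reflexivity); right; congruence.
Qed.

Lemma ksub_invol {d} (k j : Tn d Z) : ksub k (ksub k j) = j.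
Proof.
  unfold ksub; revert k j; induction d as [|d IH]; simpl; intros k j.
  - destruct j; reflexivity.
  - destruct j; simpl; rewrite IH; f_equal; lia.
Qed.

Lemma kadd_ksub {d} (j k : Tn d Z) : kadd j (ksub k j) = k.
Proof.
  unfold ksub; revert k j; induction d as [|d IH]; simpl; intros k j.
  - destruct k; reflexivity.
  - destruct k; simpl; rewrite IH; f_equal; lia.
Qed.

Lemma ksub_inj_l {d} (k j j' : Tn d Z) : ksub k j = ksub k j' -> j = j'.
Proof. intros E; rewrite <- (ksub_invol k j), E; apply ksub_invol. Qed.

Lemma ksub_inj_r {d} (k k' j : Tn d Z) : ksub k j = ksub k' j -> k = k'.
Proof. intros E; rewrite <- (kadd_ksub j k), E; apply kadd_ksub. Qed.

Lemma kopp_invol {d} (k : Tn d Z) : kopp (kopp k) = k.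
Proof.
  induction d as [|d IH]; simpl; destruct k; simpl; auto.
  rewrite IH; f_equal; lia.
Qed.

Lemma sqnorm_kopp {d} (k : Tn d Z) : sqnorm (kopp k) = sqnorm k.
Proof.
  induction d as [|d IH]; simpl; auto.
  rewrite IH, opp_IZR; ring.
Qed.

Lemma sqnorm_kadd {d} (a b : Tn d Z) :
  sqnorm (kadd a b) = sqnorm a + 2 * kip a b + sqnorm b.
Proof.
  induction d as [|d IH]; simpl; [ring|].
  rewrite IH, plus_IZR; ring.
Qed.

Lemma kip_kadd_l {d} (a b c : Tn d Z) : kip (kadd a b) c = kip a c + kip b c.
Proof.
  induction d as [|d IH]; simpl; [ring|].
  rewrite IH, plus_IZR; ring.
Qed.

Lemma sqnorm_pos {d} (k : Tn d Z) : 0 <= sqnorm k.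
Proof.
  induction d as [|d IH]; simpl; [lra|].
  specialize (IH (snd k)); nra.
Qed.

(** The induction step of Cauchy-Schwarz, shared by [kip_sqr_le] and [lsum_cauchy_schwarz]: [p],
    [A], [B] are the inner product and the squared norms accumulated so far. The cross term
    satisfies 2xyp <= x^2 B + y^2 A, by comparing squares. *)
Lemma cauchy_schwarz_step x y p A B : p ^ 2 <= A * B -> 0 <= A -> 0 <= B ->
  (x * y + p) ^ 2 <= (x ^ 2 + A) * (y ^ 2 + B).
Proof.
  intros IH HA HB.
  assert (Rabs (2 * x * y * p) <= Rabs (x ^ 2 * B + y ^ 2 * A)) as H.
  { apply Rsqr_le_abs_0; unfold Rsqr.
    assert (0 <= (x * y) ^ 2) by apply pow2_ge_0.
    assert ((x * y) ^ 2 * p ^ 2 <= (x * y) ^ 2 * (A * B)) by (apply Rmult_le_compat_l; auto).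
    pose proof (pow2_ge_0 (x ^ 2 * B - y ^ 2 * A)). nra. }
  rewrite (Rabs_right (x ^ 2 * B + y ^ 2 * A)) in H by nra.
  pose proof (Rle_abs (2 * x * y * p)). nra.
Qed.

Lemma kip_sqr_le {d} (a b : Tn d Z) : (kip a b) ^ 2 <= sqnorm a * sqnorm b.
Proof.
  induction d as [|d IH]; cbn [kip sqnorm]; [lra|].
  apply cauchy_schwarz_step; [apply IH|apply sqnorm_pos|apply sqnorm_pos].
Qed.

Lemma dot_kadd {d} (a b : Tn d Z) x : dot (kadd a b) x = dot a x + dot b x.
Proof.
  induction d as [|d IH]; simpl; [ring|].
  rewrite IH, plus_IZR; ring.
Qed.

Lemma dot_kopp {d} (a : Tn d Z) x : dot (kopp a) x = - dot a x.
Proof.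
  induction d as [|d IH]; simpl; [ring|].
  rewrite IH, opp_IZR; ring.
Qed.

(** * Finite sums *)

Fixpoint lsum {G : AbelianGroup} {I : Type} (f : I -> G) (l : list I) : G :=
  match l with
  | nil => zero
  | k :: l' => plus (f k) (lsum f l')
  end.

Lemma lsum_app {G : AbelianGroup} {I} (f : I -> G) l l' :
  lsum f (l ++ l') = plus (lsum f l) (lsum f l').
Proof.
  induction l as [|k l IH]; simpl.
  - now rewrite plus_zero_l.
  - now rewrite IH, plus_assoc.
Qed.

Lemma lsum_perm {G : AbelianGroup} {I} (f : I -> G) l l' :
  Permutation l l' -> lsum f l = lsum f l'.
Proof.
  induction 1; simpl; try congruence.
  rewrite !plus_assoc; f_equal; apply plus_comm.
Qed.

Lemma lsum_map {G : AbelianGroup} {I J} (g : J -> I) (f : I -> G) l :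
  lsum f (map g l) = lsum (fun j => f (g j)) l.
Proof. induction l; simpl; congruence. Qed.

Lemma lsum_ext {G : AbelianGroup} {I} (f g : I -> G) l :
  (forall k, f k = g k) -> lsum f l = lsum g l.
Proof. intros H; induction l; simpl; congruence. Qed.

Lemma lsum_Rext {I} (f g : I -> R) l :
  (forall k, f k = g k) -> lsum f l = lsum g l.
Proof. apply (lsum_ext (G := R_AbelianGroup)). Qed.

Lemma lsum_plus {G : AbelianGroup} {I} (f g : I -> G) l :
  lsum (fun k => plus (f k) (g k)) l = plus (lsum f l) (lsum g l).
Proof.
  induction l as [|k l IH]; simpl.
  - now rewrite plus_zero_l.
  - rewrite IH, <- !plus_assoc; f_equal.
    rewrite !plus_assoc; f_equal; apply plus_comm.
Qed.

Lemma lsum_Rplus {I} (f g : I -> R) l :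
  lsum (fun k => f k + g k) l = lsum f l + lsum g l.
Proof. apply (lsum_plus (G := R_AbelianGroup)). Qed.

Lemma lsum_zero {G : AbelianGroup} {I} l : lsum (fun _ : I => zero : G) l = zero.
Proof. induction l; simpl; [auto|]. now rewrite IHl, plus_zero_l. Qed.

Lemma lsum_swap {G : AbelianGroup} {I J} (f : I -> J -> G) l l' :
  lsum (fun i => lsum (f i) l') l = lsum (fun j => lsum (fun i => f i j) l) l'.
Proof.
  induction l as [|i l IH]; simpl.
  - now rewrite lsum_zero.
  - now rewrite IH, lsum_plus.
Qed.

Lemma lsum_le {I} (f g : I -> R) l : (forall k, f k <= g k) -> lsum f l <= lsum g l.
Proof.
  intros H; induction l as [|k l IH]; simpl; [apply Rle_refl|].
  apply Rplus_le_compat; auto.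
Qed.

Lemma lsum_nonneg {I} (f : I -> R) l : (forall k, 0 <= f k) -> 0 <= lsum f l.
Proof.
  intros H; induction l as [|k l IH]; simpl; [apply Rle_refl|].
  apply Rplus_le_le_0_compat; auto.
Qed.

Lemma lsum_scal {I} (c : R) (f : I -> R) l : lsum (fun k => c * f k) l = c * lsum f l.
Proof.
  induction l as [|k l IH]; simpl.
  - unfold zero; simpl; ring.
  - rewrite IH; unfold plus; simpl; ring.
Qed.

Lemma lsum_Cscal {I} (c : C) (f : I -> C) l :
  lsum (fun k => (c * f k)%C) l = (c * lsum f l)%C.
Proof.
  induction l as [|k l IH]; simpl.
  - change ((0 : C) = (c * 0)%C); ring.
  - rewrite IH; unfold plus; simpl; ring.
Qed.

Lemma Cmod_lsum {I} (f : I -> C) l : Cmod (lsum f l) <= lsum (fun k => Cmod (f k)) l.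
Proof.
  induction l as [|k l IH]; simpl.
  - change (Cmod 0 <= 0); rewrite Cmod_0; lra.
  - eapply Rle_trans; [apply Cmod_triangle|].
    apply Rplus_le_compat_l, IH.
Qed.

Lemma Re_lsum {I} (f : I -> C) l : Re (lsum f l) = lsum (fun k => Re (f k)) l.
Proof. induction l as [|k l IH]; simpl; [auto|]. now rewrite <- IH. Qed.

Lemma Im_lsum {I} (f : I -> C) l : Im (lsum f l) = lsum (fun k => Im (f k)) l.
Proof. induction l as [|k l IH]; simpl; [auto|]. now rewrite <- IH. Qed.

Lemma NoDup_incl_perm {d} (l l' : list (Tn d Z)) :
  NoDup l -> incl l l' -> exists r, Permutation l' (l ++ r).
Proof.
  intros Hl; revert l'; induction Hl as [|k l Hk Hl IH]; intros l' Hi.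
  - exists l'; apply Permutation_refl.
  - assert (In k l') as Hin by (apply Hi; now left).
    destruct (in_split _ _ Hin) as (l1 & l2 & ->).
    destruct (IH (l1 ++ l2)) as (r & Hr).
    { intros j Hj. assert (In j (l1 ++ k :: l2)) as H by (apply Hi; now right).
      apply in_app_iff in H; apply in_app_iff; destruct H as [H|[H|H]]; auto.
      subst; contradiction. }
    exists r; simpl. rewrite <- Hr. symmetry; apply Permutation_middle.
Qed.

Lemma lsum_incl {d} (f : Tn d Z -> R) l l' :
  (forall k, 0 <= f k) -> NoDup l -> incl l l' -> lsum f l <= lsum f l'.
Proof.
  intros Hf Hl Hi; destruct (NoDup_incl_perm l l' Hl Hi) as (r & Hr).
  rewrite (lsum_perm _ _ _ Hr), lsum_app.
  change (lsum f l <= lsum f l + lsum f r).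
  pose proof (lsum_nonneg f r Hf); lra.
Qed.

(** * Cubes of frequencies *)

Definition zrange (N : nat) : list Z :=
  map (fun j => (Z.of_nat j - Z.of_nat N)%Z) (seq 0 (S (2 * N))).

Fixpoint boxl (d N : nat) : list (Tn d Z) :=
  match d with
  | O => tt :: nil
  | S d' => list_prod (zrange N) (boxl d' N)
  end.

Lemma lsum_list_prod {G : AbelianGroup} {I J} (f : I * J -> G) l l' :
  lsum f (list_prod l l') = lsum (fun i => lsum (fun j => f (i, j)) l') l.
Proof.
  induction l as [|i l IH]; simpl; [auto|].
  rewrite lsum_app, lsum_map, IH; reflexivity.
Qed.

Lemma sum_n_lsum {G : AbelianGroup} (f : nat -> G) n : sum_n f n = lsum f (seq 0 (S n)).
Proof.
  induction n as [|n IH].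
  - rewrite sum_O; simpl; now rewrite plus_zero_r.
  - rewrite sum_Sn, IH, (seq_S (S n)), lsum_app; simpl; now rewrite plus_zero_r.
Qed.

Lemma box_sum_lsum {G : AbelianGroup} {d} N (f : Tn d Z -> G) :
  box_sum N f = lsum f (boxl d N).
Proof.
  revert f; induction d as [|d IH]; intros f; cbn [box_sum boxl].
  - simpl; now rewrite plus_zero_r.
  - rewrite sum_n_lsum; unfold zrange.
    change (lsum f (list_prod ?a ?b)) with (lsum (f : Z * Tn d Z -> G) (list_prod a b)).
    rewrite lsum_list_prod, lsum_map.
    apply lsum_ext; intros j; apply IH.
Qed.

Lemma in_zrange N k : In k (zrange N) <-> (- Z.of_nat N <= k <= Z.of_nat N)%Z.
Proof.
  unfold zrange; rewrite in_map_iff; split.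
  - intros (j & <- & Hj); apply in_seq in Hj; lia.
  - intros H; exists (Z.to_nat (k + Z.of_nat N)); split; [lia|].
    apply in_seq; lia.
Qed.

Lemma NoDup_zrange N : NoDup (zrange N).
Proof.
  apply FinFun.Injective_map_NoDup; [intros a b; lia|apply seq_NoDup].
Qed.

Lemma NoDup_list_prod {A B} (l : list A) (l' : list B) :
  NoDup l -> NoDup l' -> NoDup (list_prod l l').
Proof.
  intros Hl Hl'; induction Hl as [|a l Ha Hl IH]; simpl; [constructor|].
  apply NoDup_app; auto.
  - apply FinFun.Injective_map_NoDup; [intros x y E; congruence|auto].
  - intros [x y] H1 H2; apply in_map_iff in H1; apply in_prod_iff in H2.
    destruct H1 as (z & E & _), H2 as [H2 _]; congruence.
Qed.

Lemma NoDup_boxl d N : NoDup (boxl d N).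
Proof.
  induction d as [|d IH]; cbn [boxl].
  - constructor; [easy|constructor].
  - apply NoDup_list_prod; [apply NoDup_zrange|apply IH].
Qed.

Lemma boxl_incr d N M : (N <= M)%nat -> incl (boxl d N) (boxl d M).
Proof.
  intros H; induction d as [|d IH]; cbn [boxl]; [apply incl_refl|].
  intros [a b] Hab; apply in_prod_iff in Hab; apply in_prod_iff.
  destruct Hab as [Ha Hb]; split; [|now apply IH].
  apply in_zrange in Ha; apply in_zrange; lia.
Qed.

Lemma in_boxl {d} (k : Tn d Z) : exists N, In k (boxl d N).
Proof.
  induction d as [|d IH]; cbn [boxl].
  - destruct k; exists O; now left.
  - destruct k as [a b]; destruct (IH b) as [N HN].
    exists (N + Z.to_nat (Z.abs a))%nat; apply in_prod_iff; split.
    + apply in_zrange; lia.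
    + revert HN; apply boxl_incr; lia.
Qed.

Lemma incl_boxl {d} (l : list (Tn d Z)) : exists N, incl l (boxl d N).
Proof.
  induction l as [|k l [N HN]].
  - exists O; intros k [].
  - destruct (in_boxl k) as [M HM]; exists (N + M)%nat; intros j [<-|Hj].
    + revert HM; apply boxl_incr; lia.
    + generalize (HN _ Hj); apply boxl_incr; lia.
Qed.

(** * Sums over the lattice *)

(** Testing on all duplicate-free lists instead of cubes makes the bound invariant under
    translations and reflections of the lattice, which do not preserve cubes. It is a statement
    about l1 norms only for nonnegative [f]. *)
Definition L1 {d} (f : Tn d Z -> R) (B : R) : Prop :=
  forall l, NoDup l -> lsum f l <= B.

(** [real] sends an infinite limit to 0, so the value is meaningful only together with a summability
    bound. *)
Definition rsum {d} (f : Tn d Z -> R) : R :=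
  real (Lim_seq (fun N => box_sum N f)).

Definition csum {d} (f : Tn d Z -> C) : C :=
  (rsum (fun k => Re (f k)), rsum (fun k => Im (f k))).

Definition csummable {d} (f : Tn d Z -> C) : Prop :=
  exists B, L1 (fun k => Cmod (f k)) B.

Lemma L1_nonneg {d} (f : Tn d Z -> R) B : L1 f B -> 0 <= B.
Proof. intros H; exact (H nil (NoDup_nil _)). Qed.

Lemma L1_le {d} (f g : Tn d Z -> R) B : (forall k, f k <= g k) -> L1 g B -> L1 f B.
Proof. intros H Hg l Hl; eapply Rle_trans; [apply lsum_le, H|]; auto. Qed.

Lemma L1_plus {d} (f g : Tn d Z -> R) A B :
  L1 f A -> L1 g B -> L1 (fun k => f k + g k) (A + B).
Proof.
  intros Hf Hg l Hl.
  rewrite lsum_Rplus.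
  apply Rplus_le_compat; auto.
Qed.

Lemma L1_scal {d} (f : Tn d Z -> R) c A :
  0 <= c -> L1 f A -> L1 (fun k => c * f k) (c * A).
Proof.
  intros Hc Hf l Hl; rewrite lsum_scal; apply Rmult_le_compat_l; auto.
Qed.

Lemma L1_single {d} (f : Tn d Z -> R) A k : (forall k, 0 <= f k) -> L1 f A -> f k <= A.
Proof.
  intros H Hf.
  assert (NoDup (k :: nil)) as Hn by (constructor; [easy|constructor]).
  specialize (Hf _ Hn); cbn in Hf; unfold plus, zero in Hf; cbn in Hf; lra.
Qed.

Lemma box_sum_incr {d} (f : Tn d Z -> R) N M : (forall k, 0 <= f k) -> (N <= M)%nat ->
  box_sum N f <= box_sum M f.
Proof.
  intros Hf H; rewrite !box_sum_lsum; apply lsum_incl; auto.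
  apply NoDup_boxl. now apply boxl_incr.
Qed.

Lemma rsum_lim_nonneg {d} (f : Tn d Z -> R) B : (forall k, 0 <= f k) -> L1 f B ->
  is_lim_seq (fun N => box_sum N f) (rsum f).
Proof.
  intros Hf HB; apply Lim_seq_correct', ex_finite_lim_seq_incr with B.
  - intros n; apply box_sum_incr; auto.
  - intros n; rewrite box_sum_lsum; apply HB, NoDup_boxl.
Qed.

Lemma rsum_eq {d} (f : Tn d Z -> R) (l : R) :
  is_lim_seq (fun N => box_sum N f) l -> rsum f = l.
Proof. intros H; unfold rsum; now rewrite (is_lim_seq_unique _ _ H). Qed.

Lemma box_sum_plus {G : AbelianGroup} {d} N (f g : Tn d Z -> G) :
  box_sum N (fun k => plus (f k) (g k)) = plus (box_sum N f) (box_sum N g).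
Proof. rewrite !box_sum_lsum; apply lsum_plus. Qed.

(** Write [f] as (f + |f|) - |f|: both parts are nonnegative and summable, so their cube sums
    increase to finite limits. *)
Lemma rsum_lim {d} (f : Tn d Z -> R) B : L1 (fun k => Rabs (f k)) B ->
  is_lim_seq (fun N => box_sum N f) (rsum f).
Proof.
  intros HB.
  assert (forall k, 0 <= f k + Rabs (f k)) as H0.
  { intros k; pose proof (Rabs_pos (f k)). unfold Rabs in *; destruct Rcase_abs; lra. }
  assert (L1 (fun k => f k + Rabs (f k)) (B + B)) as H1.
  { apply L1_plus; auto. eapply L1_le; [|apply HB]; intros k; apply Rle_abs. }
  pose proof (rsum_lim_nonneg _ _ H0 H1) as L1'.
  pose proof (rsum_lim_nonneg _ _ (fun k => Rabs_pos (f k)) HB) as L2'.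
  pose proof (is_lim_seq_minus' _ _ _ _ L1' L2') as L.
  assert (is_lim_seq (fun N => box_sum N f)
    (rsum (fun k => f k + Rabs (f k)) - rsum (fun k => Rabs (f k)))) as L3.
  { eapply is_lim_seq_ext; [|exact L]; intros n; cbv beta.
    rewrite !box_sum_lsum, lsum_Rplus; ring. }
  now rewrite (rsum_eq _ _ L3).
Qed.

Lemma Rabs_Re_le (z : C) : Rabs (Re z) <= Cmod z.
Proof. eapply Rle_trans; [|apply Rmax_Cmod]; apply Rmax_l. Qed.

Lemma Rabs_Im_le (z : C) : Rabs (Im z) <= Cmod z.
Proof. eapply Rle_trans; [|apply Rmax_Cmod]; apply Rmax_r. Qed.

Definition clim (u : nat -> C) (z : C) : Prop :=
  is_lim_seq (fun n => Re (u n)) (Re z) /\ is_lim_seq (fun n => Im (u n)) (Im z).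

Lemma clim_unique u z z' : clim u z -> clim u z' -> z = z'.
Proof.
  intros [H1 H2] [H3 H4]; destruct z, z'; cbn in *.
  apply is_lim_seq_unique in H1, H2, H3, H4.
  rewrite H1 in H3; rewrite H2 in H4; congruence.
Qed.

Lemma clim_ext u v z : (forall n, u n = v n) -> clim u z -> clim v z.
Proof.
  intros E [H1 H2]; split; eapply is_lim_seq_ext; eauto; intros n; cbn; now rewrite E.
Qed.

Lemma clim_plus u v a b : clim u a -> clim v b -> clim (fun n => u n + v n)%C (a + b)%C.
Proof. intros [H1 H2] [H3 H4]; split; now apply is_lim_seq_plus'. Qed.

Lemma clim_scal u a c : clim u a -> clim (fun n => c * u n)%C (c * a)%C.
Proof.
  intros [H1 H2]; split.
  - apply is_lim_seq_minus'.
    + exact (is_lim_seq_scal_l _ (Re c) _ H1).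
    + exact (is_lim_seq_scal_l _ (Im c) _ H2).
  - apply is_lim_seq_plus'.
    + exact (is_lim_seq_scal_l _ (Re c) _ H2).
    + exact (is_lim_seq_scal_l _ (Im c) _ H1).
Qed.

Lemma clim_const c : clim (fun _ => c) c.
Proof. split; apply is_lim_seq_const. Qed.

Lemma Re_Cmult_Cconj_le (z w : C) : Re z * Re w + Im z * Im w <= Cmod z * Cmod w.
Proof.
  destruct z as [a b], w as [x y]; cbn [Re Im fst snd].
  rewrite <- Cmod_mult.
  rewrite <- (Rabs_pos_eq (Cmod _)) by apply Cmod_ge_0.
  eapply Rle_trans; [apply Rle_abs|]. apply Rsqr_le_abs_0; unfold Rsqr.
  rewrite <- (Rmult_1_r (Cmod _ * _)), Rmult_1_r.
  unfold Cmod; rewrite sqrt_sqrt; cbn; [|nra].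
  pose proof (pow2_ge_0 (a * y - b * x)); nra.
Qed.

Lemma Cmod_sqr (z : C) : Cmod z ^ 2 = Re z ^ 2 + Im z ^ 2.
Proof. unfold Cmod; rewrite pow2_sqrt; [reflexivity|]; cbn; nra. Qed.

(** Pair with the limit itself: |z|^2 is the limit of the real part of conj(z) u_n, which is at most
    |z| B. *)
Lemma clim_bound u z B N0 : clim u z -> (forall n, (N0 <= n)%nat -> Cmod (u n) <= B) ->
  Cmod z <= B.
Proof.
  intros [H1 H2] HB.
  assert (0 <= B) as HB0 by (eapply Rle_trans; [apply Cmod_ge_0|apply (HB N0); lia]).
  pose proof (is_lim_seq_plus' _ _ _ _
    (is_lim_seq_scal_l _ (Re z) _ H1) (is_lim_seq_scal_l _ (Im z) _ H2)) as L.
  assert (Cmod z ^ 2 <= Cmod z * B) as H.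
  { rewrite Cmod_sqr.
    replace (Re z ^ 2 + Im z ^ 2) with (Re z * Re z + Im z * Im z) by ring.
    assert (Rbar_le (Re z * Re z + Im z * Im z) (Cmod z * B)) as H; [|exact H].
    eapply is_lim_seq_le_loc; [|exact L|apply is_lim_seq_const].
    exists N0; intros n Hn. eapply Rle_trans; [apply Re_Cmult_Cconj_le|].
    apply Rmult_le_compat_l; [apply Cmod_ge_0|auto]. }
  pose proof (Cmod_ge_0 z); nra.
Qed.

Lemma csum_lim {d} (f : Tn d Z -> C) : csummable f -> clim (fun N => box_sum N f) (csum f).
Proof.
  intros [B HB]; split; cbn.
  - apply is_lim_seq_ext with (fun N => box_sum N (fun k => Re (f k))).
    { intros n; now rewrite !box_sum_lsum, Re_lsum. }
    apply rsum_lim with B. eapply L1_le; [|exact HB]; intros k; apply Rabs_Re_le.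
  - apply is_lim_seq_ext with (fun N => box_sum N (fun k => Im (f k))).
    { intros n; now rewrite !box_sum_lsum, Im_lsum. }
    apply rsum_lim with B. eapply L1_le; [|exact HB]; intros k; apply Rabs_Im_le.
Qed.

Lemma csum_unique {d} (f : Tn d Z -> C) z :
  csummable f -> clim (fun N => box_sum N f) z -> csum f = z.
Proof. intros Hf; apply clim_unique; now apply csum_lim. Qed.

Lemma box_sum_ext {G : AbelianGroup} {d} N (f g : Tn d Z -> G) :
  (forall k, f k = g k) -> box_sum N f = box_sum N g.
Proof. intros H; rewrite !box_sum_lsum; now apply lsum_ext. Qed.

Lemma csum_ext {d} (f g : Tn d Z -> C) : (forall k, f k = g k) -> csum f = csum g.
Proof.
  intros H; unfold csum, rsum; f_equal; f_equal; apply Lim_seq_ext; intros n;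
    apply box_sum_ext; intros k; now rewrite H.
Qed.

Lemma csummable_le {d} (f : Tn d Z -> C) (g : Tn d Z -> R) B :
  (forall k, Cmod (f k) <= g k) -> L1 g B -> csummable f.
Proof. intros H Hg; exists B; eapply L1_le; eauto. Qed.

Lemma csummable_plus {d} (f g : Tn d Z -> C) :
  csummable f -> csummable g -> csummable (fun k => f k + g k)%C.
Proof.
  intros [A HA] [B HB]; exists (A + B).
  eapply L1_le; [|apply (L1_plus _ _ _ _ HA HB)]; intros k; apply Cmod_triangle.
Qed.

Lemma csummable_scal {d} (f : Tn d Z -> C) c :
  csummable f -> csummable (fun k => c * f k)%C.
Proof.
  intros [A HA]; exists (Cmod c * A).
  eapply L1_le; [|apply (L1_scal _ _ _ (Cmod_ge_0 c) HA)]; intros k.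
  rewrite Cmod_mult; apply Rle_refl.
Qed.

Lemma csum_plus {d} (f g : Tn d Z -> C) : csummable f -> csummable g ->
  csum (fun k => f k + g k)%C = (csum f + csum g)%C.
Proof.
  intros Hf Hg; apply csum_unique; [now apply csummable_plus|].
  eapply clim_ext; [|apply clim_plus; apply csum_lim; eassumption].
  intros n; symmetry; apply (box_sum_plus (G := C_AbelianGroup)).
Qed.

Lemma csum_scal {d} (f : Tn d Z -> C) c : csummable f ->
  csum (fun k => c * f k)%C = (c * csum f)%C.
Proof.
  intros Hf; apply csum_unique; [now apply csummable_scal|].
  eapply clim_ext; [|apply clim_scal, csum_lim, Hf].
  intros n; cbv beta; rewrite !(box_sum_lsum (G := C_AbelianGroup)). symmetry; apply lsum_Cscal.
Qed.

Lemma csum_bound {d} (f : Tn d Z -> C) B : L1 (fun k => Cmod (f k)) B -> Cmod (csum f) <= B.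
Proof.
  intros HB; apply clim_bound with (fun N => box_sum N f) 0%nat.
  - apply csum_lim; now exists B.
  - intros n _; rewrite box_sum_lsum; eapply Rle_trans; [apply Cmod_lsum|].
    apply HB, NoDup_boxl.
Qed.

Lemma rsum_ge {d} (f : Tn d Z -> R) B l : (forall k, 0 <= f k) -> L1 f B -> NoDup l ->
  lsum f l <= rsum f.
Proof.
  intros Hf HB Hl; destruct (incl_boxl l) as [N HN].
  apply Rle_trans with (box_sum N f).
  - rewrite box_sum_lsum; now apply lsum_incl.
  - assert (Rbar_le (box_sum N f) (rsum f)) as H; [|exact H].
    eapply is_lim_seq_le_loc; [|apply is_lim_seq_const|eapply rsum_lim_nonneg; eauto].
    exists N; intros n Hn; now apply box_sum_incr.
Qed.

Lemma rsum_le {d} (f : Tn d Z -> R) B : (forall k, 0 <= f k) -> L1 f B -> rsum f <= B.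
Proof.
  intros Hf HB; assert (Rbar_le (rsum f) B) as H; [|exact H].
  eapply is_lim_seq_le; [|eapply rsum_lim_nonneg; eauto|apply is_lim_seq_const].
  intros n; cbv beta; rewrite box_sum_lsum; apply HB, NoDup_boxl.
Qed.

Lemma L1_rsum {d} (f : Tn d Z -> R) B : (forall k, 0 <= f k) -> L1 f B -> L1 f (rsum f).
Proof. intros Hf HB l Hl; eapply rsum_ge; eauto. Qed.

Lemma Cplus_minus_l (a b : C) : (a + b - a)%C = b.
Proof. ring. Qed.

Lemma csum_tail {d} (f : Tn d Z -> C) (F : Tn d Z -> R) B N :
  (forall k, Cmod (f k) <= F k) -> L1 F B ->
  Cmod (csum f - box_sum N f) <= rsum F - box_sum N F.
Proof.
  intros HfF HB.
  assert (forall k, 0 <= F k) as HF by (intros k; eapply Rle_trans; [apply Cmod_ge_0|apply HfF]).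
  assert (csummable f) as Hf by (eapply csummable_le; eauto).
  apply clim_bound with (fun M => box_sum M f + - box_sum N f)%C N.
  - apply clim_plus; [now apply csum_lim|apply clim_const].
  - intros M HM.
    destruct (NoDup_incl_perm (boxl d N) (boxl d M)) as [r Hr];
      [apply NoDup_boxl|now apply boxl_incr|].
    assert (box_sum M F <= rsum F) as H1.
    { rewrite box_sum_lsum; eapply rsum_ge; eauto; apply NoDup_boxl. }
    rewrite box_sum_lsum in H1; rewrite !(box_sum_lsum (G := C_AbelianGroup)), (box_sum_lsum N F).
    rewrite (lsum_perm F _ _ Hr), lsum_app in H1.
    rewrite (lsum_perm f _ _ Hr), lsum_app.
    change (lsum F (boxl d N) + lsum F r <= rsum F) in H1.
    apply Rle_trans with (Cmod (lsum f r)); [right; f_equal; apply Cplus_minus_l|].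
    pose proof (Cmod_lsum f r) as H2.
    pose proof (lsum_le _ _ r HfF). lra.
Qed.

Lemma rsum_tail_lim {d} (F : Tn d Z -> R) B : (forall k, 0 <= F k) -> L1 F B ->
  forall eps : posreal, exists N, rsum F - box_sum N F < eps.
Proof.
  intros HF HB eps; pose proof (rsum_lim_nonneg F B HF HB) as L.
  apply is_lim_seq_spec in L; destruct (L eps) as [N HN]; exists N.
  specialize (HN N (Nat.le_refl _)); apply Rabs_def2 in HN; lra.
Qed.

(** * Convolution *)

Definition rconv {d} (a b : Tn d Z -> R) (k : Tn d Z) : R :=
  rsum (fun j => a j * b (ksub k j)).

Definition conv {d} (a b : Tn d Z -> C) (k : Tn d Z) : C :=
  csum (fun j => a j * b (ksub k j))%C.

(** [B] bounds the l2 norm itself. Since only its square enters the sum, its sign has to be recorded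
    separately. *)
Definition L2 {d} (f : Tn d Z -> R) (B : R) : Prop :=
  0 <= B /\ L1 (fun k => f k ^ 2) (B ^ 2).

Lemma lsum_cauchy_schwarz {I} (f g : I -> R) l :
  (lsum (fun k => f k * g k) l) ^ 2
    <= lsum (fun k => f k ^ 2) l * lsum (fun k => g k ^ 2) l.
Proof.
  induction l as [|k l IH]; cbn [lsum].
  - unfold zero; simpl; lra.
  - apply cauchy_schwarz_step; [apply IH| |]; apply lsum_nonneg; intros; apply pow2_ge_0.
Qed.

Lemma L2_plus {d} (f g h : Tn d Z -> R) A B : L2 f A -> L2 g B ->
  (forall k, Rabs (h k) <= f k + g k) -> L2 h (A + B).
Proof.
  intros [HA Hf] [HB Hg] Hh; split; [lra|]; intros l Hl.
  specialize (Hf l Hl); specialize (Hg l Hl).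
  apply Rle_trans with (lsum (fun k => (f k ^ 2 + g k ^ 2) + 2 * (f k * g k)) l).
  - apply lsum_le; intros k. specialize (Hh k).
    rewrite <- (pow2_abs (h k)). pose proof (Rabs_pos (h k)). nra.
  - rewrite !lsum_Rplus, lsum_scal.
    pose proof (lsum_cauchy_schwarz f g l) as H.
    assert (0 <= lsum (fun k => f k ^ 2) l) by (apply lsum_nonneg; intros; apply pow2_ge_0).
    assert (0 <= lsum (fun k => g k ^ 2) l) by (apply lsum_nonneg; intros; apply pow2_ge_0).
    assert ((lsum (fun k => f k * g k) l) ^ 2 <= (A * B) ^ 2).
    { eapply Rle_trans; [apply H|]. replace ((A * B) ^ 2) with (A ^ 2 * B ^ 2) by ring.
      apply Rmult_le_compat; auto. }
    assert (lsum (fun k => f k * g k) l <= A * B).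
    { apply Rnot_lt_le; intros K.
      assert (0 <= A * B) by nra. nra. }
    nra.
Qed.

Lemma L2_le {d} (f h : Tn d Z -> R) c A : 0 <= c -> L2 f A ->
  (forall k, Rabs (h k) <= c * f k) -> L2 h (c * A).
Proof.
  intros Hc [HA Hf] Hh; split; [nra|].
  replace ((c * A) ^ 2) with (c ^ 2 * A ^ 2) by ring.
  eapply L1_le; [|apply L1_scal; [|apply Hf]; apply pow2_ge_0].
  intros k; cbv beta; rewrite <- pow2_abs; specialize (Hh k); pose proof (Rabs_pos (h k)).
  replace (c ^ 2 * f k ^ 2) with ((c * f k) ^ 2) by ring.
  apply pow_incr; lra.
Qed.

Lemma L1_mult_L2 {d} (f g : Tn d Z -> R) A B : L2 f A -> L2 g B ->
  L1 (fun k => f k * g k) (A * B).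
Proof.
  intros [HA Hf] [HB Hg] l Hl; specialize (Hf l Hl); specialize (Hg l Hl).
  pose proof (lsum_cauchy_schwarz f g l) as H.
  assert (0 <= lsum (fun k => f k ^ 2) l) by (apply lsum_nonneg; intros; apply pow2_ge_0).
  assert (0 <= lsum (fun k => g k ^ 2) l) by (apply lsum_nonneg; intros; apply pow2_ge_0).
  assert ((lsum (fun k => f k * g k) l) ^ 2 <= (A * B) ^ 2).
  { eapply Rle_trans; [apply H|]. replace ((A * B) ^ 2) with (A ^ 2 * B ^ 2) by ring.
    apply Rmult_le_compat; auto. }
  apply Rnot_lt_le; intros K. assert (0 <= A * B) by nra. nra.
Qed.

Lemma L1_shift {d} (f : Tn d Z -> R) A j : L1 f A -> L1 (fun k => f (ksub k j)) A.
Proof.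
  intros Hf l Hl; rewrite <- (lsum_map (fun k => ksub k j) f).
  apply Hf, FinFun.Injective_map_NoDup; auto. intros a b; apply ksub_inj_r.
Qed.

Lemma L1_reflect {d} (f : Tn d Z -> R) A k : L1 f A -> L1 (fun j => f (ksub k j)) A.
Proof.
  intros Hf l Hl; rewrite <- (lsum_map (fun j => ksub k j) f).
  apply Hf, FinFun.Injective_map_NoDup; auto. intros a b; apply ksub_inj_l.
Qed.

Lemma L1_conv_terms {d} (a b : Tn d Z -> R) A B k :
  (forall k, 0 <= a k) -> (forall k, 0 <= b k) -> L1 a A -> (forall k, b k <= B) ->
  L1 (fun j => a j * b (ksub k j)) (B * A).
Proof.
  intros Ha Hb HA HB.
  assert (0 <= B) by (eapply Rle_trans; [apply (Hb k)|apply HB]).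
  eapply L1_le; [|apply L1_scal; [|apply HA]; auto].
  intros j; cbv beta. rewrite Rmult_comm; apply Rmult_le_compat_r; auto.
Qed.

Lemma lsum_rsum_lim {d} {I} (f : I -> Tn d Z -> R) l :
  (forall i, is_lim_seq (fun N => box_sum N (f i)) (rsum (f i))) ->
  is_lim_seq (fun N => lsum (fun i => box_sum N (f i)) l) (lsum (fun i => rsum (f i)) l).
Proof.
  intros H; induction l as [|i l IH]; simpl.
  - apply is_lim_seq_const.
  - apply is_lim_seq_plus'; auto.
Qed.

Lemma rconv_nonneg {d} (a b : Tn d Z -> R) A B k :
  (forall k, 0 <= a k) -> (forall k, 0 <= b k) -> L1 a A -> (forall k, b k <= B) ->
  0 <= rconv a b k.
Proof.
  intros Ha Hb HA HB.
  apply (rsum_ge (fun j => a j * b (ksub k j)) (B * A) nil); [|now apply L1_conv_terms|constructor].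
  intros j; apply Rmult_le_pos; auto.
Qed.

(** Fubini is used only between two finite lists: the inner sums are replaced by their cube sums,
    the two finite sums are swapped, each translate of [b] is bounded by [B], and the limit over
    cubes is taken last. *)
Lemma young_L1 {d} (a b : Tn d Z -> R) A B :
  (forall k, 0 <= a k) -> (forall k, 0 <= b k) -> L1 a A -> L1 b B -> L1 (rconv a b) (A * B).
Proof.
  intros Ha Hb HA HB l Hl.
  assert (forall k, b k <= B) as Hbb by (intros k; now apply L1_single).
  assert (Rbar_le (lsum (rconv a b) l) (A * B)) as H; [|exact H].
  eapply is_lim_seq_le;
    [|apply (lsum_rsum_lim (fun k j => a j * b (ksub k j)) l)|apply is_lim_seq_const].
  - intros N; cbv beta.
    rewrite (lsum_Rext _ (fun k => lsum (fun j => a j * b (ksub k j)) (boxl d N)))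
      by (intros; apply box_sum_lsum).
    rewrite lsum_swap.
    apply Rle_trans with (lsum (fun j => B * a j) (boxl d N)).
    + apply lsum_le; intros j; rewrite lsum_scal, Rmult_comm.
      apply Rmult_le_compat_r; auto. now apply (L1_shift b B j).
    + rewrite lsum_scal, Rmult_comm; apply Rmult_le_compat_r.
      * eapply L1_nonneg; eauto.
      * apply HA, NoDup_boxl.
  - intros k; eapply rsum_lim_nonneg; [|now apply L1_conv_terms; eauto].
    intros j; apply Rmult_le_pos; auto.
Qed.

Lemma L2_bounded {d} (b : Tn d Z -> R) B k : L2 b B -> b k <= B.
Proof.
  intros [HB Hb]. pose proof (L1_single _ _ k (fun k => pow2_ge_0 (b k)) Hb). nra.
Qed.

(** Splitting a b = sqrt(a) (sqrt(a) b) and applying Cauchy-Schwarz gives (a conv b)^2 <= A (a conv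
    b^2) pointwise; [young_L1] then bounds the sum over all frequencies. *)
Lemma young_L2 {d} (a b : Tn d Z -> R) A B :
  (forall k, 0 <= a k) -> (forall k, 0 <= b k) -> L1 a A -> L2 b B -> L2 (rconv a b) (A * B).
Proof.
  intros Ha Hb HA HB.
  pose proof (L1_nonneg _ _ HA) as HA0; destruct (HB) as [HB0 HB2].
  split; [nra|].
  pose proof (young_L1 a (fun k => b k ^ 2) A (B ^ 2) Ha (fun k => pow2_ge_0 (b k)) HA HB2) as HY.
  replace ((A * B) ^ 2) with (A * (A * B ^ 2)) by ring.
  eapply L1_le; [|apply (L1_scal _ _ _ HA0 HY)].
  intros k; cbv beta.
  assert (forall j, 0 <= a j * b (ksub k j) ^ 2) as Hp
    by (intros j; apply Rmult_le_pos; auto; apply pow2_ge_0).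
  assert (L1 (fun j => a j * b (ksub k j) ^ 2) (B ^ 2 * A)) as Hq.
  { apply (L1_conv_terms a (fun k => b k ^ 2)); auto.
    - intros; apply pow2_ge_0.
    - intros i; apply (L1_single _ _ i (fun k => pow2_ge_0 (b k)) HB2). }
  set (q := rconv a (fun k => b k ^ 2) k).
  assert (0 <= q) as Hq0 by exact (rsum_ge _ _ nil Hp Hq (NoDup_nil _)).
  assert (rconv a b k <= sqrt (A * q)) as H.
  { eapply rsum_le.
    - intros j; apply Rmult_le_pos; auto.
    - intros l Hl. apply Rsqr_incr_0_var; [|apply sqrt_pos].
      rewrite Rsqr_sqrt by nra. rewrite Rsqr_pow2.
      rewrite (lsum_Rext _ (fun j => sqrt (a j) * (sqrt (a j) * b (ksub k j)))).
      2:{ intros j; rewrite <- Rmult_assoc, sqrt_sqrt; auto. }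
      eapply Rle_trans; [apply lsum_cauchy_schwarz|].
      apply Rmult_le_compat.
      + apply lsum_nonneg; intros; apply pow2_ge_0.
      + apply lsum_nonneg; intros; apply pow2_ge_0.
      + rewrite (lsum_Rext _ a) by (intros; rewrite pow2_sqrt; auto). now apply HA.
      + rewrite (lsum_Rext _ (fun j => a j * b (ksub k j) ^ 2))
          by (intros; rewrite Rpow_mult_distr, pow2_sqrt; auto).
        eapply rsum_ge; eauto. }
  assert (0 <= rconv a b k) as H0.
  { eapply rconv_nonneg; eauto. intros i; eapply L2_bounded; eauto. }
  apply Rle_trans with (sqrt (A * q) ^ 2).
  - apply pow_incr; lra.
  - rewrite pow2_sqrt; nra.
Qed.

(** The reflection j -> k - j carries duplicate-free lists to duplicate-free lists, so every partial
    sum on the left is a partial sum of the series on the right. *)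
Lemma rconv_comm_le {d} (a b : Tn d Z -> R) A B k :
  (forall k, 0 <= a k) -> (forall k, 0 <= b k) -> L1 a A -> (forall k, b k <= B) ->
  rconv b a k <= rconv a b k.
Proof.
  intros Ha Hb HA HB; apply rsum_le.
  - intros j; apply Rmult_le_pos; auto.
  - intros l Hl.
    rewrite (lsum_Rext _ (fun j => a (ksub k j) * b (ksub k (ksub k j))))
      by (intros; rewrite ksub_invol; ring).
    rewrite <- (lsum_map (fun j => ksub k j) (fun j => a j * b (ksub k j))).
    eapply rsum_ge; [|now eapply L1_conv_terms; eauto|].
    + intros j; apply Rmult_le_pos; auto.
    + apply FinFun.Injective_map_NoDup; auto. intros x y; apply ksub_inj_l.
Qed.

Lemma young_L2_r {d} (a b : Tn d Z -> R) A B :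
  (forall k, 0 <= a k) -> (forall k, 0 <= b k) -> L1 a A -> L2 b B -> L2 (rconv b a) (A * B).
Proof.
  intros Ha Hb HA HB.
  replace (A * B) with (1 * (A * B)) by ring.
  apply (L2_le (rconv a b)); [lra|now apply young_L2|].
  intros k; rewrite Rmult_1_l, Rabs_pos_eq.
  - eapply rconv_comm_le; eauto. intros i; eapply L2_bounded; eauto.
  - apply (rsum_ge (fun j => b j * a (ksub k j)) (A * B) nil); [|intros l Hl|constructor].
    + intros j; apply Rmult_le_pos; auto.
    + rewrite (lsum_Rext _ (fun j => a (ksub k j) * b j)) by (intros; ring).
      pose proof (L1_reflect a A k HA) as H. 
      apply Rle_trans with (lsum (fun j => B * a (ksub k j)) l).
      * apply lsum_le; intros j; rewrite Rmult_comm; apply Rmult_le_compat_r; auto.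
        eapply L2_bounded; eauto.
      * rewrite lsum_scal, Rmult_comm; apply Rmult_le_compat_r; [apply HB|auto].
Qed.

(** * Japanese brackets *)

(** The exponent is halved so that the weight multiplies a coefficient rather than its square: the
    H^s norm is the l2 norm of [wt s k * Cmod (x k)]. *)
Definition wt {d} (s : R) (k : Tn d Z) : R := Rpower (1 + sqnorm k) (s / 2).

Lemma Rpower_pos x y : 0 < Rpower x y.
Proof. apply exp_pos. Qed.

Lemma wt_pos {d} s (k : Tn d Z) : 0 < wt s k.
Proof. apply Rpower_pos. Qed.

Lemma Rpower_le_exp x a b : 1 <= x -> a <= b -> Rpower x a <= Rpower x b.
Proof.
  intros Hx Hab; unfold Rpower.
  assert (0 <= ln x) by (rewrite <- ln_1; apply ln_le; lra).
  assert (a * ln x <= b * ln x) as [H1|H1] by (apply Rmult_le_compat_r; auto).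
  - left; now apply exp_increasing.
  - rewrite H1; apply Rle_refl.
Qed.

Lemma Rpower_base_0 x : Rpower x 0 = 1.
Proof. unfold Rpower; now rewrite Rmult_0_l, exp_0. Qed.

Lemma wt_mono {d} s t (k : Tn d Z) : s <= t -> wt s k <= wt t k.
Proof. intros H; pose proof (sqnorm_pos k); apply Rpower_le_exp; lra. Qed.

Lemma wt_ge_1 {d} s (k : Tn d Z) : 0 <= s -> 1 <= wt s k.
Proof.
  intros H; rewrite <- (Rpower_base_0 (1 + sqnorm k)).
  pose proof (sqnorm_pos k); apply Rpower_le_exp; lra.
Qed.

Lemma wt_plus {d} s t (k : Tn d Z) : wt (s + t) k = wt s k * wt t k.
Proof. unfold wt; rewrite <- Rpower_plus; f_equal; field. Qed.

Lemma wt_sqr {d} s (k : Tn d Z) : wt s k ^ 2 = Rpower (1 + sqnorm k) s.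
Proof. simpl; rewrite Rmult_1_r; unfold wt; rewrite <- Rpower_plus; f_equal; field. Qed.

Lemma wt_kopp {d} s (k : Tn d Z) : wt s (kopp k) = wt s k.
Proof. unfold wt; now rewrite sqnorm_kopp. Qed.

Lemma wt1_sqr {d} (k : Tn d Z) : wt 1 k ^ 2 = 1 + sqnorm k.
Proof. rewrite wt_sqr, Rpower_1; auto. pose proof (sqnorm_pos k); lra. Qed.

Lemma kip_le_sum {d} (a b : Tn d Z) : 2 * Rabs (kip a b) <= sqnorm a + sqnorm b.
Proof.
  pose proof (kip_sqr_le a b); pose proof (sqnorm_pos a); pose proof (sqnorm_pos b).
  pose proof (Rabs_pos (kip a b)). rewrite <- pow2_abs in H.
  pose proof (pow2_ge_0 (sqnorm a - sqnorm b)).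
  apply Rnot_lt_le; intros K; nra.
Qed.

Lemma kip_le_wt {d} (a b : Tn d Z) : Rabs (kip a b) <= wt 1 a * wt 1 b.
Proof.
  pose proof (kip_sqr_le a b); pose proof (sqnorm_pos a); pose proof (sqnorm_pos b).
  pose proof (wt1_sqr a); pose proof (wt1_sqr b).
  pose proof (wt_pos 1 a); pose proof (wt_pos 1 b).
  pose proof (Rabs_pos (kip a b)). rewrite <- pow2_abs in H.
  assert ((Rabs (kip a b)) ^ 2 <= (wt 1 a * wt 1 b) ^ 2).
  { rewrite Rpow_mult_distr, H2, H3; nra. }
  apply Rnot_lt_le; intros K.
  assert (0 < wt 1 a * wt 1 b) by now apply Rmult_lt_0_compat.
  nra.
Qed.

(** The 4 comes from 1 + |a + b|^2 <= 4 (1 + max(|a|^2, |b|^2)). *)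
Definition wt_cst (s : R) : R := Rpower 4 (s / 2).

Lemma wt_kadd {d} s (a b : Tn d Z) : 0 <= s ->
  wt s (kadd a b) <= wt_cst s * (wt s a + wt s b).
Proof.
  intros Hs; unfold wt, wt_cst.
  pose proof (sqnorm_pos a) as HA; pose proof (sqnorm_pos b) as HB.
  pose proof (sqnorm_pos (kadd a b)) as HAB.
  pose proof (kip_le_sum a b) as HI; pose proof (Rle_abs (kip a b)) as HI'.
  pose proof (sqnorm_kadd a b) as E.
  rewrite Rmult_plus_distr_l, !Rpower_mult_distr by lra.
  destruct (Rle_dec (sqnorm a) (sqnorm b)).
  - assert (Rpower (1 + sqnorm (kadd a b)) (s / 2) <= Rpower (4 * (1 + sqnorm b)) (s / 2))
      by (apply Rle_Rpower_l; lra).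
    pose proof (Rpower_pos (4 * (1 + sqnorm a)) (s / 2)). lra.
  - assert (Rpower (1 + sqnorm (kadd a b)) (s / 2) <= Rpower (4 * (1 + sqnorm a)) (s / 2))
      by (apply Rle_Rpower_l; lra).
    pose proof (Rpower_pos (4 * (1 + sqnorm b)) (s / 2)). lra.
Qed.

Lemma wt_cst_pos s : 0 < wt_cst s.
Proof. apply Rpower_pos. Qed.

Lemma Rpower_neg_anti x y e : 0 < x <= y -> 0 <= e -> Rpower y (- e) <= Rpower x (- e).
Proof.
  intros Hx He; rewrite !Rpower_Ropp.
  apply Rinv_le_contravar; [apply Rpower_pos|now apply Rle_Rpower_l].
Qed.

(** Telescoping instead of an integral test: by the mean value theorem, (1 + (x+1)^2)^(-e) is at
    most (x^(-q) - (x+1)^(-q)) / q with q = 2e - 1 > 0. *)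
Lemma zrange_sum_bound e : 1 / 2 < e -> exists B, 0 < B /\ forall N,
  lsum (fun n => Rpower (1 + IZR n ^ 2) (- e)) (zrange N) <= B.
Proof.
  intros He. set (g := fun n => Rpower (1 + IZR n ^ 2) (- e)).
  set (q := 2 * e - 1). assert (0 < q) as Hq by (unfold q; lra).
  assert (forall n, g n <= 1) as Hg1.
  { intros n; unfold g.
    apply Rle_trans with (Rpower (1 + IZR n ^ 2) 0); [|rewrite Rpower_base_0; lra].
    pose proof (pow2_ge_0 (IZR n)); apply Rpower_le_exp; lra. }
  assert (forall n, 0 < g n) as Hg0 by (intros; apply Rpower_pos).
  assert (forall N, Permutation (zrange (S N)) (Z.of_nat (S N) :: (- Z.of_nat (S N))%Z :: zrange N)) as HP.
  { intros N; apply NoDup_Permutation.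
    - apply NoDup_zrange.
    - constructor; [|constructor; [|apply NoDup_zrange]].
      + intros [H|H]; [lia|apply in_zrange in H; lia].
      + intros H; apply in_zrange in H; lia.
    - intros x; cbn [In]; rewrite !in_zrange; lia. }
  assert (forall N, lsum g (zrange (S N)) = 2 * g (Z.of_nat (S N)) + lsum g (zrange N)) as HS.
  { intros N; rewrite (lsum_perm (G := R_AbelianGroup) g _ _ (HP N)); cbn [lsum].
    replace (g (- Z.of_nat (S N))%Z) with (g (Z.of_nat (S N))).
    - unfold plus; simpl; ring.
    - unfold g; rewrite opp_IZR; f_equal; ring. }
  assert (forall x, 1 <= x -> Rpower (1 + (x + 1) ^ 2) (- e)
    <= / q * (Rpower x (- q) - Rpower (x + 1) (- q))) as HM.
  { intros x Hx.
    destruct (MVT_gen (fun y => Rpower y (- q)) x (x + 1) (fun y => - q * Rpower y (- q - 1)))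
      as (c & Hc & E).
    - rewrite Rmin_left, Rmax_right by lra; intros y Hy.
      apply is_derive_Reals, derivable_pt_lim_power; lra.
    - rewrite Rmin_left, Rmax_right by lra; intros y Hy.
      apply derivable_continuous_pt; exists (- q * Rpower y (- q - 1)).
      apply derivable_pt_lim_power; lra.
    - rewrite Rmin_left, Rmax_right in Hc by lra.
      replace (Rpower x (- q) - Rpower (x + 1) (- q)) with (q * Rpower c (- q - 1)) by lra.
      rewrite <- Rmult_assoc, Rinv_l, Rmult_1_l by lra.
      replace (- q - 1) with (- (2 * e)) by (unfold q; ring).
      apply Rle_trans with (Rpower ((x + 1) ^ 2) (- e)); [apply Rpower_neg_anti; nra|].
      replace ((x + 1) ^ 2) with (Rpower (x + 1) 2).
      2:{ replace 2 with (INR 2) by (simpl; ring). rewrite Rpower_pow by lra. reflexivity. }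
      rewrite Rpower_mult. replace (2 * - e) with (- (2 * e)) by ring.
      apply Rpower_neg_anti; lra. }
  (* The 3 covers n = -1, 0, 1, each term being at most 1; the remaining terms telescope to at most
     1/q on either side. *)
  exists (3 + 2 * / q). pose proof (Rinv_0_lt_compat _ Hq) as Hq'.
  split; [lra|].
  assert (forall N, lsum g (zrange (S N)) <= 3 + 2 * / q * (1 - Rpower (INR (S N)) (- q))) as HB.
  { induction N as [|N IH].
    - rewrite HS. replace (lsum g (zrange 0)) with (g 0%Z).
      2:{ unfold zrange; simpl. unfold plus, zero; simpl; ring. }
      simpl INR. replace (Rpower 1 (- q)) with 1.
      2:{ unfold Rpower; now rewrite ln_1, Rmult_0_r, exp_0. }
      pose proof (Hg1 0%Z); pose proof (Hg1 (Z.of_nat 1)); lra.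
    - rewrite HS.
      assert (1 <= INR (S N)) as H1 by (rewrite S_INR; pose proof (pos_INR N); lra).
      pose proof (HM _ H1) as H2.
      unfold g at 1. rewrite <- INR_IZR_INZ.
      rewrite (S_INR (S N)). nra. }
  intros [|N].
  - unfold zrange; simpl. unfold plus, zero; simpl. fold (g 0%Z). pose proof (Hg1 0%Z). lra.
  - specialize (HB N). pose proof (Rpower_pos (INR (S N)) (- q)). nra.
Qed.

(** 1 + |k|^2 dominates both 1 + k_1^2 and 1 plus the squared norm of the other coordinates. The
    power -(d e) therefore splits between the two, and the sum is bounded by a product of d
    one-dimensional sums. *)
Lemma wt_neg_summable (d : nat) (alpha : R) : INR d / 2 < alpha ->
  exists B, 0 < B /\ L1 (fun k : Tn d Z => Rpower (1 + sqnorm k) (- alpha)) B.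
Proof.
  intros Ha.
  (* The exponent is shared equally, e = alpha / d; in dimension 0 any e above 1/2 will do. *)
  assert (exists e, 1 / 2 < e /\ INR d * e <= alpha) as (e & He & Hde).
  { destruct d as [|d].
    - exists 1; simpl in *; lra.
    - exists (alpha / INR (S d)). assert (0 < INR (S d)) by (apply lt_0_INR; lia). split.
      + apply Rmult_lt_reg_r with (INR (S d)); auto. field_simplify; lra.
      + right; field; lra. }
  destruct (zrange_sum_bound e He) as (B & HB0 & HB).
  exists (B ^ d); split; [now apply pow_lt|].
  assert (forall N, lsum (fun k : Tn d Z => Rpower (1 + sqnorm k) (- (INR d * e))) (boxl d N) <= B ^ d) as H.
  { clear Ha Hde. intros N; induction d as [|d IH].
    - simpl. unfold plus, zero; simpl. rewrite Rplus_0_r, Rmult_0_l, Ropp_0, Rpower_base_0. lra.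
    - change (lsum (fun k : Z * Tn d Z =>
        Rpower (1 + sqnorm (d := S d) k) (- (INR (S d) * e)))
        (list_prod (zrange N) (boxl d N)) <= B ^ S d).
      rewrite (lsum_list_prod (G := R_AbelianGroup)).
      apply Rle_trans with (lsum (fun n => B ^ d * Rpower (1 + IZR n ^ 2) (- e)) (zrange N)).
      + apply lsum_le; intros n; rewrite (Rmult_comm (B ^ d)).
        eapply Rle_trans; [|apply Rmult_le_compat_l; [left; apply Rpower_pos|apply IH]].
        rewrite <- lsum_scal. apply lsum_le; intros k.
        cbn [sqnorm fst snd]. pose proof (sqnorm_pos k); pose proof (pow2_ge_0 (IZR n)).
        replace (- (INR (S d) * e)) with (- e + - (INR d * e)) by (rewrite S_INR; ring).
        rewrite Rpower_plus. pose proof (pos_INR d).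
        apply Rmult_le_compat; try (left; apply Rpower_pos).
        * apply Rpower_neg_anti; lra.
        * apply Rpower_neg_anti; nra.
      + rewrite lsum_scal. simpl. rewrite Rmult_comm.
        apply Rmult_le_compat_r; [apply pow_le; lra|apply HB]. }
  intros l Hl; destruct (incl_boxl l) as [N HN].
  eapply Rle_trans; [|apply (H N)].
  eapply Rle_trans; [apply lsum_incl; eauto|].
  - intros k; left; apply Rpower_pos.
  - apply lsum_le; intros k; pose proof (sqnorm_pos k); apply Rpower_le_exp; lra.
Qed.

(** * Weighted l2 norms of Fourier coefficients *)

(** The H^s norm is at most [B], for the function with Fourier coefficients [x];
    as a predicate it also expresses that the norm is finite. *)
Definition HB {d} (s : R) (x : Tn d Z -> C) (B : R) : Prop :=
  L2 (fun k => wt s k * Cmod (x k)) B.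

Lemma HB_nonneg {d} s (x : Tn d Z -> C) B : HB s x B -> 0 <= B.
Proof. intros [H _]; exact H. Qed.

Lemma wt_Cmod_nonneg {d} s (k : Tn d Z) z : 0 <= wt s k * Cmod z.
Proof. apply Rmult_le_pos; [left; apply wt_pos|apply Cmod_ge_0]. Qed.

Lemma HB_dom {d} s t (x y : Tn d Z -> C) c B : 0 <= c -> HB s x B ->
  (forall k, wt t k * Cmod (y k) <= c * (wt s k * Cmod (x k))) -> HB t y (c * B).
Proof.
  intros Hc Hx H; eapply L2_le; [auto|apply Hx|].
  intros k; rewrite Rabs_pos_eq by apply wt_Cmod_nonneg; apply H.
Qed.

Lemma HB_le {d} s t (x y : Tn d Z -> C) A B : HB s x A -> t <= s -> A <= B ->
  (forall k, y k = x k) -> HB t y B.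
Proof.
  intros Hx Hs HAB E.
  assert (HB t y A) as [H1 H2].
  { rewrite <- (Rmult_1_l A); eapply HB_dom; [lra|apply Hx|]; intros k; rewrite E.
    rewrite Rmult_1_l; apply Rmult_le_compat_r; [apply Cmod_ge_0|now apply wt_mono]. }
  split; [lra|]; intros l Hl; eapply Rle_trans; [now apply H2|]. apply pow_incr; lra.
Qed.

Lemma HB_ext {d} s (x y : Tn d Z -> C) B : (forall k, y k = x k) -> HB s x B -> HB s y B.
Proof. intros; eapply HB_le; eauto; lra. Qed.

Lemma HB_weaken {d} s (x : Tn d Z -> C) A B : A <= B -> HB s x A -> HB s x B.
Proof. intros; eapply HB_le; eauto; lra. Qed.

Lemma HB_lower {d} s t (x : Tn d Z -> C) B : t <= s -> HB s x B -> HB t x B.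
Proof. intros; eapply HB_le; eauto; lra. Qed.

Lemma HB_plus {d} s (x y : Tn d Z -> C) A B : HB s x A -> HB s y B ->
  HB s (fun k => x k + y k)%C (A + B).
Proof.
  intros Hx Hy; eapply L2_plus; [apply Hx|apply Hy|].
  intros k; rewrite Rabs_pos_eq by apply wt_Cmod_nonneg.
  rewrite <- Rmult_plus_distr_l; apply Rmult_le_compat_l; [left; apply wt_pos|].
  apply Cmod_triangle.
Qed.

Lemma HB_mult {d} s (f : Tn d Z -> C) (x : Tn d Z -> C) c B : 0 <= c ->
  (forall k, Cmod (f k) <= c) -> HB s x B -> HB s (fun k => f k * x k)%C (c * B).
Proof.
  intros Hc Hf Hx; eapply HB_dom; [auto|apply Hx|].
  intros k; rewrite Cmod_mult. specialize (Hf k).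
  pose proof (wt_Cmod_nonneg s k (x k)). nra.
Qed.

Lemma HB_scal {d} s (c : C) (x : Tn d Z -> C) B : HB s x B ->
  HB s (fun k => c * x k)%C (Cmod c * B).
Proof. apply HB_mult; [apply Cmod_ge_0|]; intros; apply Rle_refl. Qed.

Lemma HB_minus {d} s (x y : Tn d Z -> C) A B : HB s x A -> HB s y B ->
  HB s (fun k => x k - y k)%C (A + B).
Proof.
  intros Hx Hy.
  apply (HB_ext s (fun k => x k + (-(1)) * y k)%C); [intros; ring|].
  apply HB_plus; auto. replace B with (Cmod (-(1)) * B) by (rewrite Cmod_opp, Cmod_1; ring).
  now apply HB_scal.
Qed.

(** The Fourier coefficients of the complex conjugate. *)
Definition cj {d} (x : Tn d Z -> C) (k : Tn d Z) : C := Cconj (x (kopp k)).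

Lemma HB_cj {d} s (x : Tn d Z -> C) B : HB s x B -> HB s (cj x) B.
Proof.
  intros [HB0 Hx]; split; auto; intros l Hl; unfold cj.
  rewrite (lsum_Rext _ (fun k => (wt s (kopp k) * Cmod (x (kopp k))) ^ 2)).
  - rewrite <- (lsum_map kopp (fun k => (wt s k * Cmod (x k)) ^ 2)).
    apply Hx, FinFun.Injective_map_NoDup; auto.
    intros a b E; rewrite <- (kopp_invol a), E; apply kopp_invol.
  - intros k; now rewrite wt_kopp, Cmod_conj.
Qed.

Lemma HB_single {d} s (x : Tn d Z -> C) B k : 0 <= s -> HB s x B -> Cmod (x k) <= B.
Proof.
  intros Hs Hx; eapply Rle_trans; [|apply (L2_bounded _ _ k Hx)]; cbv beta.
  pose proof (wt_ge_1 s k Hs); pose proof (Cmod_ge_0 (x k)); nra.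
Qed.

(** * Bilinearity of the convolution *)

Lemma conv_terms_summable {d} (x y : Tn d Z -> C) k :
  csummable x -> csummable y -> csummable (fun j => x j * y (ksub k j))%C.
Proof.
  intros [A HA] [B HB].
  eapply csummable_le; [|apply (L1_conv_terms (fun k => Cmod (x k)) (fun k => Cmod (y k)) A B k)].
  - intros j; rewrite Cmod_mult; apply Rle_refl.
  - intros; apply Cmod_ge_0.
  - intros; apply Cmod_ge_0.
  - exact HA.
  - intros j; apply (L1_single _ _ j (fun k => Cmod_ge_0 (y k)) HB).
Qed.

Lemma conv_ext {d} (x x' y y' : Tn d Z -> C) k : (forall j, x j = x' j) ->
  (forall j, y j = y' j) -> conv x y k = conv x' y' k.
Proof. intros H H'; apply csum_ext; intros j; now rewrite H, H'. Qed.

Lemma conv_plus_l {d} (x x' y : Tn d Z -> C) k : csummable x -> csummable x' -> csummable y ->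
  conv (fun j => x j + x' j)%C y k = (conv x y k + conv x' y k)%C.
Proof.
  intros; unfold conv; rewrite <- csum_plus; try now apply conv_terms_summable.
  apply csum_ext; intros; ring.
Qed.

Lemma conv_plus_r {d} (x y y' : Tn d Z -> C) k : csummable x -> csummable y -> csummable y' ->
  conv x (fun j => y j + y' j)%C k = (conv x y k + conv x y' k)%C.
Proof.
  intros; unfold conv; rewrite <- csum_plus; try now apply conv_terms_summable.
  apply csum_ext; intros; ring.
Qed.

Lemma conv_scal_l {d} c (x y : Tn d Z -> C) k : csummable x -> csummable y ->
  conv (fun j => c * x j)%C y k = (c * conv x y k)%C.
Proof.
  intros; unfold conv; rewrite <- csum_scal; try now apply conv_terms_summable.
  apply csum_ext; intros; ring.
Qed.

Lemma conv_scal_r {d} c (x y : Tn d Z -> C) k : csummable x -> csummable y ->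
  conv x (fun j => c * y j)%C k = (c * conv x y k)%C.
Proof.
  intros; unfold conv; rewrite <- csum_scal; try now apply conv_terms_summable.
  apply csum_ext; intros; ring.
Qed.

Lemma csum_bound_scaled {d} (f : Tn d Z -> C) p B : 0 < p ->
  L1 (fun k => p * Cmod (f k)) B -> p * Cmod (csum f) <= B.
Proof.
  intros Hp H.
  assert (Cmod (csum f) <= / p * B) as H1.
  { apply csum_bound. pose proof (L1_scal _ (/ p) _ (Rlt_le _ _ (Rinv_0_lt_compat _ Hp)) H) as H1.
    eapply L1_le; [|exact H1]. intros k; cbv beta; right; field; lra. }
  apply Rmult_le_compat_l with (r := p) in H1; [|lra].
  rewrite <- Rmult_assoc, Rinv_r, Rmult_1_l in H1; lra.
Qed.

Lemma L1_rconv_terms {d} (a b : Tn d Z -> R) A B k :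
  (forall k, 0 <= a k) -> (forall k, 0 <= b k) -> L1 a A -> (forall k, b k <= B) ->
  L1 (fun j => a j * b (ksub k j)) (rconv a b k).
Proof.
  intros Ha Hb HA HB; eapply L1_rsum; [|eapply L1_conv_terms; eauto].
  intros j; apply Rmult_le_pos; auto.
Qed.

Lemma L1_rconv_terms_r {d} (a b : Tn d Z -> R) A B k :
  (forall k, 0 <= a k) -> (forall k, 0 <= b k) -> (forall k, a k <= A) -> L1 b B ->
  L1 (fun j => a j * b (ksub k j)) (rconv a b k).
Proof.
  intros Ha Hb HA HB.
  assert (0 <= A) by (eapply Rle_trans; [apply (Ha k)|apply HA]).
  eapply L1_rsum; [intros j; apply Rmult_le_pos; auto|].
  eapply L1_le; [|apply (L1_scal (fun j => b (ksub k j)) A); [auto|apply L1_reflect, HB]].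
  intros j; apply Rmult_le_compat_r; auto.
Qed.

(** * Phases *)

Definition ei (t : R) : C := (cos t, sin t).

Lemma cexp_Ci (t : R) : cexp (Ci * t) = ei t.
Proof.
  unfold cexp, ei; simpl.
  replace (0 * t - 1 * 0) with 0 by ring. replace (0 * 0 + 1 * t) with t by ring.
  rewrite exp_0; unfold Cmult; simpl; f_equal; ring.
Qed.

Lemma ei_plus a b : ei (a + b) = (ei a * ei b)%C.
Proof. unfold ei, Cmult; simpl; rewrite cos_plus, sin_plus; f_equal; ring. Qed.

Lemma ei_0 : ei 0 = 1%C.
Proof. unfold ei; now rewrite cos_0, sin_0. Qed.

Lemma Cmod_ei a : Cmod (ei a) = 1.
Proof.
  unfold Cmod, ei; cbn [fst snd]. pose proof (sin2_cos2 a) as H; unfold Rsqr in H.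
  replace (cos a ^ 2 + sin a ^ 2) with 1 by (simpl; lra). apply sqrt_1.
Qed.

Lemma ei_conj a : Cconj (ei a) = ei (- a).
Proof. unfold Cconj, ei; simpl; now rewrite cos_neg, sin_neg. Qed.

Lemma Rabs_sin_le x : Rabs (sin x) <= Rabs x.
Proof.
  destruct (Req_dec x 0) as [->|H0].
  - rewrite sin_0; lra.
  - assert (forall y, 0 < y -> Rabs (sin y) <= y) as H.
    { intros y Hy. pose proof (sin_lt_x y Hy). pose proof (SIN_bound y).
      pose proof (sin_gt_0 y Hy) as Hpos.
      destruct (Rle_dec y 1).
      - pose proof PI2_1. rewrite Rabs_pos_eq; [lra|].
        left; apply Hpos; lra.
      - unfold Rabs; destruct Rcase_abs; lra. }
    destruct (Rle_dec 0 x).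
    + rewrite (Rabs_pos_eq x) by auto; apply H; lra.
    + rewrite <- (Rabs_Ropp (sin x)), <- sin_neg, (Rabs_left x) by lra; apply H; lra.
Qed.

Lemma Cmod_ei_minus a b : Cmod (ei a - ei b) = 2 * Rabs (sin ((a - b) / 2)).
Proof.
  unfold Cmod, ei; cbn [fst snd Cminus Cplus Copp].
  replace (2 * Rabs (sin ((a - b) / 2))) with (Rabs (2 * sin ((a - b) / 2)))
    by (rewrite Rabs_mult, (Rabs_pos_eq 2); lra).
  rewrite <- sqrt_Rsqr_abs; f_equal; unfold Rsqr.
  pose proof (sin2_cos2 a) as Ha; pose proof (sin2_cos2 b) as Hb; unfold Rsqr in *.
  pose proof (cos_minus a b) as H.
  replace (cos (a - b)) with (1 - 2 * sin ((a - b) / 2) * sin ((a - b) / 2)) in H.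
  2:{ rewrite <- cos_2a_sin; f_equal; field. }
  nra.
Qed.

(** Interpolation between |sin x| <= 1 and |sin x| <= |x|: the former serves for y >= 1, the latter
    for y < 1. Every fractional power of the step size from a phase difference originates here. *)
Lemma Rabs_sin_le_Rpower x y g : Rabs x <= y -> 0 < y -> 0 <= g <= 1 ->
  Rabs (sin x) <= Rpower y g.
Proof.
  intros Hx Hy Hg. destruct (Rle_dec 1 y).
  - apply Rle_trans with 1.
    + pose proof (SIN_bound x); apply Rabs_le; lra.
    + apply Rle_trans with (Rpower y 0); [rewrite Rpower_base_0; lra|].
      apply Rpower_le_exp; lra.
  - eapply Rle_trans; [apply Rabs_sin_le|].
    eapply Rle_trans; [apply Hx|].
    apply Rle_trans with (Rpower y 1); [rewrite Rpower_1; lra|].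
    unfold Rpower. assert (ln y < 0) by (rewrite <- ln_1; apply ln_increasing; lra).
    assert (1 * ln y <= g * ln y) as [K|K] by nra.
    + left; now apply exp_increasing.
    + rewrite K; lra.
Qed.

(** * The free Schroedinger group on Fourier coefficients *)

(** [sg s] is [exp(i s Delta)]. *)
Definition sg {d} (s : R) (x : Tn d Z -> C) (k : Tn d Z) : C := (ei (- (s * sqnorm k)) * x k)%C.

Lemma sg_plus {d} s t (x : Tn d Z -> C) k : sg (s + t) x k = sg s (sg t x) k.
Proof.
  unfold sg; rewrite Cmult_assoc, <- ei_plus; f_equal; f_equal; ring.
Qed.

Lemma sg_0 {d} (x : Tn d Z -> C) k : sg 0 x k = x k.
Proof. unfold sg; rewrite Rmult_0_l, Ropp_0, ei_0; ring. Qed.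

Lemma sg_opp {d} s (x : Tn d Z -> C) k : sg (- s) (sg s x) k = x k.
Proof. rewrite <- sg_plus, Rplus_opp_l; apply sg_0. Qed.

Lemma sg_ext {d} s (x y : Tn d Z -> C) k : x k = y k -> sg s x k = sg s y k.
Proof. unfold sg; congruence. Qed.

Lemma HB_sg {d} s t (x : Tn d Z -> C) B : HB t x B -> HB t (sg s x) B.
Proof.
  intros H; rewrite <- (Rmult_1_l B); apply HB_mult; auto; [lra|].
  intros k; rewrite Cmod_ei; lra.
Qed.

Lemma cj_sg {d} s (x : Tn d Z -> C) k : cj (sg s x) k = sg (- s) (cj x) k.
Proof.
  unfold cj, sg; rewrite Cmult_conj, ei_conj, sqnorm_kopp; f_equal; f_equal; ring.
Qed.

(** Here 2g derivatives buy the factor |s|^g: the phase difference equals 2 |sin(s |k|^2 / 2)|, and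
    interpolation bounds the sine by |s|^g (1 + |k|^2)^g. *)
Lemma HB_sg_minus_id {d} a g s (x : Tn d Z -> C) B : 0 <= g <= 1 -> s <> 0 ->
  HB (a + 2 * g) x B -> HB a (fun k => sg s x k - x k)%C (2 * Rpower (Rabs s) g * B).
Proof.
  intros Hg Hs HB0.
  assert (0 < Rabs s) as Hs' by now apply Rabs_pos_lt.
  eapply HB_dom; [|apply HB0|].
  - pose proof (Rpower_pos (Rabs s) g); lra.
  - intros k; pose proof (sqnorm_pos k) as Hk.
    replace (sg s x k - x k)%C with ((ei (- (s * sqnorm k)) - ei 0) * x k)%C
      by (unfold sg; rewrite ei_0; ring).
    rewrite Cmod_mult, Cmod_ei_minus, wt_plus.
    replace (wt (2 * g) k) with (Rpower (1 + sqnorm k) g)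
      by (unfold wt; f_equal; field).
    assert (Rabs (sin ((- (s * sqnorm k) - 0) / 2)) <= Rpower (Rabs s * (1 + sqnorm k)) g) as H.
    { apply Rabs_sin_le_Rpower; auto; [|nra].
      replace ((- (s * sqnorm k) - 0) / 2) with (- (s * (sqnorm k / 2))) by field.
      rewrite Rabs_Ropp, Rabs_mult, (Rabs_pos_eq (sqnorm k / 2)) by lra. nra. }
    rewrite <- Rpower_mult_distr in H by lra.
    pose proof (wt_Cmod_nonneg a k (x k)).
    replace (wt a k * (2 * Rabs (sin ((- (s * sqnorm k) - 0) / 2)) * Cmod (x k))) with
      (2 * Rabs (sin ((- (s * sqnorm k) - 0) / 2)) * (wt a k * Cmod (x k))) by ring.
    replace (2 * Rpower (Rabs s) g * (wt a k * Rpower (1 + sqnorm k) g * Cmod (x k))) with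
      (2 * (Rpower (Rabs s) g * Rpower (1 + sqnorm k) g) * (wt a k * Cmod (x k))) by ring.
    apply Rmult_le_compat_r; lra.
Qed.

(** * The Sobolev algebra *)

Section Algebra.

Variables (d : nat) (alpha Zc : R).
Hypothesis Halpha : 0 <= alpha.
Hypothesis HZ : 0 <= Zc.
Hypothesis Hsum : L1 (fun k : Tn d Z => Rpower (1 + sqnorm k) (- alpha)) (Zc ^ 2).

(** Cauchy-Schwarz against [wt (- alpha)], whose squares are summable by [Hsum]. This is where alpha
    > d/2 acts, and [Zc] is the constant of the embedding into summable coefficients. *)
Lemma HB_L1 (x : Tn d Z -> C) B : HB alpha x B -> L1 (fun k => Cmod (x k)) (Zc * B).
Proof.
  intros Hx.
  assert (L2 (fun k : Tn d Z => wt (- alpha) k) Zc) as Hw.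
  { split; auto. eapply L1_le; [|apply Hsum]. intros k; rewrite wt_sqr; lra. }
  eapply L1_le; [|apply (L1_mult_L2 _ _ _ _ Hw Hx)].
  intros k; cbv beta. rewrite <- Rmult_assoc, <- wt_plus.
  right; unfold wt. replace ((- alpha + alpha) / 2) with 0 by field.
  rewrite Rpower_base_0; ring.
Qed.

Lemma HB_csummable s (x : Tn d Z -> C) B : alpha <= s -> HB s x B -> csummable x.
Proof. intros Hs Hx; exists (Zc * B); apply HB_L1; eapply HB_lower; eauto. Qed.

Definition alg_cst (s : R) : R := wt_cst s * Zc + wt_cst s * Zc.

(** By [wt_kadd] the weight at k = j + (k - j) falls on one of the two factors, which is then in l2;
    the other is in l1 by [HB_L1]. The two cases are two Young inequalities, one for each summand of
    [alg_cst]. *)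
Lemma HB_conv s (x y : Tn d Z -> C) A B : alpha <= s -> HB s x A -> HB s y B ->
  HB s (conv x y) (alg_cst s * A * B).
Proof.
  intros Hs Hx Hy.
  set (a := fun k => Cmod (x k)); set (b := fun k => Cmod (y k)).
  set (wa := fun k => wt s k * a k); set (wb := fun k => wt s k * b k).
  assert (L1 a (Zc * A)) as HA by (apply HB_L1; eapply HB_lower; eauto).
  assert (L1 b (Zc * B)) as HB' by (apply HB_L1; eapply HB_lower; eauto).
  assert (forall k, 0 <= a k) as Ha by (intros; apply Cmod_ge_0).
  assert (forall k, 0 <= b k) as Hb by (intros; apply Cmod_ge_0).
  assert (forall k, 0 <= wa k) as Hwa by (intros; apply wt_Cmod_nonneg).
  assert (forall k, 0 <= wb k) as Hwb by (intros; apply wt_Cmod_nonneg).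
  pose proof (young_L2 a wb _ _ Ha Hwb HA Hy) as Y1.
  pose proof (young_L2_r b wa _ _ Hb Hwa HB' Hx) as Y2.
  pose proof (wt_cst_pos s) as Hc.
  assert (forall k, 0 <= rconv a wb k) as P1.
  { intros k; eapply rconv_nonneg; eauto. intros j; apply (L2_bounded _ _ j Hy). }
  assert (forall k, wt s k * Cmod (conv x y k) <= wt_cst s * rconv wa b k + wt_cst s * rconv a wb k) as H.
  { intros k; apply csum_bound_scaled; [apply wt_pos|].
    eapply L1_le; [|apply L1_plus; (apply L1_scal; [left; exact Hc|])].
    2:{ apply (L1_rconv_terms_r wa b A (Zc * B)); auto.
        intros j; apply (L2_bounded _ _ j Hx). }
    2:{ apply (L1_rconv_terms a wb (Zc * A) B); auto.
        intros j; apply (L2_bounded _ _ j Hy). }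
    intros j; cbv beta; unfold wa, wb, a, b. rewrite Cmod_mult.
    pose proof (wt_kadd s j (ksub k j) ltac:(lra)) as H; rewrite kadd_ksub in H.
    assert (0 <= Cmod (x j) * Cmod (y (ksub k j))) as H0
      by (apply Rmult_le_pos; apply Cmod_ge_0).
    apply Rmult_le_compat_r with (r := Cmod (x j) * Cmod (y (ksub k j))) in H; auto.
    lra. }
  replace (alg_cst s * A * B) with (wt_cst s * (Zc * B * A) + wt_cst s * (Zc * A * B))
    by (unfold alg_cst; ring).
  eapply L2_plus with (f := fun k => wt_cst s * rconv wa b k) (g := fun k => wt_cst s * rconv a wb k).
  - eapply L2_le; [lra|apply Y2|]. intros k. rewrite Rabs_pos_eq; [apply Rle_refl|].
    apply Rmult_le_pos; [lra|].
    eapply (rsum_ge (fun j => wa j * b (ksub k j)) _ nil); [| |constructor].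
    + intros j; apply Rmult_le_pos; auto.
    + apply (L1_rconv_terms_r wa b A (Zc * B)); auto.
      intros j; apply (L2_bounded _ _ j Hx).
  - eapply L2_le; [lra|apply Y1|]. intros k. rewrite Rabs_pos_eq; [apply Rle_refl|].
    apply Rmult_le_pos; [lra|auto].
  - intros k; rewrite Rabs_pos_eq by apply wt_Cmod_nonneg. apply H.
Qed.

Definition tri (a b c : Tn d Z -> C) : Tn d Z -> C := conv (conv a b) c.

Lemma HB_tri s (a b c : Tn d Z -> C) A B D : alpha <= s ->
  HB s a A -> HB s b B -> HB s c D -> HB s (tri a b c) (alg_cst s ^ 2 * A * B * D).
Proof.
  intros Hs Ha Hb Hc.
  replace (alg_cst s ^ 2 * A * B * D) with (alg_cst s * (alg_cst s * A * B) * D) by ring.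
  repeat apply HB_conv; auto.
Qed.

Lemma csummable_cj (x : Tn d Z -> C) : csummable x -> csummable (cj x).
Proof.
  intros [B Hx]; exists B; intros l Hl; unfold cj.
  rewrite (lsum_Rext _ (fun k => Cmod (x (kopp k)))) by (intros; apply Cmod_conj).
  rewrite <- (lsum_map kopp (fun k => Cmod (x k))).
  apply Hx, FinFun.Injective_map_NoDup; auto.
  intros a b E; rewrite <- (kopp_invol a), E; apply kopp_invol.
Qed.

Lemma csummable_conv (x y : Tn d Z -> C) : csummable x -> csummable y -> csummable (conv x y).
Proof.
  intros [A HA] [B HB].
  exists (A * B).
  eapply L1_le; [|apply (young_L1 (fun k => Cmod (x k)) (fun k => Cmod (y k)))]; auto;
    try (intros; apply Cmod_ge_0).
  intros k; apply csum_bound.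
  eapply L1_le; [|eapply L1_rconv_terms]; try (intros; apply Cmod_ge_0).
  - intros j; rewrite Cmod_mult; apply Rle_refl.
  - exact HA.
  - intros j; apply (L1_single _ _ j (fun k => Cmod_ge_0 (y k)) HB).
Qed.

Lemma tri_ext (a a' b b' c c' : Tn d Z -> C) k : (forall j, a j = a' j) ->
  (forall j, b j = b' j) -> (forall j, c j = c' j) -> tri a b c k = tri a' b' c' k.
Proof. intros; apply conv_ext; auto. intros; apply conv_ext; auto. Qed.

(** The arguments are exchanged one at a time, from left to right, so the factors left of a
    difference are primed and those right of it are not. *)
Lemma tri_minus (a a' b b' c c' : Tn d Z -> C) k :
  csummable a -> csummable a' -> csummable b -> csummable b' -> csummable c -> csummable c' ->
  (tri a b c k - tri a' b' c' k)%C =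
  (tri (fun j => a j - a' j) b c k + tri a' (fun j => b j - b' j) c k
   + tri a' b' (fun j => c j - c' j) k)%C.
Proof.
  intros Ha Ha' Hb Hb' Hc Hc'.
  assert (forall x y : Tn d Z -> C, csummable x -> csummable y ->
    csummable (fun j => x j - y j)%C) as Hm.
  { intros x y Hx Hy. destruct (csummable_plus _ _ Hx (csummable_scal _ (-(1)) Hy)) as [B H].
    exists B; eapply L1_le; [|apply H]; intros j; right; f_equal; ring. }
  unfold tri.
  assert (forall x y z w : Tn d Z -> C, csummable x -> csummable y -> csummable z ->
    conv x z k = (conv (fun j => x j - y j) z k + conv y z k)%C) as El.
  { intros x y z _ Hx Hy Hz; rewrite <- conv_plus_l; auto.
    apply conv_ext; auto; intros; ring. }
  assert (forall x y z : Tn d Z -> C, csummable x -> csummable y -> csummable z ->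
    conv z x k = (conv z (fun j => x j - y j) k + conv z y k)%C) as Er.
  { intros x y z Hx Hy Hz; rewrite <- conv_plus_r; auto.
    apply conv_ext; auto; intros; ring. }
  rewrite (El (conv a b) (conv a' b) c c) by auto using csummable_conv.
  rewrite (conv_ext (fun j => conv a b j - conv a' b j)%C (conv (fun j => a j - a' j)%C b) c c); auto.
  2:{ intros j. rewrite (conv_ext a (fun i => (a i - a' i) + a' i)%C b b) by (intros; ring).
      rewrite conv_plus_l by auto. ring. }
  rewrite (El (conv a' b) (conv a' b') c c) by auto using csummable_conv.
  rewrite (conv_ext (fun j => conv a' b j - conv a' b' j)%C (conv a' (fun j => b j - b' j)%C) c c); auto.
  2:{ intros j. rewrite (conv_ext a' a' b (fun i => (b i - b' i) + b' i)%C) by (intros; ring).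
      rewrite conv_plus_r by auto. ring. }
  rewrite (Er c c' (conv a' b')) by auto using csummable_conv.
  ring.
Qed.

(** The bounds supplied are those on the factors accompanying each difference in [tri_minus]. The
    summability of [a] and [c'] is recovered from [a'], [c] and the differences. *)
Lemma HB_tri_minus s (a a' b b' c c' : Tn d Z -> C) A' B B' D ea eb ec : alpha <= s ->
  HB s (fun k => a k - a' k)%C ea -> HB s (fun k => b k - b' k)%C eb ->
  HB s (fun k => c k - c' k)%C ec -> HB s a' A' -> HB s b B -> HB s b' B' -> HB s c D ->
  HB s (fun k => tri a b c k - tri a' b' c' k)%C
    (alg_cst s ^ 2 * ea * B * D + alg_cst s ^ 2 * A' * eb * D + alg_cst s ^ 2 * A' * B' * ec).
Proof.
  intros Hs Hea Heb Hec Ha' Hb Hb' Hc.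
  assert (HB s a (ea + A')) as Ha.
  { eapply HB_ext; [|apply (HB_plus _ _ _ _ _ Hea Ha')]; intros; cbv beta; ring. }
  assert (HB s c' (D + ec)) as Hc'.
  { eapply HB_ext; [|apply (HB_minus _ _ _ _ _ Hc Hec)]; intros; cbv beta; ring. }
  eapply HB_ext.
  { intros k; apply tri_minus; eapply HB_csummable; eauto. }
  repeat apply HB_plus; apply HB_tri; auto.
Qed.

Lemma tri_plus_3 (a b c c' : Tn d Z -> C) k :
  csummable a -> csummable b -> csummable c -> csummable c' ->
  tri a b (fun j => c j + c' j)%C k = (tri a b c k + tri a b c' k)%C.
Proof. intros; apply conv_plus_r; auto using csummable_conv. Qed.

Lemma tri_scal_1 z (a b c : Tn d Z -> C) k :
  csummable a -> csummable b -> csummable c ->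
  tri (fun j => z * a j)%C b c k = (z * tri a b c k)%C.
Proof.
  intros; unfold tri.
  rewrite (conv_ext _ (fun j => z * conv a b j)%C c c) by (intros; auto; now apply conv_scal_l).
  apply conv_scal_l; auto using csummable_conv.
Qed.

Lemma tri_scal_2 z (a b c : Tn d Z -> C) k :
  csummable a -> csummable b -> csummable c ->
  tri a (fun j => z * b j)%C c k = (z * tri a b c k)%C.
Proof.
  intros; unfold tri.
  rewrite (conv_ext _ (fun j => z * conv a b j)%C c c) by (intros; auto; now apply conv_scal_r).
  apply conv_scal_l; auto using csummable_conv.
Qed.

Lemma tri_scal_3 z (a b c : Tn d Z -> C) k :
  csummable a -> csummable b -> csummable c ->
  tri a b (fun j => z * c j)%C k = (z * tri a b c k)%C.
Proof. intros; apply conv_scal_r; auto using csummable_conv. Qed.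

End Algebra.

(** * Trilinear forms with a multiplier *)

(** The sum of [m k1 k2 k3 * a k1 * b k2 * c k3] over [k1 + k2 + k3 = k]. *)
Definition trim {d} (m : Tn d Z -> Tn d Z -> Tn d Z -> C) (a b c : Tn d Z -> C)
    (k : Tn d Z) : C :=
  csum (fun j => csum (fun i => m i (ksub j i) (ksub k j) * (a i * b (ksub j i)))
                 * c (ksub k j))%C.

Definition mult_bounded {d} (m : Tn d Z -> Tn d Z -> Tn d Z -> C) : Prop :=
  exists B, 0 <= B /\ forall i l r, Cmod (m i l r) <= B.

Lemma trim_inner_summable {d} m (a b : Tn d Z -> C) k j :
  mult_bounded m -> csummable a -> csummable b ->
  csummable (fun i => m i (ksub j i) (ksub k j) * (a i * b (ksub j i)))%C.
Proof.
  intros (M & HM & Hm) Ha Hb; destruct (conv_terms_summable a b j Ha Hb) as [B HB].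
  exists (M * B); eapply L1_le; [|apply (L1_scal _ _ _ HM HB)].
  intros i; rewrite Cmod_mult; apply Rmult_le_compat_r; [apply Cmod_ge_0|apply Hm].
Qed.

Lemma trim_outer_summable {d} m (a b c : Tn d Z -> C) k :
  mult_bounded m -> csummable a -> csummable b -> csummable c ->
  csummable (fun j => csum (fun i => m i (ksub j i) (ksub k j) * (a i * b (ksub j i)))
                      * c (ksub k j))%C.
Proof.
  intros (M & HM & Hm) [A HA] [B HB] [D HD].
  set (a1 := fun k => Cmod (a k)) in *; set (b1 := fun k => Cmod (b k)) in *.
  set (c1 := fun k => Cmod (c k)) in *.
  assert (forall k, 0 <= a1 k) as Ha by (intros; apply Cmod_ge_0).
  assert (forall k, 0 <= b1 k) as Hb by (intros; apply Cmod_ge_0).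
  assert (forall k, 0 <= c1 k) as Hc by (intros; apply Cmod_ge_0).
  assert (forall k, b1 k <= B) as HbB by (intros j; apply (L1_single _ _ j Hb HB)).
  assert (forall j, 0 <= rconv a1 b1 j) as Hr by (intros j; eapply rconv_nonneg; eauto).
  exists (M * (D * (A * B))).
  eapply L1_le; [|apply (L1_scal _ _ _ HM (L1_conv_terms (rconv a1 b1) c1 _ D k Hr Hc
    (young_L1 _ _ _ _ Ha Hb HA HB) (fun j => L1_single _ _ j Hc HD)))].
  intros j; cbv beta; rewrite Cmod_mult, <- Rmult_assoc.
  apply Rmult_le_compat_r; [apply Cmod_ge_0|].
  apply csum_bound. 
  eapply L1_le; [|apply (L1_scal _ _ _ HM (L1_rconv_terms a1 b1 A B j Ha Hb HA HbB))].
  intros i; cbv beta; rewrite !Cmod_mult; apply Rmult_le_compat_r; [|apply Hm].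
  apply Rmult_le_pos; apply Cmod_ge_0.
Qed.

Lemma trim_plus {d} m m' (a b c : Tn d Z -> C) k :
  mult_bounded m -> mult_bounded m' -> csummable a -> csummable b -> csummable c ->
  trim (fun i l r => m i l r + m' i l r)%C a b c k = (trim m a b c k + trim m' a b c k)%C.
Proof.
  intros Hm Hm' Ha Hb Hc; unfold trim.
  rewrite <- csum_plus by now apply trim_outer_summable.
  apply csum_ext; intros j.
  rewrite <- Cmult_plus_distr_r, <- csum_plus by now apply trim_inner_summable.
  f_equal; apply csum_ext; intros i; ring.
Qed.

Lemma trim_minus {d} m m' (a b c : Tn d Z -> C) k :
  mult_bounded m -> mult_bounded m' -> csummable a -> csummable b -> csummable c ->
  trim (fun i l r => m i l r - m' i l r)%C a b c k = (trim m a b c k - trim m' a b c k)%C.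
Proof.
  intros Hm Hm' Ha Hb Hc.
  assert (mult_bounded (fun i l r => m i l r - m' i l r)%C) as Hd.
  { destruct Hm as (M & HM & H), Hm' as (M' & HM' & H'); exists (M + M'); split; [lra|].
    intros i l r; unfold Cminus; eapply Rle_trans; [apply Cmod_triangle|].
    rewrite Cmod_opp; apply Rplus_le_compat; auto. }
  replace (trim m a b c k) with
    (trim (fun i l r => (m i l r - m' i l r) + m' i l r)%C a b c k).
  - rewrite (trim_plus _ m') by auto. ring.
  - unfold trim; apply csum_ext; intros j; f_equal; apply csum_ext; intros i; f_equal; ring.
Qed.

Lemma mult_bounded_ei {d} (f : Tn d Z -> Tn d Z -> Tn d Z -> R) :
  mult_bounded (fun i l r => ei (f i l r)).
Proof. exists 1; split; [lra|]; intros; rewrite Cmod_ei; lra. Qed.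

Lemma csummable_sg {d} s (x : Tn d Z -> C) : csummable x -> csummable (sg s x).
Proof.
  intros [B H]; exists B; eapply L1_le; [|apply H]; intros k.
  unfold sg; rewrite Cmod_mult, Cmod_ei; lra.
Qed.

(** The multiplier obtained when a triple product is conjugated by the free flow: [r] is the
    frequency of the conjugate, hence its opposite sign in the phase. *)
Definition mfull {d} (s : R) (i l r : Tn d Z) : C :=
  ei (s * (sqnorm (kadd (kadd i l) r) - sqnorm i - sqnorm l + sqnorm r)).

(** The part of the phase the scheme integrates exactly: it depends on the conjugate's frequency
    alone, so it is the action of a Fourier multiplier on that single factor. *)
Definition mpart {d} (s : R) (i l r : Tn d Z) : C := ei (2 * s * sqnorm r).

Lemma sg_tri_trim {d} s (a b c : Tn d Z -> C) k :
  csummable a -> csummable b -> csummable c ->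
  sg (- s) (tri d (sg s a) (sg s b) (sg (- s) c)) k = trim (mfull s) a b c k.
Proof.
  intros Ha Hb Hc; unfold sg at 1, tri, trim, conv at 1.
  rewrite <- csum_scal
    by (apply conv_terms_summable; auto using csummable_conv, csummable_sg).
  apply csum_ext; intros j; unfold conv.
  unfold sg at 3.
  rewrite Cmult_assoc, Cmult_assoc, (Cmult_comm _ (ei (- (- s * sqnorm (ksub k j))))), Cmult_assoc.
  f_equal.
  rewrite <- csum_scal by (apply conv_terms_summable; auto using csummable_sg).
  apply csum_ext; intros i; unfold sg, mfull.
  rewrite !kadd_ksub.
  replace (s * (sqnorm k - sqnorm i - sqnorm (ksub j i) + sqnorm (ksub k j))) with
    (- (- s * sqnorm (ksub k j)) + - (- s * sqnorm k) + - (s * sqnorm i)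
     + - (s * sqnorm (ksub j i))) by ring.
  rewrite !ei_plus; ring.
Qed.

Lemma tri_sg_trim {d} s (a b c : Tn d Z -> C) k :
  csummable a -> csummable b -> csummable c ->
  tri d a b (sg (- (2 * s)) c) k = trim (mpart s) a b c k.
Proof.
  intros Ha Hb Hc; unfold tri, trim, conv at 1.
  apply csum_ext; intros j; unfold conv, sg.
  rewrite Cmult_assoc, (Cmult_comm _ (ei _)).
  f_equal.
  rewrite <- csum_scal by (apply conv_terms_summable; auto).
  apply csum_ext; intros i; unfold mpart. f_equal; f_equal; ring.
Qed.

Section TrimBound.

Variables (d : nat) (alpha g Zc : R).
Hypothesis Halpha : 0 <= alpha.
Hypothesis Hg : 0 <= g.
Hypothesis HZ : 0 <= Zc.
Hypothesis Hsum : L1 (fun k : Tn d Z => Rpower (1 + sqnorm k) (- alpha)) (Zc ^ 2).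

Lemma wt_mixed s t (i l : Tn d Z) : 0 <= s -> 0 <= t ->
  wt s i * wt t l <= wt (s + t) i + wt (s + t) l.
Proof.
  intros Hs Ht; rewrite !wt_plus.
  pose proof (wt_pos s i); pose proof (wt_pos t i); pose proof (wt_pos s l); pose proof (wt_pos t l).
  destruct (Rle_dec (sqnorm i) (sqnorm l)) as [Hil|Hil].
  - assert (wt s i <= wt s l) by
      (unfold wt; pose proof (sqnorm_pos i); apply Rle_Rpower_l; lra). nra.
  - assert (wt t l <= wt t i) by
      (unfold wt; pose proof (sqnorm_pos l); apply Rle_Rpower_l; lra). nra.
Qed.

(** Expanding gives nine products of an alpha weight and a 2g weight. By [wt_mixed] a mixed product
    is at most the sum of the two combined weights, so each frequency is counted once on the
    diagonal and four times off it; this is the 5. *)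
Lemma wt_triple (i l r : Tn d Z) :
  wt alpha (kadd (kadd i l) r) * (wt (2 * g) i + wt (2 * g) l + wt (2 * g) r)
  <= 5 * wt_cst alpha ^ 2 *
     (wt (alpha + 2 * g) i + wt (alpha + 2 * g) l + wt (alpha + 2 * g) r).
Proof.
  assert (1 <= wt_cst alpha) as Hc.
  { unfold wt_cst; apply Rle_trans with (Rpower 4 0); [rewrite Rpower_base_0; lra|].
    apply Rpower_le_exp; lra. }
  set (cc := wt_cst alpha) in *.
  pose proof (wt_kadd alpha (kadd i l) r Halpha) as HK1.
  pose proof (wt_kadd alpha i l Halpha) as HK2. fold cc in HK1, HK2.
  pose proof (wt_pos alpha i); pose proof (wt_pos alpha l); pose proof (wt_pos alpha r).
  pose proof (wt_pos (2 * g) i); pose proof (wt_pos (2 * g) l); pose proof (wt_pos (2 * g) r).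
  assert (wt alpha (kadd (kadd i l) r) <= cc ^ 2 * (wt alpha i + wt alpha l + wt alpha r)) as HK.
  { eapply Rle_trans; [apply HK1|].
    apply Rle_trans with (cc * (cc * (wt alpha i + wt alpha l) + cc * wt alpha r)); [|right; ring].
    apply Rmult_le_compat_l; [lra|]. nra. }
  assert (0 <= 2 * g) as Hg2 by lra.
  pose proof (wt_mixed _ _ i l Halpha Hg2); pose proof (wt_mixed _ _ i r Halpha Hg2).
  pose proof (wt_mixed _ _ l i Halpha Hg2); pose proof (wt_mixed _ _ l r Halpha Hg2).
  pose proof (wt_mixed _ _ r i Halpha Hg2); pose proof (wt_mixed _ _ r l Halpha Hg2).
  pose proof (wt_plus alpha (2 * g) i); pose proof (wt_plus alpha (2 * g) l);
    pose proof (wt_plus alpha (2 * g) r).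
  apply Rle_trans with (cc ^ 2 * (wt alpha i + wt alpha l + wt alpha r)
    * (wt (2 * g) i + wt (2 * g) l + wt (2 * g) r)).
  { apply Rmult_le_compat_r; lra. }
  rewrite Rmult_assoc, (Rmult_comm 5), !Rmult_assoc.
  apply Rmult_le_compat_l; [apply pow_le; lra|]. lra.
Qed.

(** 15 is three Young terms times the 5 of [wt_triple]; [Zc ^ 2] comes from the two l1 factors in
    each term. *)
Definition trim_cst : R := 15 * wt_cst alpha ^ 2 * Zc ^ 2.

Lemma HB_weight_1 (x : Tn d Z -> C) B : HB (alpha + 1 + 2 * g) x B ->
  L1 (fun k => wt 1 k * Cmod (x k)) (Zc * B).
Proof.
  intros Hx.
  assert (HB alpha (fun k => RtoC (wt 1 k) * x k)%C (1 * B)) as H.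
  { eapply HB_dom; [lra|apply Hx|]; intros k.
    rewrite Cmod_mult, Cmod_R, (Rabs_pos_eq (wt 1 k)) by (left; apply wt_pos).
    rewrite Rmult_1_l, <- Rmult_assoc, <- wt_plus.
    apply Rmult_le_compat_r; [apply Cmod_ge_0|apply wt_mono; lra]. }
  rewrite Rmult_1_l in H; apply (HB_L1 _ _ _ HZ Hsum) in H.
  eapply L1_le; [|apply H]; intros k; cbv beta.
  rewrite Cmod_mult, Cmod_R, (Rabs_pos_eq (wt 1 k)) by (left; apply wt_pos); lra.
Qed.

(** After [wt_triple] exactly one factor carries alpha + 2g + 1 and goes to l2, while the other two
    carry weight 1 and go to l1 by [HB_weight_1]. The three choices of the l2 factor give the three
    terms of [T]. *)
Lemma HB_trim m (a b c : Tn d Z -> C) A Ba Bb Bc : 0 <= A ->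
  (forall i l r, Cmod (m i l r) <= A *
     (wt 1 i * wt 1 l * wt 1 r * (wt (2 * g) i + wt (2 * g) l + wt (2 * g) r))) ->
  HB (alpha + 1 + 2 * g) a Ba -> HB (alpha + 1 + 2 * g) b Bb -> HB (alpha + 1 + 2 * g) c Bc ->
  HB alpha (trim m a b c) (trim_cst * A * Ba * Bb * Bc).
Proof.
  intros HA0 Hm Ha Hb Hc.
  set (dl := alpha + 1 + 2 * g) in *.
  set (a0 := fun k => wt dl k * Cmod (a k)); set (b0 := fun k => wt dl k * Cmod (b k)).
  set (c0 := fun k => wt dl k * Cmod (c k)).
  set (a1 := fun k => wt 1 k * Cmod (a k)); set (b1 := fun k => wt 1 k * Cmod (b k)).
  set (c1 := fun k => wt 1 k * Cmod (c k)).
  assert (forall k, 0 <= a0 k) as Pa0 by (intros; apply wt_Cmod_nonneg).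
  assert (forall k, 0 <= b0 k) as Pb0 by (intros; apply wt_Cmod_nonneg).
  assert (forall k, 0 <= c0 k) as Pc0 by (intros; apply wt_Cmod_nonneg).
  assert (forall k, 0 <= a1 k) as Pa1 by (intros; apply wt_Cmod_nonneg).
  assert (forall k, 0 <= b1 k) as Pb1 by (intros; apply wt_Cmod_nonneg).
  assert (forall k, 0 <= c1 k) as Pc1 by (intros; apply wt_Cmod_nonneg).
  assert (L1 a1 (Zc * Ba)) as La by now apply HB_weight_1.
  assert (L1 b1 (Zc * Bb)) as Lb by now apply HB_weight_1.
  assert (L1 c1 (Zc * Bc)) as Lc by now apply HB_weight_1.
  assert (forall k, a0 k <= Ba) as Ua0 by (intros k; apply (L2_bounded _ _ k Ha)).
  assert (forall k, b0 k <= Bb) as Ub0 by (intros k; apply (L2_bounded _ _ k Hb)).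
  assert (forall k, c0 k <= Bc) as Uc0 by (intros k; apply (L2_bounded _ _ k Hc)).
  assert (forall k, b1 k <= Zc * Bb) as Ub1 by (intros k; apply (L1_single _ _ k Pb1 Lb)).
  assert (forall k, c1 k <= Zc * Bc) as Uc1 by (intros k; apply (L1_single _ _ k Pc1 Lc)).
  pose proof (young_L2_r b1 a0 _ _ Pb1 Pa0 Lb Ha) as Y01.
  pose proof (young_L2 a1 b0 _ _ Pa1 Pb0 La Hb) as Y10.
  pose proof (young_L1 a1 b1 _ _ Pa1 Pb1 La Lb) as Y11.
  assert (forall k, 0 <= rconv a0 b1 k) as P01.
  { intros k; eapply (rsum_ge (fun j => a0 j * b1 (ksub k j)) _ nil); [| |constructor].
    - intros j; apply Rmult_le_pos; auto.
    - eapply L1_rconv_terms_r; eauto. }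
  assert (forall k, 0 <= rconv a1 b0 k) as P10 by (intros k; eapply rconv_nonneg; eauto).
  assert (forall k, 0 <= rconv a1 b1 k) as P11 by (intros k; eapply rconv_nonneg; eauto).
  pose proof (young_L2_r c1 (rconv a0 b1) _ _ Pc1 P01 Lc Y01) as Y011.
  pose proof (young_L2_r c1 (rconv a1 b0) _ _ Pc1 P10 Lc Y10) as Y101.
  pose proof (young_L2 (rconv a1 b1) c0 _ _ P11 Pc0 Y11 Hc) as Y110.
  set (K := A * (5 * wt_cst alpha ^ 2)).
  assert (0 <= K) as HK.
  { unfold K; apply Rmult_le_pos; auto. pose proof (pow2_ge_0 (wt_cst alpha)); lra. }
  set (T := fun k => K * rconv (rconv a0 b1) c1 k + (K * rconv (rconv a1 b0) c1 k
                     + K * rconv (rconv a1 b1) c0 k)).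
  assert (forall k, wt alpha k * Cmod (trim m a b c k) <= T k) as HT.
  { intros k; unfold trim; apply csum_bound_scaled; [apply wt_pos|].
    eapply L1_le; [|apply L1_plus; [|apply L1_plus]; (apply L1_scal; [exact HK|])].
    2:{ eapply L1_rconv_terms_r; eauto; intros j; apply (L2_bounded _ _ j Y01). }
    2:{ eapply L1_rconv_terms_r; eauto; intros j; apply (L2_bounded _ _ j Y10). }
    2:{ eapply L1_rconv_terms; eauto. }
    intros j; cbv beta. rewrite Cmod_mult.
    set (kj := ksub k j).
    (* To enter the inner sum, [csum_bound_scaled] needs a strictly positive prefactor, so a
       vanishing outer coefficient is treated apart. *)
    destruct (Req_dec (Cmod (c kj)) 0) as [E0|E0].
    { rewrite E0, !Rmult_0_r.
      assert (0 <= rconv a0 b1 j * c1 kj) by (apply Rmult_le_pos; auto).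
      assert (0 <= rconv a1 b0 j * c1 kj) by (apply Rmult_le_pos; auto).
      assert (0 <= rconv a1 b1 j * c0 kj) by (apply Rmult_le_pos; auto).
      assert (0 <= K * (rconv a0 b1 j * c1 kj)) by (apply Rmult_le_pos; auto).
      assert (0 <= K * (rconv a1 b0 j * c1 kj)) by (apply Rmult_le_pos; auto).
      assert (0 <= K * (rconv a1 b1 j * c0 kj)) by (apply Rmult_le_pos; auto).
      lra. }
    assert (0 < Cmod (c kj)) as E1 by (pose proof (Cmod_ge_0 (c kj)); lra).
    rewrite (Rmult_comm (Cmod _) (Cmod (c kj))), <- Rmult_assoc.
    apply csum_bound_scaled; [apply Rmult_lt_0_compat; auto; apply wt_pos|].
    replace (K * (rconv a0 b1 j * c1 kj) + (K * (rconv a1 b0 j * c1 kj) + K * (rconv a1 b1 j * c0 kj)))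
      with (K * c1 kj * rconv a0 b1 j + (K * c1 kj * rconv a1 b0 j + K * c0 kj * rconv a1 b1 j)) by ring.
    eapply L1_le; [|apply L1_plus; [|apply L1_plus]; (apply L1_scal; [now apply Rmult_le_pos|])].
    2:{ eapply L1_rconv_terms_r; eauto. }
    2:{ eapply L1_rconv_terms; eauto. }
    2:{ eapply L1_rconv_terms; eauto. }
    intros i; cbv beta. set (ji := ksub j i).
    pose proof (wt_triple i ji kj) as HW.
    replace (kadd (kadd i ji) kj) with k in HW by (unfold ji, kj; now rewrite !kadd_ksub).
    rewrite !Cmod_mult. specialize (Hm i ji kj).
    unfold K, a0, b0, c0, a1, b1, c1.
    replace dl with (alpha + 2 * g + 1) by (unfold dl; ring).
    rewrite !(wt_plus (alpha + 2 * g) 1).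
    set (X := Cmod (a i) * Cmod (b ji) * Cmod (c kj)).
    assert (0 <= X) as HX by (unfold X; repeat apply Rmult_le_pos; apply Cmod_ge_0).
    set (V := wt 1 i * wt 1 ji * wt 1 kj) in *.
    assert (0 <= V) as HV by (unfold V; repeat apply Rmult_le_pos; left; apply wt_pos).
    pose proof (wt_pos alpha k) as Hw.
    apply Rle_trans with (A * V * X * (wt alpha k *
      (wt (2 * g) i + wt (2 * g) ji + wt (2 * g) kj))).
    - replace (wt alpha k * Cmod (c kj) * (Cmod (m i ji kj) * (Cmod (a i) * Cmod (b ji))))
        with (Cmod (m i ji kj) * (wt alpha k * X)) by (unfold X; ring).
      eapply Rle_trans; [apply Rmult_le_compat_r; [|apply Hm]; apply Rmult_le_pos; lra|].
      right; ring.
    - eapply Rle_trans; [apply Rmult_le_compat_l; [|apply HW];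
        apply Rmult_le_pos; [apply Rmult_le_pos|]; auto|].
      right; unfold V, X; ring. }
  replace (trim_cst * A * Ba * Bb * Bc) with
    (K * (Zc * Bc * (Zc * Bb * Ba)) + (K * (Zc * Bc * (Zc * Ba * Bb)) + K * (Zc * Ba * (Zc * Bb) * Bc)))
    by (unfold trim_cst, K; ring).
  assert (forall f B, (forall k : Tn d Z, 0 <= f k) -> L2 f B -> L2 (fun k => K * f k) (K * B)) as HL.
  { intros f B Hf HB; eapply L2_le; [auto|apply HB|].
    intros k; rewrite Rabs_pos_eq; [lra|]. apply Rmult_le_pos; auto. }
  assert (forall k, 0 <= rconv (rconv a0 b1) c1 k) as Q1.
  { intros k; eapply (rsum_ge (fun j => rconv a0 b1 j * c1 (ksub k j)) _ nil); [| |constructor].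
    - intros j; apply Rmult_le_pos; auto.
    - eapply L1_rconv_terms_r; eauto; intros j; apply (L2_bounded _ _ j Y01). }
  assert (forall k, 0 <= rconv (rconv a1 b0) c1 k) as Q2.
  { intros k; eapply (rsum_ge (fun j => rconv a1 b0 j * c1 (ksub k j)) _ nil); [| |constructor].
    - intros j; apply Rmult_le_pos; auto.
    - eapply L1_rconv_terms_r; eauto; intros j; apply (L2_bounded _ _ j Y10). }
  assert (forall k, 0 <= rconv (rconv a1 b1) c0 k) as Q3
    by (intros k; eapply rconv_nonneg; eauto).
  eapply L2_plus; [apply (HL _ _ Q1 Y011)|
    eapply L2_plus; [apply (HL _ _ Q2 Y101)|apply (HL _ _ Q3 Y110)|]|].
  - intros k; cbv beta. rewrite Rabs_pos_eq; [apply Rle_refl|].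
    pose proof (Rmult_le_pos _ _ HK (Q2 k)); pose proof (Rmult_le_pos _ _ HK (Q3 k)); lra.
  - intros k; rewrite Rabs_pos_eq by apply wt_Cmod_nonneg. apply HT.
Qed.

(** The part of the phase that the scheme neglects: it contains only products of
    two different frequencies, each of which costs one derivative. *)
Definition kpsi (i l r : Tn d Z) : R := 2 * (kip i l + kip i r + kip l r).

Lemma phase_split (i l r : Tn d Z) :
  sqnorm (kadd (kadd i l) r) - sqnorm i - sqnorm l + sqnorm r = 2 * sqnorm r + kpsi i l r.
Proof. unfold kpsi; rewrite !sqnorm_kadd, kip_kadd_l; ring. Qed.

(** Each inner product costs one weight at two frequencies, and the third weight, being at least 1,
    is inserted for symmetry. The 6 is the factor 2 times the three pairs. *)
Lemma kpsi_le (i l r : Tn d Z) : Rabs (kpsi i l r) <= 6 * (wt 1 i * wt 1 l * wt 1 r).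
Proof.
  pose proof (kip_le_wt i l); pose proof (kip_le_wt i r); pose proof (kip_le_wt l r).
  assert (1 <= wt 1 i) by (apply wt_ge_1; lra).
  assert (1 <= wt 1 l) by (apply wt_ge_1; lra).
  assert (1 <= wt 1 r) by (apply wt_ge_1; lra).
  unfold kpsi; rewrite Rabs_mult, (Rabs_pos_eq 2) by lra.
  pose proof (Rabs_triang (kip i l + kip i r) (kip l r)).
  pose proof (Rabs_triang (kip i l) (kip i r)).
  assert (0 <= wt 1 i * wt 1 l) by (apply Rmult_le_pos; lra).
  assert (0 <= wt 1 i * wt 1 r) by (apply Rmult_le_pos; lra).
  assert (0 <= wt 1 l * wt 1 r) by (apply Rmult_le_pos; lra).
  assert (wt 1 i * wt 1 l <= wt 1 i * wt 1 l * wt 1 r) by nra.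
  assert (wt 1 i * wt 1 r <= wt 1 i * wt 1 l * wt 1 r) by nra.
  assert (wt 1 l * wt 1 r <= wt 1 i * wt 1 l * wt 1 r) by nra.
  lra.
Qed.

Definition mdiff (s : R) (i l r : Tn d Z) : C := (mfull s i l r - mpart s i l r)%C.

Lemma mdiff_bounded s : mult_bounded (mdiff s).
Proof.
  exists 2; split; [lra|]; intros i l r; unfold mdiff, mfull, mpart, Cminus.
  eapply Rle_trans; [apply Cmod_triangle|]. rewrite Cmod_opp, !Cmod_ei; lra.
Qed.

(** For the one-sided starting step, first order in [s] suffices and a single sine is estimated. The
    sum of 2g weights is at least 1 and brings the bound into the form expected by [HB_trim]. *)
Lemma mdiff_le s (i l r : Tn d Z) : Cmod (mdiff s i l r) <= 6 * Rabs s *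
  (wt 1 i * wt 1 l * wt 1 r * (wt (2 * g) i + wt (2 * g) l + wt (2 * g) r)).
Proof.
  unfold mdiff, mfull, mpart; rewrite phase_split, Cmod_ei_minus.
  replace ((s * (2 * sqnorm r + kpsi i l r) - 2 * s * sqnorm r) / 2)
    with (s * (kpsi i l r / 2)) by field.
  pose proof (Rabs_sin_le (s * (kpsi i l r / 2))) as H.
  rewrite Rabs_mult in H. unfold Rdiv in H at 2. rewrite (Rabs_mult (kpsi i l r)) in H.
  rewrite (Rabs_pos_eq (/ 2)) in H by lra.
  pose proof (kpsi_le i l r) as H1.
  pose proof (Rabs_pos s) as Hs.
  assert (1 <= wt (2 * g) i) by (apply wt_ge_1; lra).
  assert (1 <= wt (2 * g) l) by (apply wt_ge_1; lra).
  assert (1 <= wt (2 * g) r) by (apply wt_ge_1; lra).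
  set (V := wt 1 i * wt 1 l * wt 1 r) in *.
  assert (0 <= V) as HV by (unfold V; repeat apply Rmult_le_pos; left; apply wt_pos).
  apply Rle_trans with (Rabs s * (6 * V)); [nra|].
  assert (0 <= Rabs s * V) by nra. nra.
Qed.

(** The sum over both times is real, a difference of two cosines, hence a product of sines. One sine
    is bounded linearly and yields s |psi| / 2; the other is interpolated with exponent g. The
    constant is 4 (product formula) times 3 (half of the 6 in [kpsi_le]) times 9 (phase size). *)
Lemma mdiff_sum_le s (i l r : Tn d Z) : g <= 1 -> 0 < s ->
  Cmod (mdiff s i l r + mdiff (- s) i l r) <= 108 * (Rpower s g * s) *
  (wt 1 i * wt 1 l * wt 1 r * (wt (2 * g) i + wt (2 * g) l + wt (2 * g) r)).
Proof.
  intros Hg1 Hs; unfold mdiff, mfull, mpart; rewrite phase_split.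
  set (ps := kpsi i l r). set (ka := sqnorm r).
  assert (Cmod (ei (s * (2 * ka + ps)) - ei (2 * s * ka) + (ei (- s * (2 * ka + ps)) - ei (2 * - s * ka)))
    = 4 * Rabs (sin (s * (ps / 2))) * Rabs (sin (s * (2 * ka + ps / 2)))) as ->.
  { replace (- s * (2 * ka + ps)) with (- (s * (2 * ka + ps))) by ring.
    replace (2 * - s * ka) with (- (2 * s * ka)) by ring.
    replace (ei (s * (2 * ka + ps)) - ei (2 * s * ka)
      + (ei (- (s * (2 * ka + ps))) - ei (- (2 * s * ka))))%C
      with (RtoC (2 * (cos (s * (2 * ka + ps)) - cos (2 * s * ka)))).
    - rewrite Cmod_R, form2.
      replace ((s * (2 * ka + ps) - 2 * s * ka) / 2) with (s * (ps / 2)) by field.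
      replace ((s * (2 * ka + ps) + 2 * s * ka) / 2) with (s * (2 * ka + ps / 2)) by field.
      rewrite !Rabs_mult. rewrite (Rabs_left (-2)) by lra. rewrite (Rabs_pos_eq 2) by lra. ring.
    - unfold ei; rewrite !cos_neg, !sin_neg. apply injective_projections; simpl; ring. }
  pose proof (Rabs_sin_le (s * (ps / 2))) as H1.
  rewrite Rabs_mult, (Rabs_pos_eq s) in H1 by lra.
  assert (Rabs (ps / 2) = Rabs ps / 2) as E2.
  { unfold Rdiv; rewrite Rabs_mult, (Rabs_pos_eq (/ 2)); lra. }
  pose proof (kpsi_le i l r) as H2; fold ps in H2.
  pose proof (sqnorm_pos i) as Ki; pose proof (sqnorm_pos l) as Kl; pose proof (sqnorm_pos r) as Kr.
  (* The maximum of the three brackets: its g-th power is one of the three 2g weights, hence at most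
     their sum. The second phase is at most s times 5 [mx]; the 9 below leaves room. *)
  set (mx := Rmax (Rmax (1 + sqnorm i) (1 + sqnorm l)) (1 + sqnorm r)).
  assert (1 + sqnorm i <= mx /\ 1 + sqnorm l <= mx /\ 1 + sqnorm r <= mx) as (Mi & Ml & Mr).
  { unfold mx; repeat split; [| |apply Rmax_r];
      (eapply Rle_trans; [|apply Rmax_l]); [apply Rmax_l|apply Rmax_r]. }
  assert (Rpower mx g <= wt (2 * g) i + wt (2 * g) l + wt (2 * g) r) as H3.
  { unfold wt. replace (2 * g / 2) with g by field.
    pose proof (Rpower_pos (1 + sqnorm i) g); pose proof (Rpower_pos (1 + sqnorm l) g);
      pose proof (Rpower_pos (1 + sqnorm r) g).
    unfold mx, Rmax; repeat destruct Rle_dec; lra. }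
  assert (Rabs (sin (s * (2 * ka + ps / 2))) <= Rpower (s * (9 * mx)) g) as H4.
  { apply Rabs_sin_le_Rpower; [|nra|lra].
    rewrite Rabs_mult, (Rabs_pos_eq s) by lra; apply Rmult_le_compat_l; [lra|].
    eapply Rle_trans; [apply Rabs_triang|]. rewrite (Rabs_pos_eq (2 * ka)) by (unfold ka; lra).
    rewrite E2. unfold ps, kpsi, ka; rewrite Rabs_mult, (Rabs_pos_eq 2) by lra.
    pose proof (kip_le_sum i l); pose proof (kip_le_sum i r); pose proof (kip_le_sum l r).
    pose proof (Rabs_triang (kip i l + kip i r) (kip l r)).
    pose proof (Rabs_triang (kip i l) (kip i r)). lra. }
  assert (Rpower (s * (9 * mx)) g <= 9 * Rpower s g * Rpower mx g) as H5.
  { rewrite <- !Rpower_mult_distr by lra.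
    assert (Rpower 9 g <= Rpower 9 1) as H by (apply Rpower_le_exp; lra).
    rewrite Rpower_1 in H by lra.
    pose proof (Rpower_pos s g); pose proof (Rpower_pos mx g).
    rewrite <- !Rmult_assoc, (Rmult_comm _ (Rpower 9 g)).
    apply Rmult_le_compat_r; [lra|]. apply Rmult_le_compat_r; lra. }
  set (V := wt 1 i * wt 1 l * wt 1 r) in *.
  set (W := wt (2 * g) i + wt (2 * g) l + wt (2 * g) r) in *.
  assert (0 <= V) as HV by (unfold V; repeat apply Rmult_le_pos; left; apply wt_pos).
  pose proof (Rpower_pos s g) as Hp; pose proof (Rpower_pos mx g) as Hm'.
  apply Rle_trans with (4 * (s * (3 * V)) * (9 * Rpower s g * W)); [|right; ring].
  apply Rmult_le_compat.
  - apply Rmult_le_pos; [lra|apply Rabs_pos].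
  - apply Rabs_pos.
  - apply Rmult_le_compat_l; [lra|]. eapply Rle_trans; [apply H1|].
    apply Rmult_le_compat_l; [lra|]. rewrite E2; lra.
  - eapply Rle_trans; [apply H4|]. eapply Rle_trans; [apply H5|].
    apply Rmult_le_compat_l; [lra|auto].
Qed.

End TrimBound.

(** * Calculus of complex-valued functions of one real variable *)

(** Taken componentwise, so that [auto_derive] and the real mean value theorem apply directly. *)
Definition cderive (f : R -> C) (t : R) (w : C) : Prop :=
  is_derive (fun s => Re (f s)) t (Re w) /\ is_derive (fun s => Im (f s)) t (Im w).

Lemma is_derive_eps (f : R -> R) x l :
  is_derive f x l <-> forall eps, 0 < eps -> exists delta, 0 < delta /\
    forall h, Rabs h < delta -> Rabs (f (x + h) - f x - h * l) <= eps * Rabs h.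
Proof.
  split.
  - intros H%is_derive_Reals eps Heps; destruct (H eps Heps) as [delta Hd].
    exists delta; split; [apply cond_pos|]; intros h Hh.
    destruct (Req_dec h 0) as [->|H0].
    + rewrite Rplus_0_r, Rmult_0_l, Rabs_R0.
      replace (f x - f x - 0) with 0 by ring. rewrite Rabs_R0; lra.
    + specialize (Hd h H0 Hh).
      replace (f (x + h) - f x - h * l) with (((f (x + h) - f x) / h - l) * h) by (field; auto).
      rewrite Rabs_mult; apply Rmult_le_compat_r; [apply Rabs_pos|lra].
  - intros H; apply is_derive_Reals; intros eps Heps.
    destruct (H (eps / 2) ltac:(lra)) as (delta & Hd0 & Hd).
    exists (mkposreal delta Hd0); intros h H0 Hh; specialize (Hd h Hh).
    replace (f (x + h) - f x - h * l) with (((f (x + h) - f x) / h - l) * h) in Hd by (field; auto).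
    rewrite Rabs_mult in Hd; apply Rmult_le_reg_r in Hd; [lra|now apply Rabs_pos_lt].
Qed.

Lemma cderive_eps (f : R -> C) t w :
  cderive f t w <-> forall eps, 0 < eps -> exists delta, 0 < delta /\
    forall h, Rabs h < delta -> Cmod (f (t + h)%R - f t - h * w) <= eps * Rabs h.
Proof.
  split.
  - intros [H1 H2] eps Heps.
    destruct (proj1 (is_derive_eps _ _ _) H1 (eps / 2) ltac:(lra)) as (d1 & Hd1 & K1).
    destruct (proj1 (is_derive_eps _ _ _) H2 (eps / 2) ltac:(lra)) as (d2 & Hd2 & K2).
    exists (Rmin d1 d2); split; [now apply Rmin_pos|]; intros h Hh.
    specialize (K1 h (Rlt_le_trans _ _ _ Hh (Rmin_l _ _))).
    specialize (K2 h (Rlt_le_trans _ _ _ Hh (Rmin_r _ _))).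
    set (z := (f (t + h)%R - f t - h * w)%C).
    assert (Re z = Re (f (t + h)) - Re (f t) - h * Re w) as E1
      by (unfold z; simpl; unfold Re, Im; ring).
    assert (Im z = Im (f (t + h)) - Im (f t) - h * Im w) as E2
      by (unfold z; simpl; unfold Re, Im; ring).
    rewrite <- E1 in K1; rewrite <- E2 in K2.
    pose proof (Cmod_sqr z) as E. pose proof (Cmod_ge_0 z).
    rewrite <- (pow2_abs (Re z)), <- (pow2_abs (Im z)) in E.
    pose proof (Rabs_pos (Re z)); pose proof (Rabs_pos (Im z)).
    apply Rnot_lt_le; intros K. nra.
  - intros H; split; apply is_derive_eps; intros eps Heps;
      destruct (H eps Heps) as (dl & Hd & K); exists dl; split; auto; intros h Hh;
      specialize (K h Hh); (eapply Rle_trans; [|apply K]).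
    + eapply Rle_trans; [|apply Rabs_Re_le]; right; f_equal; simpl; unfold Re, Im; ring.
    + eapply Rle_trans; [|apply Rabs_Im_le]; right; f_equal; simpl; unfold Re, Im; ring.
Qed.

(** The product norm of [C_R_NormedModule] unfolds to [Cmod], so both notions share the epsilon form
    of [cderive_eps]. *)
Lemma cderive_is_derive (f : R -> C) t w :
  is_derive (V := C_R_NormedModule) f t w -> cderive f t w.
Proof.
  intros [_ H]; apply cderive_eps; intros eps Heps.
  specialize (H t (fun P HP => HP)); specialize (H (mkposreal eps Heps)).
  destruct H as [dl Hd]; exists dl; split; [apply cond_pos|]; intros h Hh.
  assert (ball t dl (t + h)) as Hb.
  { unfold ball; simpl; unfold AbsRing_ball, abs, minus, plus, opp; simpl.
    replace (t + h + - t) with h by ring; auto. }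
  specialize (Hd (t + h) Hb).
  unfold norm in Hd; simpl in Hd; unfold prod_norm in Hd; simpl in Hd.
  unfold norm, abs, minus, plus, opp, scal in Hd; simpl in Hd.
  unfold prod_plus, prod_opp, prod_scal, plus, opp, scal, mult in Hd; simpl in Hd.
  unfold mult in Hd; simpl in Hd.
  replace (t + h + - t) with h in Hd by ring.
  eapply Rle_trans; [|exact Hd]. unfold Cmod; right; f_equal.
  cbn [fst snd pow Cminus Cplus Copp Cmult RtoC].
  rewrite !Rmult_1_r, <- !Rabs_mult, !Rabs_pos_eq by apply Rle_0_sqr.
  unfold Cminus, Cplus, Copp, Cmult; simpl. ring.
Qed.

Lemma cderive_ext_loc (f g : R -> C) t w : (exists delta, 0 < delta /\
    forall s, Rabs (s - t) < delta -> f s = g s) -> cderive f t w -> cderive g t w.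
Proof.
  intros (dl & Hd & E) H; rewrite cderive_eps in H |- *; intros eps Heps.
  destruct (H eps Heps) as (d1 & Hd1 & K); exists (Rmin d1 dl); split; [now apply Rmin_pos|].
  intros h Hh; rewrite <- !E.
  - apply K; eapply Rlt_le_trans; [apply Hh|apply Rmin_l].
  - now rewrite Rminus_diag, Rabs_R0.
  - replace (t + h - t) with h by ring; eapply Rlt_le_trans; [apply Hh|apply Rmin_r].
Qed.

Lemma cderive_ext (f g : R -> C) t w : (forall s, f s = g s) -> cderive f t w -> cderive g t w.
Proof. intros E; apply cderive_ext_loc; exists 1; split; [lra|auto]. Qed.

Lemma cderive_val (f : R -> C) t w w' : w = w' -> cderive f t w -> cderive f t w'.
Proof. now intros ->. Qed.

Lemma cderive_plus f g t a b : cderive f t a -> cderive g t b ->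
  cderive (fun s => f s + g s)%C t (a + b)%C.
Proof. intros [H1 H2] [H3 H4]; split; apply (is_derive_plus (V := R_NormedModule)); auto. Qed.

Lemma cderive_minus f g t a b : cderive f t a -> cderive g t b ->
  cderive (fun s => f s - g s)%C t (a - b)%C.
Proof. intros [H1 H2] [H3 H4]; split; apply (is_derive_minus (V := R_NormedModule)); auto. Qed.

Lemma cderive_const c t : cderive (fun _ => c) t 0%C.
Proof. split; apply (is_derive_const (V := R_NormedModule)). Qed.

Lemma is_derive_Rmult (f g : R -> R) t a b : is_derive f t a -> is_derive g t b ->
  is_derive (fun s => f s * g s) t (a * g t + f t * b).
Proof. rewrite !is_derive_Reals; apply derivable_pt_lim_mult. Qed.

Lemma cderive_mult f g t a b : cderive f t a -> cderive g t b ->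
  cderive (fun s => f s * g s)%C t (a * g t + f t * b)%C.
Proof.
  intros [H1 H2] [H3 H4]; split.
  - replace (Re (a * g t + f t * b)) with
      ((Re a * Re (g t) + Re (f t) * Re b) - (Im a * Im (g t) + Im (f t) * Im b))
      by (simpl; unfold Re, Im; ring).
    apply (is_derive_minus (V := R_NormedModule) (fun s => Re (f s) * Re (g s))
             (fun s => Im (f s) * Im (g s))); now apply is_derive_Rmult.
  - replace (Im (a * g t + f t * b)) with
      ((Re a * Im (g t) + Re (f t) * Im b) + (Im a * Re (g t) + Im (f t) * Re b))
      by (simpl; unfold Re, Im; ring).
    apply (is_derive_plus (V := R_NormedModule) (fun s => Re (f s) * Im (g s))
             (fun s => Im (f s) * Re (g s))); now apply is_derive_Rmult.
Qed.

Lemma cderive_scal c f t a : cderive f t a -> cderive (fun s => c * f s)%C t (c * a)%C.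
Proof.
  intros H; eapply cderive_val; [|apply (cderive_mult _ _ _ _ _ (cderive_const c t) H)].
  ring.
Qed.

Lemma cderive_affine f e t0 t a : cderive f (t0 + e * t) a ->
  cderive (fun s => f (t0 + e * s)) t (e * a)%C.
Proof.
  intros [H1 H2].
  assert (is_derive (fun s => t0 + e * s) t e) as He by (auto_derive; [auto|ring]).
  split.
  - pose proof (is_derive_comp (V := R_NormedModule) (fun s => Re (f s)) _ t _ _ H1 He) as H.
    replace (Re (e * a)) with (scal e (Re a)); [exact H|].
    unfold scal; simpl; unfold mult; simpl; unfold Re, Im; ring.
  - pose proof (is_derive_comp (V := R_NormedModule) (fun s => Im (f s)) _ t _ _ H2 He) as H.
    replace (Im (e * a)) with (scal e (Im a)); [exact H|].
    unfold scal; simpl; unfold mult; simpl; unfold Re, Im; ring.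
Qed.

Lemma cderive_ei l t : cderive (fun s => ei (s * l)) t (Ci * l * ei (t * l))%C.
Proof.
  split; unfold ei; simpl.
  - auto_derive; auto; ring.
  - auto_derive; auto; ring.
Qed.

Lemma cderive_id_scal c t : cderive (fun s : R => s * c)%C t c.
Proof.
  split; simpl; unfold Re, Im; auto_derive; auto; simpl; ring.
Qed.

(** Continuity relative to a closed interval: nothing is assumed beyond its
    end points. *)
Definition rcont (f : R -> C) (a b : R) : Prop :=
  forall x, a <= x <= b -> forall eps, 0 < eps -> exists delta, 0 < delta /\
    forall y, a <= y <= b -> Rabs (y - x) < delta -> Cmod (f y - f x) < eps.

Definition rcontR (f : R -> R) (a b : R) : Prop :=
  forall x, a <= x <= b -> forall eps, 0 < eps -> exists delta, 0 < delta /\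
    forall y, a <= y <= b -> Rabs (y - x) < delta -> Rabs (f y - f x) < eps.

(** Nothing is known outside [a, b], so [f] is composed with the clamp [cl] to that interval. The
    clamp is 1-Lipschitz and locally the identity inside, so the composite is continuous at the end
    points and keeps its derivative. *)
Lemma mvt_closed (f f' : R -> R) a b : a < b -> rcontR f a b ->
  (forall x, a < x < b -> is_derive f x (f' x)) ->
  exists c, a < c < b /\ f b - f a = f' c * (b - a).
Proof.
  intros Hab Hc Hd.
  set (cl := fun x => Rmax a (Rmin b x)).
  assert (forall x, a <= cl x <= b) as Hcl.
  { intros x; unfold cl, Rmax, Rmin; repeat destruct Rle_dec; lra. }
  assert (forall x, a <= x <= b -> cl x = x) as Hcx.
  { intros x Hx; unfold cl, Rmax, Rmin; repeat destruct Rle_dec; lra. }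
  assert (forall x y, Rabs (cl y - cl x) <= Rabs (y - x)) as Hlip.
  { intros x y; unfold cl, Rmax, Rmin, Rabs; repeat destruct Rle_dec; repeat destruct Rcase_abs; lra. }
  assert (forall x, a < x < b -> derivable_pt_lim (fun x => f (cl x)) x (f' x)) as Hd'.
  { intros x Hx; apply is_derive_Reals.
    eapply is_derive_ext_loc; [|apply Hd, Hx].
    assert (0 < Rmin (x - a) (b - x)) as Hm by (apply Rmin_pos; lra).
    exists (mkposreal _ Hm); intros y Hy.
    unfold ball in Hy; simpl in Hy; unfold AbsRing_ball, abs, minus, plus, opp in Hy; simpl in Hy.
    pose proof (Rmin_l (x - a) (b - x)); pose proof (Rmin_r (x - a) (b - x)).
    apply Rabs_def2 in Hy. rewrite Hcx; auto; lra. }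
  assert (forall x, a <= x <= b -> continuity_pt (fun x => f (cl x)) x) as Hc'.
  { intros x Hx eps Heps; destruct (Hc (cl x) (Hcl x) eps Heps) as (dl & Hdl & K).
    exists dl; split; auto; intros y [_ Hy]; simpl in *; unfold Rdist in *.
    apply K; auto. eapply Rle_lt_trans; [apply Hlip|auto]. }
  destruct (MVT (fun x => f (cl x)) id a b
    (fun c P => exist _ (f' c) (Hd' c P)) (fun c _ => derivable_pt_id c)) as (c & P & E); auto.
  { intros; apply derivable_continuous_pt, derivable_pt_id. }
  exists c; split; auto.
  rewrite derive_pt_id in E. simpl in E. unfold id in E. rewrite !Hcx in E by lra. lra.
Qed.

Lemma rcont_plus f g a b : rcont f a b -> rcont g a b -> rcont (fun t => f t + g t)%C a b.
Proof.
  intros Hf Hg x Hx eps Heps.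
  destruct (Hf x Hx (eps / 2) ltac:(lra)) as (d1 & Hd1 & K1).
  destruct (Hg x Hx (eps / 2) ltac:(lra)) as (d2 & Hd2 & K2).
  exists (Rmin d1 d2); split; [now apply Rmin_pos|]; intros y Hy Hyx.
  specialize (K1 y Hy (Rlt_le_trans _ _ _ Hyx (Rmin_l _ _))).
  specialize (K2 y Hy (Rlt_le_trans _ _ _ Hyx (Rmin_r _ _))).
  replace (f y + g y - (f x + g x))%C with ((f y - f x) + (g y - g x))%C by ring.
  eapply Rle_lt_trans; [apply Cmod_triangle|lra].
Qed.

Lemma Cmult_continuous (z w : C) eps : 0 < eps -> exists eta, 0 < eta /\
  forall z' w', Cmod (z' - z) < eta -> Cmod (w' - w) < eta -> Cmod (z' * w' - z * w) < eps.
Proof.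
  intros Heps. set (A := Cmod z + Cmod w + 1).
  pose proof (Cmod_ge_0 z) as Hz; pose proof (Cmod_ge_0 w) as Hw.
  assert (0 < eps / A) as He by (apply Rdiv_lt_0_compat; unfold A; lra).
  exists (Rmin 1 (eps / A)); split; [apply Rmin_pos; lra|]; intros z' w' H1 H2.
  pose proof (Rmin_l 1 (eps / A)); pose proof (Rmin_r 1 (eps / A)).
  set (eta := Rmin 1 (eps / A)) in *.
  replace (z' * w' - z * w)%C with ((z' - z) * w + (z * (w' - w) + (z' - z) * (w' - w)))%C by ring.
  pose proof (Cmod_triangle ((z' - z) * w) (z * (w' - w) + (z' - z) * (w' - w))) as T1.
  pose proof (Cmod_triangle (z * (w' - w)) ((z' - z) * (w' - w))) as T2.
  rewrite Cmod_mult in T1; rewrite (Cmod_mult z), (Cmod_mult (z' - z)) in T2.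
  pose proof (Cmod_ge_0 (z' - z)) as P1; pose proof (Cmod_ge_0 (w' - w)) as P2.
  assert (Cmod (z' - z) * Cmod w <= eta * Cmod w) by (apply Rmult_le_compat_r; lra).
  assert (Cmod z * Cmod (w' - w) <= Cmod z * eta) by (apply Rmult_le_compat_l; lra).
  assert (Cmod (z' - z) * Cmod (w' - w) < eta).
  { apply Rle_lt_trans with (1 * Cmod (w' - w)); [apply Rmult_le_compat_r|]; lra. }
  assert (eta * A <= eps / A * A) as H6
    by (apply Rmult_le_compat_r; [unfold A; lra|auto]).
  replace (eps / A * A) with eps in H6 by (field; unfold A; lra).
  unfold A in H6; lra.
Qed.

Lemma rcont_mult f g a b : rcont f a b -> rcont g a b -> rcont (fun t => f t * g t)%C a b.
Proof.
  intros Hf Hg x Hx eps Heps.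
  destruct (Cmult_continuous (f x) (g x) eps Heps) as (eta & He & K).
  destruct (Hf x Hx _ He) as (d1 & Hd1 & K1); destruct (Hg x Hx _ He) as (d2 & Hd2 & K2).
  exists (Rmin d1 d2); split; [now apply Rmin_pos|]; intros y Hy Hyx; apply K.
  - apply K1, (Rlt_le_trans _ _ _ Hyx (Rmin_l _ _)); auto.
  - apply K2, (Rlt_le_trans _ _ _ Hyx (Rmin_r _ _)); auto.
Qed.

Lemma rcont_cderive f f' a b : (forall t, cderive f t (f' t)) -> rcont f a b.
Proof.
  intros H x _ eps Heps.
  destruct (proj1 (cderive_eps _ _ _) (H x) 1 ltac:(lra)) as (dl & Hd & K).
  set (B := 1 + Cmod (f' x)). assert (1 <= B) by (unfold B; pose proof (Cmod_ge_0 (f' x)); lra).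
  exists (Rmin dl (eps / B)); split.
  { apply Rmin_pos; auto; apply Rdiv_lt_0_compat; lra. }
  intros y _ Hy.
  specialize (K (y - x) (Rlt_le_trans _ _ _ Hy (Rmin_l _ _))).
  replace (x + (y - x)) with y in K by ring.
  replace (f y - f x)%C with ((f y - f x - RtoC (y - x) * f' x) + RtoC (y - x) * f' x)%C by ring.
  eapply Rle_lt_trans; [apply Cmod_triangle|]. rewrite Cmod_mult, Cmod_R.
  apply Rle_lt_trans with (B * Rabs (y - x)); [unfold B; lra|].
  apply Rlt_le_trans with (B * (eps / B)); [|right; field; lra].
  apply Rmult_lt_compat_l; [lra|]. eapply Rlt_le_trans; [apply Hy|apply Rmin_r].
Qed.

Lemma rcont_const c a b : rcont (fun _ => c) a b.
Proof. apply rcont_cderive with (f' := fun _ => 0%C); intros; apply cderive_const. Qed.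

Lemma rcont_affine f e t0 a b a' b' : e = 1 \/ e = -1 -> rcont f a' b' ->
  (forall s, a <= s <= b -> a' <= t0 + e * s <= b') -> rcont (fun s => f (t0 + e * s)) a b.
Proof.
  intros He Hf H x Hx eps Heps.
  destruct (Hf _ (H x Hx) eps Heps) as (dl & Hd & K).
  exists dl; split; auto; intros y Hy Hyx; apply K; auto.
  replace (t0 + e * y - (t0 + e * x)) with (e * (y - x)) by ring.
  rewrite Rabs_mult. replace (Rabs e) with 1; [lra|].
  destruct He as [-> | ->]; [rewrite Rabs_R1|rewrite Rabs_left]; lra.
Qed.

Lemma rcont_ext f g a b : (forall t, f t = g t) -> rcont f a b -> rcont g a b.
Proof. intros E H x Hx eps Heps; destruct (H x Hx eps Heps) as (dl & Hd & K).
  exists dl; split; auto; intros y; rewrite <- !E; apply K. Qed.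

Lemma rcontR_lsum {I} (w : I -> C) (y : R -> I -> C) a b l :
  (forall k, rcont (fun s => y s k) a b) ->
  rcontR (fun s => lsum (fun k => Re (w k * y s k)) l) a b.
Proof.
  intros H.
  assert (rcont (fun s => lsum (fun k => w k * y s k)%C l) a b) as HC.
  { induction l as [|k l IH]; cbn [lsum].
    - apply rcont_const.
    - apply (rcont_plus (fun s => w k * y s k)%C); auto.
      apply rcont_mult; auto; apply rcont_const. }
  intros x Hx eps Heps; destruct (HC x Hx eps Heps) as (dl & Hd & K).
  exists dl; split; auto; intros z Hz Hzx; specialize (K z Hz Hzx).
  rewrite <- !(Re_lsum (fun k => w k * _ k)%C).
  eapply Rle_lt_trans; [|exact K].
  eapply Rle_trans; [|apply Rabs_Re_le]; right; reflexivity.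
Qed.

(** Testing against the increment itself reduces the vector-valued mean value
    inequality to the scalar mean value theorem. *)
Lemma HB_mvt {d} sigma (y y' : R -> Tn d Z -> C) b B : 0 < b -> 0 <= B ->
  (forall k, rcont (fun s => y s k) 0 b) ->
  (forall k s, 0 < s < b -> cderive (fun s => y s k) s (y' s k)) ->
  (forall s, 0 < s < b -> HB sigma (y' s) B) ->
  HB sigma (fun k => y b k - y 0 k)%C (b * B).
Proof.
  intros Hb HB0 Hc Hd Hy'; split; [nra|]; intros l Hl.
  set (c := fun k => (y b k - y 0 k)%C).
  (* The conjugate increment with squared weights: pairing with [w] turns the increment of [phi]
     into [Q], the squared weighted norm of the increment over the list. *)
  set (w := fun k => (RtoC (wt sigma k ^ 2) * Cconj (c k))%C).
  set (phi := fun s => lsum (fun k => Re (w k * y s k)) l).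
  set (phi' := fun s => lsum (fun k => Re (w k * y' s k)) l).
  assert (forall s, 0 < s < b -> is_derive phi s (phi' s)) as Hphi.
  { intros s Hs; unfold phi, phi'; clear Hl; induction l as [|k l IH]; cbn [lsum].
    - apply (is_derive_const (V := R_NormedModule)).
    - apply (is_derive_plus (V := R_NormedModule)); auto.
      apply (cderive_scal (w k) (fun s => y s k) s (y' s k) (Hd k s Hs)). }
  destruct (mvt_closed phi phi' 0 b Hb) as (xi & Hxi & E); auto.
  { now apply rcontR_lsum. }
  set (Q := lsum (fun k => (wt sigma k * Cmod (c k)) ^ 2) l).
  assert (phi b - phi 0 = Q) as EQ.
  { unfold phi, Q. 
    replace (lsum (fun k => Re (w k * y b k)) l - lsum (fun k => Re (w k * y 0 k)) l)
      with (lsum (fun k => Re (w k * y b k)) l + -1 * lsum (fun k => Re (w k * y 0 k)) l) by (simpl; ring).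
    rewrite <- lsum_scal, <- lsum_Rplus; apply lsum_Rext; intros k.
    rewrite Rpow_mult_distr, Cmod_sqr. unfold w, c; simpl; unfold Re, Im; simpl; ring. }
  assert (0 <= Q) as HQ by (apply lsum_nonneg; intros; apply pow2_ge_0).
  assert (phi' xi ^ 2 <= Q * B ^ 2) as H.
  { destruct (Hy' xi Hxi) as [_ HY]; specialize (HY l Hl).
    set (q := lsum (fun k => wt sigma k * Cmod (c k) * (wt sigma k * Cmod (y' xi k))) l).
    assert (Rabs (phi' xi) <= q) as H1.
    { unfold phi', q; rewrite <- (Re_lsum (fun k => w k * y' xi k)%C).
      eapply Rle_trans; [apply Rabs_Re_le|]. eapply Rle_trans; [apply Cmod_lsum|].
      apply lsum_le; intros k; unfold w; rewrite !Cmod_mult, Cmod_conj, Cmod_R.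
      rewrite Rabs_pos_eq by apply pow2_ge_0. right; ring. }
    assert (q ^ 2 <= Q * B ^ 2) as H2.
    { eapply Rle_trans; [apply lsum_cauchy_schwarz|]. apply Rmult_le_compat_l; auto. }
    pose proof (Rabs_pos (phi' xi)). rewrite <- pow2_abs.
    eapply Rle_trans; [|apply H2]. apply pow_incr; lra. }
  rewrite EQ, Rminus_0_r in E.
  fold Q. change (Q <= (b * B) ^ 2).
  destruct (Req_dec Q 0) as [E0|E0]; [rewrite E0; apply pow2_ge_0|].
  (* Since Q = b phi'(xi) and phi'(xi)^2 <= Q B^2, one factor [Q] can be divided out. *)
  assert (Q * Q <= (b * B) ^ 2 * Q) as H3.
  { replace (Q * Q) with (phi' xi ^ 2 * b ^ 2) by (rewrite E; ring).
    replace ((b * B) ^ 2 * Q) with (Q * B ^ 2 * b ^ 2) by ring.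
    apply Rmult_le_compat_r; [apply pow2_ge_0|auto]. }
  apply Rmult_le_reg_r in H3; lra.
Qed.

Lemma cderive_lsum {I} (f f' : I -> R -> C) t l :
  (forall k, cderive (f k) t (f' k t)) ->
  cderive (fun s => lsum (fun k => f k s) l) t (lsum (fun k => f' k t) l).
Proof.
  intros H; induction l as [|k l IH]; cbn [lsum].
  - apply cderive_const.
  - apply (cderive_plus (f k)); auto.
Qed.

Lemma Cmod_mvt (f f' : R -> C) t h B : (forall s, cderive f s (f' s)) ->
  (forall s, Cmod (f' s) <= B) -> Cmod (f (t + h)%R - f t) <= B * Rabs h.
Proof.
  intros Hf HB.
  set (c := (f (t + h)%R - f t)%C).
  set (phi := fun s => Re (Cconj c * f s)).
  destruct (MVT_gen phi t (t + h) (fun s => Re (Cconj c * f' s))) as (xi & _ & E).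
  - intros x _; apply (cderive_scal (Cconj c) f x (f' x) (Hf x)).
  - intros x _; apply derivable_continuous_pt; exists (Re (Cconj c * f' x)).
    apply is_derive_Reals, (cderive_scal (Cconj c) f x (f' x) (Hf x)).
  - replace (phi (t + h) - phi t) with (Cmod c ^ 2) in E.
    2:{ rewrite Cmod_sqr; unfold phi, c; simpl; unfold Re, Im; simpl; ring. }
    replace (t + h - t) with h in E by ring.
    assert (Cmod c ^ 2 <= Cmod c * (B * Rabs h)) as H.
    { rewrite E. eapply Rle_trans; [apply Rle_abs|]. rewrite Rabs_mult, <- Rmult_assoc.
      apply Rmult_le_compat_r; [apply Rabs_pos|].
      eapply Rle_trans; [apply Rabs_Re_le|]. rewrite Cmod_mult, Cmod_conj.
      apply Rmult_le_compat_l; [apply Cmod_ge_0|auto]. }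
    pose proof (Cmod_ge_0 c).
    assert (0 <= B * Rabs h).
    { apply Rmult_le_pos; [|apply Rabs_pos]. eapply Rle_trans; [apply Cmod_ge_0|apply (HB 0)]. }
    apply Rnot_lt_le; intros K; nra.
Qed.

(** Termwise differentiation: each difference remainder is at most 2 |h| |c_j|, uniformly in the
    time-dependent factor. A cube with small tail is fixed first, and ordinary differentiability is
    used inside it. *)
Lemma cderive_csum {d} (c : Tn d Z -> C) (g g' : Tn d Z -> R -> C) (t : R) :
  csummable c -> (forall j s, cderive (g j) s (g' j s)) ->
  (forall j s, Cmod (g' j s) <= 1) ->
  (forall s, csummable (fun j => c j * g j s)%C) ->
  cderive (fun s => csum (fun j => c j * g j s)%C) t (csum (fun j => c j * g' j t)%C).
Proof.
  intros [B HB] Hg Hg' Hs; apply cderive_eps; intros eps Heps.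
  set (F := fun j => Cmod (c j)).
  assert (forall k, 0 <= F k) as HF by (intros; apply Cmod_ge_0).
  (* The tail of the remainders is at most 2 |h| times the tail of [c], which leaves eps / 2 for the
     cube. *)
  assert (0 < eps / 4) as He4 by lra.
  destruct (rsum_tail_lim F B HF HB (mkposreal _ He4)) as [N HN]; simpl in HN.
  destruct (proj1 (cderive_eps _ _ _) (cderive_lsum (fun j s => c j * g j s)%C
     (fun j s => c j * g' j s)%C t (boxl d N) (fun k => cderive_scal _ _ _ _ (Hg k t)))
     (eps / 2) ltac:(lra)) as (dl & Hd & K).
  exists dl; split; auto; intros h Hh; specialize (K h Hh).
  set (D := fun j => (c j * (g j (t + h)%R - g j t - h * g' j t))%C).
  assert (csummable (fun j => c j * g' j t)%C) as Hs'.
  { eapply csummable_le; [|apply HB]; intros j; rewrite Cmod_mult.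
    pose proof (Hg' j t); pose proof (Cmod_ge_0 (c j)); nra. }
  assert (csum D = csum (fun j => c j * g j (t + h)%R)%C - csum (fun j => c j * g j t)%C
    - h * csum (fun j => c j * g' j t)%C)%C as E.
  { unfold D.
    rewrite (csum_ext _ (fun j => c j * g j (t + h)%R
      + ((-(1)) * (c j * g j t) + (- h) * (c j * g' j t)))%C) by (intros; ring).
    rewrite !csum_plus, !csum_scal; auto using csummable_plus, csummable_scal. ring. }
  rewrite <- E.
  assert (forall j, Cmod (D j) <= 2 * Rabs h * F j) as HD.
  { intros j; unfold D; rewrite Cmod_mult, Rmult_comm; apply Rmult_le_compat_r; [apply Cmod_ge_0|].
    unfold Cminus at 1; eapply Rle_trans; [apply Cmod_triangle|].
    rewrite Cmod_opp, Cmod_mult, Cmod_R.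
    pose proof (Cmod_mvt (g j) (g' j) t h 1 (Hg j) (Hg' j)) as H1.
    pose proof (Hg' j t); pose proof (Rabs_pos h). nra. }
  assert (0 <= 2 * Rabs h) as Hh2 by (pose proof (Rabs_pos h); lra).
  pose proof (csum_tail D _ _ N HD (L1_scal _ _ _ Hh2 HB)) as HT.
  assert (rsum (fun j => 2 * Rabs h * F j) - box_sum N (fun j => 2 * Rabs h * F j)
    = 2 * Rabs h * (rsum F - box_sum N F)) as ET.
  { rewrite !box_sum_lsum, lsum_scal. rewrite Rmult_minus_distr_l; f_equal.
    apply rsum_eq. eapply is_lim_seq_ext;
      [|apply (is_lim_seq_scal_l _ (2 * Rabs h) _ (rsum_lim_nonneg F B HF HB))].
    intros n; cbv beta; now rewrite !box_sum_lsum, lsum_scal. }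
  rewrite ET in HT.
  assert (Cmod (box_sum N D) <= eps / 2 * Rabs h) as HK.
  { eapply Rle_trans; [|apply K]; right; f_equal. rewrite box_sum_lsum.
    unfold D; clear. induction (boxl d N) as [|k l IH]; cbn [lsum].
    - unfold zero; simpl. change ((0:C) = (0 - 0 - h * 0)%C); ring.
    - rewrite IH; unfold plus; simpl; ring. }
  replace (csum D) with ((csum D - box_sum N D) + box_sum N D)%C by (unfold Cminus; ring).
  eapply Rle_trans; [apply Cmod_triangle|].
  pose proof (Rabs_pos h). nra.
Qed.

(** * Local error *)

(** [gmul q s] is the integral of [exp(2 i r q)] for [r] from 0 to [s]. *)
Definition gmul (q s : R) : C :=
  if Req_EM_T q 0 then RtoC s
  else (sin (2 * s * q) / (2 * q), (1 - cos (2 * s * q)) / (2 * q)).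

Lemma cderive_gmul q s : cderive (gmul q) s (ei (2 * s * q)).
Proof.
  unfold gmul; destruct (Req_EM_T q 0) as [->|H]; split; unfold ei; simpl.
  - replace (2 * s * 0) with 0 by ring; rewrite cos_0; auto_derive; auto.
  - replace (2 * s * 0) with 0 by ring; rewrite sin_0; auto_derive; auto.
  - auto_derive; auto; field; auto.
  - auto_derive; auto; field; auto.
Qed.

Lemma gmul_0 q : gmul q 0 = 0%C.
Proof.
  unfold gmul; destruct (Req_EM_T q 0); auto.
  replace (2 * 0 * q) with 0 by ring; rewrite sin_0, cos_0.
  unfold RtoC; f_equal; field; auto.
Qed.

Lemma Cmod_gmul_le q s : Cmod (gmul q s) <= Rabs s.
Proof.
  pose proof (Cmod_mvt (gmul q) (fun s => ei (2 * s * q)) 0 s 1 (cderive_gmul q)) as H.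
  rewrite Rplus_0_l, gmul_0, Rmult_1_l in H.
  replace (gmul q s - 0)%C with (gmul q s) in H by ring.
  apply H; intros; rewrite Cmod_ei; lra.
Qed.

(** [q] stands for |k|^2, whereas the scheme evaluates its filter at the Laplacian's symbol -|k|^2;
    this explains the minus sign. At q = 0 the convention phi_1(0) = 1 matches the integral of 1. *)
Lemma gmul_phi_1 q tau : gmul q tau = (tau * phi_1 (- (2) * Ci * (tau * - q)%R))%C.
Proof.
  unfold gmul, phi_1.
  destruct (Req_EM_T q 0) as [->|Hq].
  - destruct Ceq_dec as [_|H]; [ring|].
    exfalso; apply H; rewrite Ropp_0, Rmult_0_r; ring.
  - destruct (Req_EM_T tau 0) as [->|Ht].
    { rewrite Cmult_0_l. replace (2 * 0 * q) with 0 by ring; rewrite sin_0, cos_0.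
      unfold RtoC; f_equal; field; auto. }
    assert ((- (2) * Ci * (tau * - q)%R)%C = (Ci * (2 * tau * q)%R)%C) as E
      by (apply injective_projections; simpl; ring).
    rewrite E; destruct Ceq_dec as [H|H].
    + exfalso; apply (f_equal snd) in H; simpl in H.
      assert (2 * tau * q = 0) as H' by lra.
      apply Rmult_integral in H'; destruct H' as [H'|H']; [|auto]. lra.
    + rewrite cexp_Ci. unfold ei.
      assert (((cos (2 * tau * q), sin (2 * tau * q)) - 1)%C
         = ((Ci * (2 * tau * q)%R) * (sin (2 * tau * q) / (2 * tau * q),
              (1 - cos (2 * tau * q)) / (2 * tau * q))%R)%C) as ->
        by (apply injective_projections; simpl; field; auto).
      unfold Cdiv. rewrite (Cmult_comm (Ci * _)), <- Cmult_assoc, Cinv_r, Cmult_1_r by auto.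
      apply injective_projections; simpl; field; auto.
Qed.

(** The origin of the sine filter: the left side is the integral of exp(2irq) over [-tau, tau],
    whose imaginary part cancels by symmetry. *)
Lemma gmul_phi_s q tau :
  (gmul q tau - gmul q (- tau))%C = (2 * tau * RtoC (phi_s (2 * tau * - q)))%C.
Proof.
  unfold gmul, phi_s.
  destruct (Req_EM_T q 0) as [->|Hq].
  - rewrite Ropp_0, Rmult_0_r. destruct (Req_EM_T 0 0) as [_|H]; [|lra].
    rewrite RtoC_opp; ring.
  - destruct (Req_EM_T tau 0) as [->|Ht].
    { rewrite Ropp_0; ring. }
    destruct (Req_EM_T (2 * tau * - q) 0) as [H|H].
    { exfalso; apply Rmult_integral in H; lra. }
    replace (2 * - tau * q) with (- (2 * tau * q)) by ring.
    replace (2 * tau * - q) with (- (2 * tau * q)) by ring.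
    rewrite !sin_neg, cos_neg. rewrite <- !RtoC_mult.
    apply injective_projections; simpl; field; auto.
Qed.

Lemma Rpower_ge_id b g : 0 < b <= 1 -> g <= 1 -> b <= Rpower b g.
Proof.
  intros Hb Hg. replace b with (Rpower b 1) at 1 by (apply Rpower_1; lra).
  unfold Rpower. assert (ln b <= 0) by (rewrite <- ln_1; apply ln_le; lra).
  assert (1 * ln b <= g * ln b) as [K|K] by nra.
  - left; now apply exp_increasing.
  - rewrite K; lra.
Qed.

Ltac mul_nonneg := repeat first [assumption | lra | apply Rmult_le_pos].

Lemma RtoC_m1 : RtoC (-1) = (- (1))%C.
Proof. apply injective_projections; simpl; ring. Qed.

Lemma Cmod_Ci_mult (mu : R) : Cmod (- Ci * mu) = Rabs mu.
Proof.
  rewrite Cmod_mult, Cmod_opp, Cmod_R.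
  replace (Cmod Ci) with 1; [ring|].
  unfold Cmod; transitivity (sqrt 1); [now rewrite sqrt_1|f_equal; simpl; ring].
Qed.

Section LocalError.

Variables (d : nat) (alpha g mu Zc M : R).
Hypothesis Halpha : 0 <= alpha.
Hypothesis Hg : 0 <= g <= 1.
Hypothesis HZ : 0 <= Zc.
Hypothesis Hsum : L1 (fun k : Tn d Z => Rpower (1 + sqnorm k) (- alpha)) (Zc ^ 2).
Hypothesis HM : 0 <= M.

Notation delta := (alpha + 1 + 2 * g).
(** In H^beta one can still spend 2g derivatives in [HB_sg_minus_id] and land in H^alpha with a gain
    b^g; slopes are kept in this space. *)
Notation beta := (alpha + 2 * g).
Notation tri := (tri d).

Definition cubic (x : Tn d Z -> C) : Tn d Z -> C := tri x x (cj x).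

Definition tri_cst : R := alg_cst Zc alpha ^ 2.
Definition tri_cst_beta : R := alg_cst Zc beta ^ 2.

Lemma tri_cst_nonneg : 0 <= tri_cst. Proof. apply pow2_ge_0. Qed.
Lemma tri_cst_beta_nonneg : 0 <= tri_cst_beta. Proof. apply pow2_ge_0. Qed.

Lemma HB_alpha_tri a b c A B D : HB alpha a A -> HB alpha b B -> HB alpha c D ->
  HB alpha (tri a b c) (tri_cst * A * B * D).
Proof. apply (HB_tri d alpha Zc Halpha HZ Hsum); lra. Qed.

Lemma HB_beta_tri a b c A B D : HB beta a A -> HB beta b B -> HB beta c D ->
  HB beta (tri a b c) (tri_cst_beta * A * B * D).
Proof. apply (HB_tri d alpha Zc Halpha HZ Hsum); lra. Qed.

Lemma HB_alpha_summable (x : Tn d Z -> C) B : HB alpha x B -> csummable x.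
Proof. apply (HB_csummable d alpha Zc HZ Hsum); lra. Qed.

Variables (T : R) (a : R -> Tn d Z -> C).
Hypothesis Hcont : forall k, rcont (fun t => a t k) 0 T.
Hypothesis Hder : forall k t, 0 < t < T ->
  cderive (fun s => a s k) t (- Ci * (sqnorm k * a t k + mu * cubic (a t) k))%C.
Hypothesis Hbd : forall t, 0 <= t <= T -> HB delta (a t) M.

Variable t0 : R.
Hypothesis Ht0 : 0 <= t0 <= T.

Notation U := (a t0).

Lemma a_alpha t : 0 <= t <= T -> HB alpha (a t) M.
Proof. intros H; eapply HB_lower; [|apply Hbd, H]; lra. Qed.

Lemma a_beta t : 0 <= t <= T -> HB beta (a t) M.
Proof. intros H; eapply HB_lower; [|apply Hbd, H]; lra. Qed.

Lemma a_summable t : 0 <= t <= T -> csummable (a t).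
Proof. intros H; eapply HB_alpha_summable, a_alpha, H. Qed.

(** The sign [e] treats forward and backward times together, [b] being the elapsed length. The bound
    b <= 1 makes b <= b^g available. *)
Definition adm (e b : R) : Prop := (e = 1 \/ e = -1) /\ 0 < b <= 1 /\ 0 <= t0 + e * b <= T.

Lemma adm_inner e b s : adm e b -> 0 < s < b -> 0 < t0 + e * s < T /\ adm e s.
Proof. intros ([-> | ->] & Hb & H) Hs; unfold adm; repeat split; auto; lra. Qed.

Lemma adm_closed e b s : adm e b -> 0 <= s <= b -> 0 <= t0 + e * s <= T.
Proof. intros ([-> | ->] & Hb & H) Hs; lra. Qed.

Lemma adm_Cmod e b : adm e b -> Cmod e = 1.
Proof. intros ([-> | ->] & _); rewrite Cmod_R; [apply Rabs_R1|rewrite Rabs_left; lra]. Qed.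

Lemma adm_Rabs e b : adm e b -> Rabs (e * b) = b.
Proof.
  intros ([-> | ->] & Hb & _); unfold Rabs; destruct Rcase_abs; lra.
Qed.

(** The interaction picture around time [t0]. *)
Definition inter (s : R) (k : Tn d Z) : C := sg (- s) (a (t0 + s)) k.

Lemma inter_0 k : inter 0 k = U k.
Proof. unfold inter; rewrite Ropp_0, sg_0, Rplus_0_r; auto. Qed.

Lemma a_inter s k : a (t0 + s) k = sg s (inter s) k.
Proof.
  unfold inter. pose proof (sg_opp (- s) (a (t0 + s)) k) as H.
  now rewrite Ropp_involutive in H.
Qed.

(** Differentiating the phase cancels the Laplacian, so only the cubic term remains and no
    derivative is lost; the prefactor [e] comes from the chain rule. *)
Lemma cderive_inter e b s k : adm e b -> 0 < s < b ->
  cderive (fun s => inter (e * s) k) s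
    (e * (- Ci * mu * sg (- (e * s)) (cubic (a (t0 + e * s))) k))%C.
Proof.
  intros Hb Hs; destruct (adm_inner e b s Hb Hs) as [Ht _].
  apply cderive_ext with (fun s => inter (0 + e * s) k); [intros; now rewrite Rplus_0_l|].
  apply (cderive_affine (fun s => inter s k) e 0 s). rewrite Rplus_0_l.
  set (r := e * s) in *.
  apply cderive_ext with (fun s => ei (s * sqnorm k) * a (t0 + s)%R k)%C.
  { intros q; unfold inter, sg; do 2 f_equal; ring. }
  assert (cderive (fun s => a (t0 + s) k) r
    (- Ci * (sqnorm k * a (t0 + r)%R k + mu * cubic (a (t0 + r)%R) k))%C) as H.
  { apply cderive_ext with (fun s => a (t0 + 1 * s) k); [intros; now rewrite Rmult_1_l|].
    eapply cderive_val; [|apply (cderive_affine (fun s => a s k) 1 t0 r)].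
    2:{ rewrite Rmult_1_l; now apply Hder. }
    ring. }
  eapply cderive_val; [|apply (cderive_mult _ _ _ _ _ (cderive_ei (sqnorm k) r) H)].
  unfold sg. replace (- (- r * sqnorm k)) with (r * sqnorm k) by ring. ring.
Qed.

Lemma rcont_inter e b k : adm e b -> rcont (fun s => inter (e * s) k) 0 b.
Proof.
  intros Hb.
  apply rcont_ext with (fun s => ei (s * (e * sqnorm k)) * a (t0 + e * s)%R k)%C.
  { intros s; unfold inter, sg; do 2 f_equal; ring. }
  apply rcont_mult.
  - eapply rcont_cderive; intros; apply cderive_ei.
  - apply (rcont_affine (fun t => a t k) e t0 0 b 0 T); auto; [apply Hb|].
    intros s Hs; eapply adm_closed; eauto.
Qed.

Lemma HB_alpha_cubic x B : HB alpha x B -> HB alpha (cubic x) (tri_cst * B * B * B).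
Proof. intros H; exact (HB_alpha_tri _ _ _ _ _ _ H H (HB_cj _ _ _ H)). Qed.

Lemma HB_beta_cubic x B : HB beta x B -> HB beta (cubic x) (tri_cst_beta * B * B * B).
Proof. intros H; exact (HB_beta_tri _ _ _ _ _ _ H H (HB_cj _ _ _ H)). Qed.

Definition inter_cst : R := Rabs mu * (tri_cst * M * M * M).

Lemma inter_cst_nonneg : 0 <= inter_cst.
Proof.
  unfold inter_cst; pose proof tri_cst_nonneg; apply Rmult_le_pos; [apply Rabs_pos|].
  mul_nonneg.
Qed.

Lemma inter_lipschitz e b : adm e b ->
  HB alpha (fun k => inter (e * b) k - U k)%C (b * inter_cst).
Proof.
  intros Hb; destruct (Hb) as (_ & Hb0 & _).
  apply HB_ext with (fun k => inter (e * b) k - inter (e * 0) k)%C.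
  { intros k; now rewrite Rmult_0_r, inter_0. }
  apply (HB_mvt alpha (fun s => inter (e * s))
    (fun s k => e * (- Ci * mu * sg (- (e * s)) (cubic (a (t0 + e * s))) k))%C); [lra|apply inter_cst_nonneg| | |].
  - intros k; now apply rcont_inter.
  - intros k s Hs; eapply cderive_inter; eauto.
  - intros s Hs; destruct (adm_inner e b s Hb Hs) as [Ht _].
    eapply HB_weaken; [|apply HB_scal, HB_scal, HB_sg, HB_alpha_cubic, a_alpha; lra].
    rewrite (adm_Cmod e b Hb), Cmod_Ci_mult.
    unfold inter_cst; right; ring.
Qed.

Definition close_cst : R := inter_cst + 2 * M.

Lemma free_close e b : adm e b ->
  HB alpha (fun k => sg (e * b) U k - U k)%C (Rpower b g * (2 * M)).
Proof.
  intros Hb; destruct (Hb) as (He & Hb0 & _).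
  eapply HB_weaken; [|apply (HB_sg_minus_id alpha g (e * b) U M); auto].
  - rewrite (adm_Rabs e b Hb); right; ring.
  - destruct He as [-> | ->]; lra.
  - now apply a_beta.
Qed.

Lemma a_minus_free e b : adm e b ->
  HB alpha (fun k => a (t0 + e * b)%R k - sg (e * b) U k)%C (b * inter_cst).
Proof.
  intros Hb; eapply HB_ext; [|apply (HB_sg (e * b)), (inter_lipschitz e b Hb)].
  intros k; rewrite a_inter; unfold sg; ring.
Qed.

(** The free motion limits the rate to b^g; the nonlinear displacement, of order b, is absorbed
    because b <= b^g for b <= 1. *)
Lemma a_close e b : adm e b ->
  HB alpha (fun k => a (t0 + e * b)%R k - U k)%C (Rpower b g * close_cst).
Proof.
  intros Hb; destruct (Hb) as (He & Hb0 & _).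
  pose proof (HB_plus _ _ _ _ _ (a_minus_free e b Hb) (free_close e b Hb)) as H.
  eapply HB_le; [apply H|lra| |intros; cbv beta; ring].
  pose proof (Rpower_ge_id b g Hb0 (proj2 Hg)). pose proof inter_cst_nonneg. unfold close_cst; nra.
Qed.

Lemma HB_cj_minus (x y : Tn d Z -> C) B : HB alpha (fun k => x k - y k)%C B ->
  HB alpha (fun k => cj x k - cj y k)%C B.
Proof.
  intros H; eapply HB_ext; [|apply HB_cj, H].
  intros k; unfold cj. now rewrite Cminus_conj.
Qed.

Definition cubic_cst : R := 3 * tri_cst * M * M * close_cst + 2 * (tri_cst_beta * M * M * M).

Lemma cubic_cst_nonneg : 0 <= cubic_cst.
Proof.
  unfold cubic_cst, close_cst; pose proof tri_cst_nonneg; pose proof tri_cst_beta_nonneg; pose proof inter_cst_nonneg.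
  apply Rplus_le_le_0_compat; mul_nonneg.
Qed.

(** Two effects of size b^g add up: the solution moves as in [a_close], and the group moves
    [cubic U], which lies in H^beta. *)
Lemma cubic_close e b : adm e b ->
  HB alpha (fun k => sg (- (e * b)) (cubic (a (t0 + e * b))) k - cubic U k)%C (Rpower b g * cubic_cst).
Proof.
  intros Hb; destruct (Hb) as (He & Hb0 & Hin).
  pose proof (a_close e b Hb) as Hx.
  pose proof (a_alpha _ Hin) as Hxa; pose proof (a_alpha _ Ht0) as HUa.
  pose proof (HB_tri_minus d alpha Zc Halpha HZ Hsum alpha _ _ _ _ _ _ _ _ _ _ _ _ _
    (Rle_refl _) Hx Hx (HB_cj_minus _ _ _ Hx) HUa Hxa HUa (HB_cj _ _ _ Hxa)) as H1.
  assert (HB alpha (fun k => sg (- (e * b)) (cubic U) k - cubic U k)%C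
    (2 * Rpower (Rabs (- (e * b))) g * (tri_cst_beta * M * M * M))) as H2.
  { apply HB_sg_minus_id; auto.
    - destruct He as [-> | ->]; lra.
    - now apply HB_beta_cubic, a_beta. }
  rewrite Rabs_Ropp, (adm_Rabs e b Hb) in H2.
  eapply HB_le; [apply (HB_plus _ _ _ _ _ (HB_sg (- (e * b)) _ _ _ H1) H2)|lra| |].
  - unfold cubic_cst, tri_cst; right; ring.
  - intros k; unfold cubic, sg; ring.
Qed.

(** The velocity of the interaction picture at [t0]. *)
Definition slope (k : Tn d Z) : C := (- Ci * mu * cubic U k)%C.

Definition slope_cst : R := Rabs mu * (tri_cst_beta * M * M * M).

Lemma slope_cst_nonneg : 0 <= slope_cst.
Proof.
  unfold slope_cst; pose proof tri_cst_beta_nonneg; apply Rmult_le_pos; [apply Rabs_pos|].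
  mul_nonneg.
Qed.

Lemma HB_slope : HB beta slope slope_cst.
Proof.
  unfold slope_cst; rewrite <- Cmod_Ci_mult. apply HB_scal, HB_beta_cubic, a_beta, Ht0.
Qed.

(** [HB_mvt] is applied to [inter] minus its tangent line. The derivative of the difference is
    controlled by [cubic_close] with s^g <= b^g. *)
Lemma inter_expansion e b : adm e b ->
  HB alpha (fun k => inter (e * b) k - U k - (e * b)%R * slope k)%C
    (b * (Rpower b g * (Rabs mu * cubic_cst))).
Proof.
  intros Hb; destruct (Hb) as (_ & Hb0 & _).
  apply HB_ext with (fun k => (inter (e * b) k - (b * (e * slope k)))
                              - (inter (e * 0) k - (RtoC 0 * (e * slope k))))%C.
  { intros k; rewrite Rmult_0_r, inter_0, RtoC_mult; ring. }
  apply (HB_mvt alpha (fun s k => inter (e * s) k - (s * (e * slope k)))%C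
    (fun s k => e * (- Ci * mu * sg (- (e * s)) (cubic (a (t0 + e * s))) k) - e * slope k)%C);
    [lra| | | |].
  - pose proof (Rpower_pos b g); pose proof cubic_cst_nonneg; pose proof (Rabs_pos mu).
    mul_nonneg.
  - intros k. apply rcont_ext with (fun s => inter (e * s) k + s * (- (e * slope k)))%C;
      [intros; ring|].
    apply rcont_plus; [now apply rcont_inter|].
    eapply rcont_cderive; intros; apply cderive_id_scal.
  - intros k s Hs; apply cderive_minus; [eapply cderive_inter; eauto|apply cderive_id_scal].
  - intros s Hs; destruct (adm_inner e b s Hb Hs) as [Ht Hs'].
    eapply HB_le; [apply (HB_scal alpha e), (HB_scal alpha (- Ci * mu)), (cubic_close e s Hs')|lra| |].
    + rewrite (adm_Cmod e b Hb), Cmod_Ci_mult.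
      assert (Rpower s g <= Rpower b g) by (apply Rle_Rpower_l; lra).
      pose proof cubic_cst_nonneg; pose proof (Rabs_pos mu).
      assert (0 <= Rabs mu * cubic_cst) by (apply Rmult_le_pos; auto). nra.
    + intros k; unfold slope; ring.
Qed.

Definition expansion_cst : R := Rabs mu * cubic_cst + 2 * slope_cst.

Lemma expansion_cst_nonneg : 0 <= expansion_cst.
Proof.
  unfold expansion_cst; pose proof cubic_cst_nonneg; pose proof slope_cst_nonneg; pose proof (Rabs_pos mu).
  assert (0 <= Rabs mu * cubic_cst) by now apply Rmult_le_pos. lra.
Qed.

(** Transporting [inter_expansion] back by the group leaves [sg (e * b) slope] in place of [slope].
    The exchange costs 2 b^g in H^alpha because [slope] lies in H^beta, which is the second term of
    [expansion_cst]. *)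
Lemma a_minus_free_expansion e b : adm e b ->
  HB alpha (fun k => (a (t0 + e * b)%R k - sg (e * b) U k) - (e * b)%R * slope k)%C
    (b * Rpower b g * expansion_cst).
Proof.
  intros Hb; destruct (Hb) as (He & Hb0 & _).
  assert (HB alpha (fun k => (e * b)%R * (sg (e * b) slope k - slope k))%C
    (b * (2 * Rpower b g * slope_cst))) as H1.
  { assert (Cmod (e * b)%R = b) as Hbe by (rewrite Cmod_R; apply (adm_Rabs e b Hb)).
    rewrite <- Hbe at 1. apply HB_scal.
    rewrite <- (adm_Rabs e b Hb) at 1. apply HB_sg_minus_id; auto.
    - destruct He as [-> | ->]; lra.
    - apply HB_slope. }
  eapply HB_le; [apply (HB_plus _ _ _ _ _ (HB_sg (e * b) _ _ _ (inter_expansion e b Hb)) H1)|lra| |].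
  - unfold expansion_cst; right; ring.
  - intros k; rewrite a_inter; unfold sg; ring.
Qed.

(** The derivative of [cubic] at [U] in the direction [slope]. Because of the conjugate slot it is
    linear over the reals only, which suffices for real time increments. *)
Definition slope3 (k : Tn d Z) : C :=
  (tri slope U (cj U) k + tri U slope (cj U) k + tri U U (cj slope) k)%C.

Definition slope3_cst : R := 3 * tri_cst_beta * slope_cst * M * M.

Lemma HB_slope3 : HB beta slope3 slope3_cst.
Proof.
  pose proof HB_slope as H; pose proof (a_beta _ Ht0) as HU.
  eapply HB_weaken; [|apply HB_plus; [apply HB_plus|]; apply HB_beta_tri;
    auto using HB_cj; eassumption || apply HB_cj; eassumption].
  unfold slope3_cst; right; ring.
Qed.

Definition odd_cst : R := 3 * tri_cst * (expansion_cst * M * M + slope_cst * close_cst * M + inter_cst * close_cst * M) + 2 * slope3_cst.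

(** First-order effect of the nonlinearity on the local error: up to
    [O(b^(1+g))] it is odd in time, so the two-step scheme does not see it. *)
Lemma cubic_minus_free e b : adm e b ->
  HB alpha (fun k => sg (- (e * b)) (fun j => cubic (a (t0 + e * b)) j - cubic (sg (e * b) U) j) k
                     - (e * b)%R * slope3 k)%C
    (b * Rpower b g * odd_cst).
Proof.
  intros Hb; destruct (Hb) as (He & Hb0 & Hin).
  set (s := e * b). set (x := a (t0 + s)). set (w := sg s U).
  set (h := fun k => (x k - w k)%C).
  set (sp := fun k => (RtoC s * slope k)%C).
  pose proof slope_cst_nonneg as Hbp; pose proof expansion_cst_nonneg as Hc4; pose proof inter_cst_nonneg as Hc1.
  pose proof tri_cst_nonneg as Hka; pose proof (Rpower_pos b g) as Hp.
  assert (Cmod s = b) as Hs by (rewrite Cmod_R; apply (adm_Rabs e b Hb)).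
  assert (HB alpha slope slope_cst) as Hsl by (eapply HB_lower; [|apply HB_slope]; lra).
  assert (HB alpha sp (b * slope_cst)) as Hsp by (rewrite <- Hs; now apply HB_scal).
  assert (HB alpha U M) as HU by now apply a_alpha.
  assert (HB alpha x M) as Hx by now apply a_alpha.
  assert (HB alpha w M) as Hw by now apply HB_sg.
  assert (HB alpha (fun k => h k - sp k)%C (b * Rpower b g * expansion_cst)) as Hh
    by exact (a_minus_free_expansion e b Hb).
  assert (HB alpha (fun k => x k - U k)%C (Rpower b g * close_cst)) as HxU by exact (a_close e b Hb).
  assert (HB alpha (fun k => w k - U k)%C (Rpower b g * close_cst)) as HwU.
  { eapply HB_weaken; [|exact (free_close e b Hb)]. unfold close_cst; nra. }
  pose proof (HB_cj_minus _ _ _ HxU) as HxU'.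
  pose proof (HB_cj _ _ _ Hx) as Hx'. pose proof (HB_cj _ _ _ HU) as HU'.
  pose proof (HB_cj _ _ _ Hsp) as Hsp'.
  assert (HB alpha h (b * inter_cst)) as Hh0 by exact (a_minus_free e b Hb).
  (* Telescoping cubic(x) - cubic(w) leaves three terms, each with one factor [h] = O(b). Replacing
     [h] by its linear part [sp] costs b^(1+g), and replacing another factor by [U] costs b^g times
     the O(b) already present. *)
  pose proof (HB_tri_minus d alpha Zc Halpha HZ Hsum alpha h sp x U (cj x) (cj U) _ _ _ _ _ _ _
    (Rle_refl _) Hh HxU HxU' Hsp Hx HU Hx') as T1.
  pose proof (HB_tri_minus d alpha Zc Halpha HZ Hsum alpha w U h sp (cj x) (cj U) _ _ _ _ _ _ _
    (Rle_refl _) HwU Hh HxU' HU Hh0 Hsp Hx') as T2.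
  assert (HB alpha (fun k => cj h k - cj sp k)%C (b * Rpower b g * expansion_cst)) as Hh' by now apply HB_cj_minus.
  pose proof (HB_tri_minus d alpha Zc Halpha HZ Hsum alpha w U w U (cj h) (cj sp) _ _ _ _ _ _ _
    (Rle_refl _) HwU HwU Hh' HU Hw HU (HB_cj _ _ _ Hh0)) as T3.
  fold tri_cst in T1, T2, T3.
  assert (HB alpha (fun k => s * (sg (- s) slope3 k - slope3 k))%C (b * (2 * Rpower b g * slope3_cst))) as T4.
  { rewrite <- Hs at 1. apply HB_scal.
    rewrite <- (adm_Rabs e b Hb) at 1. fold s. rewrite <- Rabs_Ropp. apply HB_sg_minus_id; auto.
    - unfold s; destruct He as [-> | ->]; lra.
    - apply HB_slope3. }
  eapply HB_le; [apply (HB_plus _ _ _ _ _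
    (HB_sg (- s) _ _ _ (HB_plus _ _ _ _ _ (HB_plus _ _ _ _ _ T1 T2) T3)) T4)|lra| |].
  - unfold odd_cst; right; ring.
  - assert (csummable w) as Sw by (eapply HB_alpha_summable; eauto).
    assert (csummable x) as Sx by (eapply HB_alpha_summable; eauto).
    assert (csummable (cj w)) as Sw' by now apply csummable_cj.
    assert (csummable (cj x)) as Sx' by now apply csummable_cj.
    assert (csummable U) as SU by (eapply HB_alpha_summable; eauto).
    assert (csummable (cj U)) as SU' by now apply csummable_cj.
    assert (csummable slope) as Ssl by (eapply HB_alpha_summable; eauto).
    assert (csummable (cj slope)) as Ssl' by now apply csummable_cj.
    intros k; unfold sg at 1; unfold sg at 1; unfold sg at 1.
    assert ((cubic x k - cubic w k)%C = (tri h x (cj x) k + tri w h (cj x) k + tri w w (cj h) k)%C) as ->.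
    { unfold cubic; rewrite tri_minus by auto. f_equal.
      apply tri_ext; auto. intros j; unfold cj, h; now rewrite Cminus_conj. }
    assert (tri sp U (cj U) k = (s * tri slope U (cj U) k)%C) as -> by now apply tri_scal_1.
    assert (tri U sp (cj U) k = (s * tri U slope (cj U) k)%C) as -> by now apply tri_scal_2.
    (* [s] is real, so it passes through the conjugate unchanged. *)
    assert (tri U U (cj sp) k = (s * tri U U (cj slope) k)%C) as ->.
    { rewrite <- tri_scal_3 by auto. apply tri_ext; auto.
      intros j; unfold cj, sp. rewrite Cmult_conj; f_equal. apply injective_projections; simpl; ring. }
    unfold slope3; ring.
Qed.

(** Up to the factor -i mu this is the time derivative of [zerr]: the exact Duhamel integrand minus
    the one the scheme integrates. *)
Definition defect (s : R) (k : Tn d Z) : C :=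
  (sg (- s) (cubic (a (t0 + s))) k - tri U U (sg (- (2 * s)) (cj U)) k)%C.

(** The cubic term along the free flow is inserted between the two integrands. The first part is the
    nonlinear effect of [cubic_minus_free]; the second compares two phases on the same data, so it
    is a trilinear multiplier. *)
Lemma defect_split s k : 0 <= t0 + s <= T ->
  defect s k = (sg (- s) (fun j => cubic (a (t0 + s)%R) j - cubic (sg s U) j)%C k
                + trim (mdiff d s) U U (cj U) k)%C.
Proof.
  intros Hs. pose proof (a_summable _ Ht0) as SU. pose proof (csummable_cj d _ SU) as SU'.
  assert (mult_bounded (mfull (d := d) s)) as Bf by apply mult_bounded_ei.
  assert (mult_bounded (mpart (d := d) s)) as Bp by apply mult_bounded_ei.
  unfold mdiff; rewrite (trim_minus (mfull s) (mpart s)) by assumption.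
  rewrite <- (sg_tri_trim s U U (cj U) k), <- (tri_sg_trim s U U (cj U) k) by assumption.
  unfold defect.
  replace (sg (- s) (tri (sg s U) (sg s U) (sg (- s) (cj U))) k)
    with (sg (- s) (cubic (sg s U)) k); [unfold sg; ring|].
  apply sg_ext; unfold cubic; apply tri_ext; intros j; [reflexivity|reflexivity|apply cj_sg].
Qed.

Definition even_defect_cst : R := 2 * odd_cst + trim_cst alpha Zc * 108 * M ^ 3.

(** The contributions b [slope3] and -b [slope3] cancel, and the two phase parts combine into the
    multiplier estimated in [mdiff_sum_le]. *)
Lemma defect_even b : adm 1 b -> adm (-1) b ->
  HB alpha (fun k => defect b k + defect (- b) k)%C (b * Rpower b g * even_defect_cst).
Proof.
  intros H1 H2. destruct (H1) as (_ & Hb0 & Hin1); destruct (H2) as (_ & _ & Hin2).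
  pose proof (cubic_minus_free 1 b H1) as T1; pose proof (cubic_minus_free (-1) b H2) as T2.
  rewrite Rmult_1_l in T1, Hin1. replace (-1 * b) with (- b) in T2, Hin2 by ring.
  assert (HB alpha (trim (fun i l r => mdiff d b i l r + mdiff d (- b) i l r)%C U U (cj U))
    (trim_cst alpha Zc * (108 * (Rpower b g * b)) * M * M * M)) as T3.
  { apply (HB_trim d alpha g Zc); auto; try lra.
    - pose proof (Rpower_pos b g). nra.
    - intros i l r; apply mdiff_sum_le; lra.
    - apply HB_cj; auto. }
  eapply HB_le; [apply (HB_plus _ _ _ _ _ (HB_plus _ _ _ _ _ T1 T2) T3)|lra| |].
  - unfold even_defect_cst; right; ring.
  - intros k; rewrite !defect_split by auto.
    pose proof (a_summable _ Ht0) as SU. pose proof (csummable_cj d _ SU) as SU'.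
    rewrite trim_plus by first [assumption|apply mdiff_bounded].
    rewrite RtoC_opp; ring.
Qed.

Definition defect_cst : R := odd_cst + slope3_cst + trim_cst alpha Zc * 6 * M ^ 3.

Lemma defect_small b : adm 1 b -> HB alpha (defect b) (b * defect_cst).
Proof.
  intros H1. destruct (H1) as (_ & Hb0 & Hin1).
  pose proof (cubic_minus_free 1 b H1) as T1.
  rewrite Rmult_1_l in T1, Hin1.
  assert (HB alpha (trim (mdiff d b) U U (cj U))
    (trim_cst alpha Zc * (6 * b) * M * M * M)) as T3.
  { apply (HB_trim d alpha g Zc); auto; try lra.
    - intros i l r. pose proof (mdiff_le d g ltac:(lra) b i l r) as H.
      rewrite (Rabs_pos_eq b) in H by lra. exact H.
    - apply HB_cj; auto. }
  assert (HB alpha slope3 slope3_cst) as Hs3 by (eapply HB_lower; [|apply HB_slope3]; lra).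
  pose proof (HB_scal alpha b _ _ Hs3) as T2.
  rewrite Cmod_R, Rabs_pos_eq in T2 by lra.
  eapply HB_le; [apply (HB_plus _ _ _ _ _ (HB_plus _ _ _ _ _ T1 T2) T3)|lra| |].
  - assert (Rpower b g <= 1).
    { unfold Rpower. rewrite <- exp_0.
      assert (ln b <= 0) by (rewrite <- ln_1; apply ln_le; lra).
      assert (g * ln b <= 0) as [K|K] by nra; [left; now apply exp_increasing|rewrite K; lra]. }
    assert (0 <= odd_cst).
    { unfold odd_cst, slope3_cst, close_cst; pose proof tri_cst_nonneg; pose proof tri_cst_beta_nonneg; pose proof inter_cst_nonneg;
      pose proof expansion_cst_nonneg; pose proof slope_cst_nonneg.
      apply Rplus_le_le_0_compat; [|mul_nonneg].
      apply Rmult_le_pos; [lra|].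
      repeat apply Rplus_le_le_0_compat; mul_nonneg. }
    assert (b * Rpower b g * odd_cst <= b * odd_cst) by (apply Rmult_le_compat_r; nra).
    unfold defect_cst; nra.
  - intros k; rewrite defect_split by auto. ring.
Qed.

Definition gm (s : R) (x : Tn d Z -> C) (k : Tn d Z) : C := (gmul (sqnorm k) s * x k)%C.

Lemma csummable_gm s x : csummable x -> csummable (gm s x).
Proof.
  intros [B H]; exists (Rabs s * B); eapply L1_le; [|apply (L1_scal _ _ _ (Rabs_pos s) H)].
  intros k; unfold gm; rewrite Cmod_mult.
  apply Rmult_le_compat_r; [apply Cmod_ge_0|apply Cmod_gmul_le].
Qed.

(** [sg tau (zerr tau)] and [sg tau (zerr tau - zerr (- tau))] are the local errors
    of the starting step and of a two-step update. *)
Definition zerr (s : R) (k : Tn d Z) : C :=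
  (inter s k - U k + Ci * mu * tri U U (gm s (cj U)) k)%C.

Lemma cderive_tri_gm s k :
  cderive (fun s => tri U U (gm s (cj U)) k) s (tri U U (sg (- (2 * s)) (cj U)) k).
Proof.
  pose proof (a_summable _ Ht0) as SU. pose proof (csummable_cj d _ SU) as SU'.
  pose proof (csummable_conv d _ _ SU SU) as SUU.
  pose proof (cderive_csum (fun j => conv U U j * cj U (ksub k j))%C
    (fun j => gmul (sqnorm (ksub k j))) (fun j s => ei (2 * s * sqnorm (ksub k j))) s) as H.
  eapply cderive_ext; [|eapply cderive_val; [|apply H]].
  - intros r; apply csum_ext; intros j; unfold gm; cbv beta; ring.
  - apply csum_ext; intros j; unfold sg. replace (- (- (2 * s) * sqnorm (ksub k j)))
      with (2 * s * sqnorm (ksub k j)) by ring. ring.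
  - now apply conv_terms_summable.
  - intros; apply cderive_gmul.
  - intros; rewrite Cmod_ei; lra.
  - intros r. destruct (conv_terms_summable _ _ k SUU (csummable_gm r _ SU')) as [B HB].
    exists B; eapply L1_le; [|apply HB]. intros j; right; f_equal; unfold gm; ring.
Qed.

Lemma cderive_zerr e b s k : adm e b -> 0 < s < b ->
  cderive (fun s => zerr (e * s) k) s (e * (- Ci * mu * defect (e * s) k))%C.
Proof.
  intros Hb Hs; unfold zerr.
  eapply cderive_val; [|apply cderive_plus; [apply cderive_minus;
    [eapply cderive_inter; eauto|apply cderive_const]|
     apply (cderive_scal (Ci * mu)),
     (cderive_ext (fun s => tri U U (gm (0 + e * s) (cj U)) k)),
     (cderive_affine (fun r => tri U U (gm r (cj U)) k) e 0 s), cderive_tri_gm]].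
  - rewrite Rplus_0_l; unfold defect; ring.
  - intros r; now rewrite Rplus_0_l.
Qed.

Lemma rcont_zerr e b k : adm e b -> rcont (fun s => zerr (e * s) k) 0 b.
Proof.
  intros Hb; unfold zerr. 
  apply rcont_ext with (fun s => inter (e * s) k
    + (- U k + Ci * mu * tri U U (gm (0 + e * s) (cj U)) k))%C.
  { intros s; rewrite Rplus_0_l; ring. }
  apply rcont_plus; [now apply rcont_inter|].
  apply rcont_cderive with (f' := fun s => (0 + Ci * mu * (e * tri U U (sg (- (2 * (0 + e * s))) (cj U)) k))%C).
  intros s; apply cderive_plus; [apply cderive_const|].
  apply cderive_scal, (cderive_affine (fun r => tri U U (gm r (cj U)) k)), cderive_tri_gm.
Qed.

Lemma zerr_0 k : zerr 0 k = 0%C.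
Proof.
  unfold zerr; rewrite inter_0.
  rewrite (tri_ext d U U U U (gm 0 (cj U)) (fun j => 0 * cj U j)%C); auto.
  - rewrite tri_scal_3; [ring|..]; try apply csummable_cj; now apply a_summable.
  - intros j; unfold gm; now rewrite gmul_0.
Qed.

Lemma defect_cst_nonneg : 0 <= even_defect_cst /\ 0 <= defect_cst.
Proof.
  assert (0 <= slope3_cst) by (unfold slope3_cst; pose proof tri_cst_beta_nonneg; pose proof slope_cst_nonneg;
    mul_nonneg).
  assert (0 <= odd_cst).
  { unfold odd_cst, close_cst; pose proof tri_cst_nonneg; pose proof inter_cst_nonneg;
    pose proof expansion_cst_nonneg; pose proof slope_cst_nonneg.
    apply Rplus_le_le_0_compat; [|lra].
    apply Rmult_le_pos; [lra|].
    repeat apply Rplus_le_le_0_compat; mul_nonneg. }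
  assert (0 <= trim_cst alpha Zc * M ^ 3).
  { unfold trim_cst; pose proof (pow2_ge_0 (wt_cst alpha)); pose proof (pow2_ge_0 Zc);
    pose proof (pow_le M 3 HM); mul_nonneg. }
  unfold even_defect_cst, defect_cst; lra.
Qed.

(** One-sided: the defect is O(s) by [defect_small], so [HB_mvt] over [0, tau] gives tau^2. *)
Lemma local_error_start tau : adm 1 tau ->
  HB alpha (fun k => a (t0 + tau)%R k - (sg tau U k
     - Ci * mu * sg tau (tri U U (gm tau (cj U))) k))%C (Rabs mu * defect_cst * (tau * tau)).
Proof.
  intros H1; destruct (H1) as (_ & Ht & Hin).
  assert (HB alpha (fun k => zerr (1 * tau) k - zerr (1 * 0) k)%C (tau * (Rabs mu * (tau * defect_cst)))) as H.
  { apply (HB_mvt alpha (fun s => zerr (1 * s))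
      (fun s k => RtoC 1 * (- Ci * mu * defect (1 * s) k))%C); [lra| | | |].
    - pose proof (proj2 defect_cst_nonneg); pose proof (Rabs_pos mu). mul_nonneg.
    - intros k; now apply rcont_zerr.
    - intros k s Hs; eapply cderive_zerr; eauto.
    - intros s Hs; destruct (adm_inner 1 tau s H1 Hs) as [_ Hs'].
      eapply HB_le; [apply (HB_scal alpha (- Ci * mu)), (defect_small s Hs')|lra| |].
      + rewrite Cmod_Ci_mult. pose proof (proj2 defect_cst_nonneg); pose proof (Rabs_pos mu).
        apply Rmult_le_compat_l; auto. apply Rmult_le_compat_r; lra.
      + intros k; cbv beta; rewrite Rmult_1_l; ring. }
  eapply HB_le; [apply (HB_sg tau _ _ _ H)|lra|right; ring|].
  intros k; unfold sg at 3; rewrite Rmult_1_l, Rmult_0_r, zerr_0. unfold zerr.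
  rewrite a_inter; unfold sg; ring.
Qed.

(** [HB_mvt] is applied to zerr(s) - zerr(-s). Its derivative is -i mu (defect(s) + defect(-s)),
    which by [defect_even] gains the extra power s^g. *)
Lemma local_error_step tau : adm 1 tau -> adm (-1) tau ->
  HB alpha (fun k => a (t0 + tau)%R k - (sg (2 * tau) (a (t0 - tau)%R) k
     - Ci * mu * sg tau (tri U U (fun j => (gmul (sqnorm j) tau - gmul (sqnorm j) (- tau)) * cj U j)) k))%C
    (Rabs mu * even_defect_cst * (tau * (tau * Rpower tau g))).
Proof.
  intros H1 H2; destruct (H1) as (_ & Ht & Hin).
  assert (HB alpha (fun k => (zerr (1 * tau) k - zerr (-1 * tau) k) - (zerr (1 * 0) k - zerr (-1 * 0) k))%C
    (tau * (Rabs mu * (tau * Rpower tau g * even_defect_cst)))) as H.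
  { apply (HB_mvt alpha (fun s k => zerr (1 * s) k - zerr (-1 * s) k)%C
      (fun s k => RtoC 1 * (- Ci * mu * defect (1 * s) k) - RtoC (-1) * (- Ci * mu * defect (-1 * s) k))%C);
      [lra| | | |].
    - pose proof (proj1 defect_cst_nonneg); pose proof (Rabs_pos mu); pose proof (Rpower_pos tau g).
      mul_nonneg.
    - intros k. apply rcont_ext with (fun s => zerr (1 * s) k + RtoC (-1) * zerr (-1 * s) k)%C.
      { intros s; rewrite RtoC_m1; ring. }
      apply rcont_plus; [now apply rcont_zerr|].
      apply rcont_mult; [apply rcont_const|now apply rcont_zerr].
    - intros k s Hs; apply cderive_minus; eapply cderive_zerr; eauto.
    - intros s Hs; destruct (adm_inner 1 tau s H1 Hs) as [_ Hs1].
      destruct (adm_inner (-1) tau s H2 Hs) as [_ Hs2].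
      eapply HB_le; [apply (HB_scal alpha (- Ci * mu)), (defect_even s Hs1 Hs2)|lra| |].
      + rewrite Cmod_Ci_mult. pose proof (proj1 defect_cst_nonneg); pose proof (Rabs_pos mu).
        apply Rmult_le_compat_l; auto. apply Rmult_le_compat_r; auto.
        apply Rmult_le_compat; [lra|left; apply Rpower_pos|lra|apply Rle_Rpower_l; lra].
      + intros k; cbv beta; rewrite Rmult_1_l. replace (-1 * s) with (- s) by ring.
        rewrite RtoC_m1; ring. }
  eapply HB_le; [apply (HB_sg tau _ _ _ H)|lra|right; ring|].
  intros k; unfold sg at 3; rewrite Rmult_1_l, !Rmult_0_r, zerr_0.
  replace (-1 * tau) with (- tau) by ring. unfold zerr.
  pose proof (a_summable _ Ht0) as SU. pose proof (csummable_cj d _ SU) as SU'.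
  assert (tri U U (fun j => (gmul (sqnorm j) tau - gmul (sqnorm j) (- tau)) * cj U j)%C k
    = (tri U U (gm tau (cj U)) k - tri U U (gm (- tau) (cj U)) k)%C) as E.
  { replace (tri U U (gm tau (cj U)) k - tri U U (gm (- tau) (cj U)) k)%C with
      (tri U U (gm tau (cj U)) k + (-(1)) * tri U U (gm (- tau) (cj U)) k)%C by ring.
    rewrite <- tri_scal_3, <- tri_plus_3 by auto using csummable_scal, csummable_gm.
    apply tri_ext; auto; intros j; unfold gm; ring. }
  unfold sg at 2; rewrite E.
  rewrite (a_inter tau k).
  replace (2 * tau) with (tau + tau) by ring. rewrite sg_plus.
  replace (t0 - tau) with (t0 + - tau) by ring.
  (* Pulling back from time t0 - tau applies exp(i tau Delta); together with the outer factor this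
     is the exp(2 i tau Delta) of the scheme. *)
  replace (inter (- tau) k) with (sg tau (a (t0 + - tau)) k)
    by (unfold inter; now rewrite Ropp_involutive).
  unfold sg; ring.
Qed.

End LocalError.

(** * Continuous functions and their means *)

Definition ccont {X : UniformSpace} (f : X -> C) : Prop :=
  forall x eps, 0 < eps -> exists delta : posreal,
    forall y, ball x delta y -> Cmod (f y - f x) < eps.

Lemma ccont_continuous {X : UniformSpace} (f : X -> C) :
  ccont f <-> forall x, continuous (U := C_UniformSpace) f x.
Proof.
  split.
  - intros H x P [eps HP]; destruct (H x eps (cond_pos eps)) as [dl Hd].
    exists dl; intros y Hy; apply HP; specialize (Hd y Hy).
    split; unfold ball; simpl; unfold AbsRing_ball, abs, minus, plus, opp; simpl;
      (eapply Rle_lt_trans; [|exact Hd]).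
    + apply (Rabs_Re_le (f y - f x)).
    + apply (Rabs_Im_le (f y - f x)).
  - intros H x eps Heps.
    assert (0 < eps / 2) as He2 by lra.
    destruct (H x (ball (f x : C_UniformSpace) (mkposreal _ He2))) as [dl Hd].
    { now exists (mkposreal _ He2). }
    exists dl; intros y Hy; destruct (Hd y Hy) as [H1 H2].
    unfold ball in H1, H2; simpl in H1, H2.
    unfold AbsRing_ball, abs, minus, plus, opp in H1, H2; simpl in H1, H2.
    pose proof (Cmod_sqr (f y - f x)) as E. pose proof (Cmod_ge_0 (f y - f x)).
    change (fst (f y) + - fst (f x)) with (Re (f y - f x)) in H1.
    change (snd (f y) + - snd (f x)) with (Im (f y - f x)) in H2.
    rewrite <- (pow2_abs (Re _)), <- (pow2_abs (Im _)) in E.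
    pose proof (Rabs_pos (Re (f y - f x))); pose proof (Rabs_pos (Im (f y - f x))).
    apply Rnot_le_lt; intros K. nra.
Qed.

Lemma ccont_ext {X : UniformSpace} (f g : X -> C) : (forall x, f x = g x) -> ccont f -> ccont g.
Proof.
  intros E H x eps Heps; destruct (H x eps Heps) as [dl Hd]; exists dl; intros y Hy.
  rewrite <- !E; auto.
Qed.

Lemma ball_min_l {X : UniformSpace} (x y : X) (d1 d2 : posreal) :
  ball x (Rmin d1 d2) y -> ball x d1 y /\ ball x d2 y.
Proof. intros H; split; (eapply ball_le; [|exact H]); [apply Rmin_l|apply Rmin_r]. Qed.

Definition posmin (d1 d2 : posreal) : posreal :=
  mkposreal (Rmin d1 d2) (Rmin_pos _ _ (cond_pos d1) (cond_pos d2)).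

Lemma ccont_const {X : UniformSpace} c : ccont (fun _ : X => c).
Proof.
  intros x eps Heps; exists (mkposreal 1 Rlt_0_1); intros y _.
  replace (c - c)%C with (RtoC 0) by ring. now rewrite Cmod_0.
Qed.

Lemma ccont_plus {X : UniformSpace} (f g : X -> C) : ccont f -> ccont g ->
  ccont (fun x => f x + g x)%C.
Proof.
  intros Hf Hg x eps Heps.
  destruct (Hf x (eps / 2) ltac:(lra)) as [d1 K1].
  destruct (Hg x (eps / 2) ltac:(lra)) as [d2 K2].
  exists (posmin d1 d2); intros y Hy; destruct (ball_min_l _ _ _ _ Hy) as [Y1 Y2].
  specialize (K1 y Y1); specialize (K2 y Y2).
  replace (f y + g y - (f x + g x))%C with ((f y - f x) + (g y - g x))%C by ring.
  eapply Rle_lt_trans; [apply Cmod_triangle|lra].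
Qed.

Lemma ccont_mult {X : UniformSpace} (f g : X -> C) : ccont f -> ccont g ->
  ccont (fun x => f x * g x)%C.
Proof.
  intros Hf Hg x eps Heps.
  destruct (Cmult_continuous (f x) (g x) eps Heps) as (eta & He & K).
  destruct (Hf x _ He) as [d1 K1]; destruct (Hg x _ He) as [d2 K2].
  exists (posmin d1 d2); intros y Hy; destruct (ball_min_l _ _ _ _ Hy) as [Y1 Y2].
  apply K; auto.
Qed.

Lemma ccont_conj {X : UniformSpace} (f : X -> C) : ccont f -> ccont (fun x => Cconj (f x)).
Proof.
  intros Hf x eps Heps; destruct (Hf x eps Heps) as [dl Hd]; exists dl; intros y Hy.
  rewrite <- Cminus_conj, Cmod_conj; auto.
Qed.

Lemma ccont_lsum {X : UniformSpace} {I} (f : I -> X -> C) l : (forall i, ccont (f i)) ->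
  ccont (fun x => lsum (fun i => f i x) l).
Proof.
  intros H; induction l as [|i l IH]; cbn [lsum].
  - apply ccont_const.
  - apply (ccont_plus (f i)); auto.
Qed.

Lemma ccont_uniform_limit {X : UniformSpace} (f : X -> C) :
  (forall eps, 0 < eps -> exists g, ccont g /\ forall x, Cmod (f x - g x) < eps) -> ccont f.
Proof.
  intros H x eps Heps. destruct (H (eps / 3) ltac:(lra)) as (g & Hg & E).
  destruct (Hg x (eps / 3) ltac:(lra)) as [dl Hd]; exists dl; intros y Hy.
  specialize (Hd y Hy). pose proof (E x) as Ex; pose proof (E y) as Ey.
  replace (f y - f x)%C with ((f y - g y) + ((g y - g x) + - (f x - g x)))%C by ring.
  eapply Rle_lt_trans; [apply Cmod_triangle|].
  pose proof (Cmod_triangle (g y - g x) (- (f x - g x))) as Ht. rewrite Cmod_opp in Ht. lra.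
Qed.

Definition cint (f : R -> C) : C := RInt (V := C_R_CompleteNormedModule) f 0 (2 * PI).

Lemma ccont_Re (f : R -> C) : ccont f -> forall x, continuous (fun t => Re (f t)) x.
Proof.
  intros H x P [eps HP]; destruct (H x eps (cond_pos eps)) as [dl Hd].
  exists dl; intros y Hy; apply HP; specialize (Hd y Hy).
  unfold ball; simpl; unfold AbsRing_ball, abs, minus, plus, opp; simpl.
  eapply Rle_lt_trans; [apply (Rabs_Re_le (f y - f x))|exact Hd].
Qed.

Lemma ccont_Im (f : R -> C) : ccont f -> forall x, continuous (fun t => Im (f t)) x.
Proof.
  intros H x P [eps HP]; destruct (H x eps (cond_pos eps)) as [dl Hd].
  exists dl; intros y Hy; apply HP; specialize (Hd y Hy).
  unfold ball; simpl; unfold AbsRing_ball, abs, minus, plus, opp; simpl.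
  eapply Rle_lt_trans; [apply (Rabs_Im_le (f y - f x))|exact Hd].
Qed.

Lemma ex_RInt_ccont (f : R -> C) a b : ccont f -> ex_RInt (V := C_R_CompleteNormedModule) f a b.
Proof.
  intros H; apply ex_RInt_continuous; intros z _.
  apply (proj1 (ccont_continuous f) H).
Qed.

Lemma cint_pair (f : R -> C) : ccont f ->
  cint f = (RInt (fun t => Re (f t)) 0 (2 * PI), RInt (fun t => Im (f t)) 0 (2 * PI)).
Proof.
  intros Hf; unfold cint; apply (is_RInt_unique (V := C_R_CompleteNormedModule)).
  apply (is_RInt_fct_extend_pair (U := R_NormedModule) (V := R_NormedModule)); apply (RInt_correct (V := R_CompleteNormedModule));
    apply ex_RInt_continuous; intros; [now apply ccont_Re|now apply ccont_Im].
Qed.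

Lemma cint_ext f g : (forall t, f t = g t) -> cint f = cint g.
Proof. intros H; apply (RInt_ext (V := C_R_CompleteNormedModule)); intros; apply H. Qed.

Lemma cint_plus f g : ccont f -> ccont g -> cint (fun t => f t + g t)%C = (cint f + cint g)%C.
Proof.
  intros Hf Hg; apply (RInt_plus (V := C_R_CompleteNormedModule)); now apply ex_RInt_ccont.
Qed.

Lemma ex_RInt_Rcont (f : R -> R) a b : (forall x, continuous f x) -> ex_RInt f a b.
Proof. intros H; apply (ex_RInt_continuous (V := R_CompleteNormedModule)); intros; apply H. Qed.

Lemma cint_scal c f : ccont f -> cint (fun t => c * f t)%C = (c * cint f)%C.
Proof.
  intros Hf. rewrite !cint_pair; auto; [|now apply (ccont_mult (fun _ => c)); [apply ccont_const|]].
  pose proof (ex_RInt_Rcont _ 0 (2 * PI) (ccont_Re f Hf)) as E1.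
  pose proof (ex_RInt_Rcont _ 0 (2 * PI) (ccont_Im f Hf)) as E2.
  assert (forall a, ex_RInt (fun t => a * Re (f t)) 0 (2 * PI)) as S1
    by (intros a; apply (ex_RInt_scal (V := R_NormedModule)), E1).
  assert (forall a, ex_RInt (fun t => a * Im (f t)) 0 (2 * PI)) as S2
    by (intros a; apply (ex_RInt_scal (V := R_NormedModule)), E2).
  assert (forall a, RInt (fun t => a * Re (f t)) 0 (2 * PI) = a * RInt (fun t => Re (f t)) 0 (2 * PI)) as R1
    by (intros a; apply (RInt_scal (V := R_CompleteNormedModule)), E1).
  assert (forall a, RInt (fun t => a * Im (f t)) 0 (2 * PI) = a * RInt (fun t => Im (f t)) 0 (2 * PI)) as R2
    by (intros a; apply (RInt_scal (V := R_CompleteNormedModule)), E2).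
  unfold Cmult at 3; cbn [fst snd]; f_equal.
  - rewrite <- R1, <- R2.
    apply (RInt_minus (V := R_CompleteNormedModule) (fun t => fst c * Re (f t))
      (fun t => snd c * Im (f t))); auto.
  - rewrite <- R1, <- R2.
    apply (RInt_plus (V := R_CompleteNormedModule) (fun t => fst c * Im (f t))
      (fun t => snd c * Re (f t))); auto.
Qed.

Lemma cint_bound f B : ccont f -> (forall t, Cmod (f t) <= B) -> Cmod (cint f) <= 2 * PI * B.
Proof.
  intros Hf HB. pose proof PI_RGT_0.
  set (z := cint f).
  assert (Re (Cconj z * z) <= Cmod z * (2 * PI * B)) as H1.
  { assert (Cconj z * z = cint (fun t => Cconj z * f t))%C as -> by (symmetry; now apply cint_scal).
    assert (ccont (fun t => Cconj z * f t)%C) as Hc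
      by (apply ccont_mult; [apply ccont_const|auto]).
    rewrite cint_pair by auto. cbn [Re fst].
    replace (Cmod z * (2 * PI * B)) with (RInt (fun _ => Cmod z * B) 0 (2 * PI)).
    2:{ rewrite RInt_const; unfold scal; simpl; unfold mult; simpl; ring. }
    apply RInt_le; [lra| | |].
    - apply ex_RInt_Rcont, (ccont_Re _ Hc).
    - apply ex_RInt_const.
    - intros t _. eapply Rle_trans; [apply Rle_abs|].
      eapply Rle_trans; [apply Rabs_Re_le|]. rewrite Cmod_mult, Cmod_conj.
      apply Rmult_le_compat_l; [apply Cmod_ge_0|auto]. }
  assert (Re (Cconj z * z) = Cmod z ^ 2) as E.
  { rewrite Cmod_sqr; simpl; unfold Re, Im; simpl; ring. }
  rewrite E in H1. pose proof (Cmod_ge_0 z).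
  assert (0 <= B) by (eapply Rle_trans; [apply Cmod_ge_0|apply (HB 0)]).
  assert (0 <= 2 * PI * B) by (apply Rmult_le_pos; lra).
  apply Rnot_lt_le; intros K; nra.
Qed.

Lemma cint_conj f : ccont f -> cint (fun t => Cconj (f t)) = Cconj (cint f).
Proof.
  intros Hf; rewrite !cint_pair; auto using ccont_conj. unfold Cconj; simpl; f_equal.
  apply (RInt_opp (V := R_CompleteNormedModule)), ex_RInt_Rcont, (ccont_Im f Hf).
Qed.

Lemma ccont_slice {X Y : UniformSpace} (f : prod_UniformSpace X Y -> C) x :
  ccont f -> ccont (fun y => f (x, y)).
Proof.
  intros H y eps Heps; destruct (H (x, y) eps Heps) as [dl Hd]; exists dl; intros z Hz.
  apply Hd; split; [apply ball_center|exact Hz].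
Qed.

Lemma Cplus_minus_r (a b : C) : (a + (b - a))%C = b.
Proof. ring. Qed.

(** A tube argument: compactness of [0, 2 pi] makes the continuity of [f] at the points (x, t)
    uniform in [t]. *)
Lemma ccont_cint_param {X : UniformSpace} (f : prod_UniformSpace X R_UniformSpace -> C) :
  ccont f -> ccont (fun x => cint (fun t => f (x, t))).
Proof.
  intros Hf x eps Heps. pose proof PI_RGT_0.
  (* The integrand will vary by at most 2e, so the integral varies by at most 4 pi e = eps / 2. *)
  set (e := eps / (8 * PI)). assert (0 < e) as He by (apply Rdiv_lt_0_compat; lra).
  assert (forall t : R, { dl : posreal | forall y, ball (x, t) dl y -> Cmod (f y - f (x, t)) < e }) as W.
  { intros t. apply constructive_indefinite_description, (Hf (x, t) e He). }
  destruct (compactness_value_1d 0 (2 * PI) (fun t => proj1_sig (W t))) as [dl Hd].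
  exists dl; intros y Hy.
  assert (forall s, 0 <= s <= 2 * PI -> Cmod (f (y, s) - f (x, s)) <= 2 * e) as HU.
  { intros s Hs; apply Rnot_lt_le; intros K; apply (Hd s Hs); intros (t & Ht & Hst & Hdt).
    revert K; apply Rle_not_lt. destruct (W t) as [dt Hdt']; simpl in *.
    assert (ball t dt s) as Bs.
    { unfold ball; simpl; unfold AbsRing_ball, abs, minus, plus, opp; simpl; auto. }
    assert (Cmod (f (y, s) - f (x, t)) < e) as K1.
    { apply Hdt'; split; [eapply ball_le; [exact Hdt|exact Hy]|exact Bs]. }
    assert (Cmod (f (x, s) - f (x, t)) < e) as K2.
    { apply Hdt'; split; [apply ball_center|exact Bs]. }
    replace (f (y, s) - f (x, s))%C with ((f (y, s) - f (x, t)) + - (f (x, s) - f (x, t)))%C by ring.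
    eapply Rle_trans; [apply Cmod_triangle|]. rewrite Cmod_opp; lra. }
  pose proof (ccont_slice f x Hf) as Cx; pose proof (ccont_slice f y Hf) as Cy.
  set (g := fun s => (f (y, s) - f (x, s))%C).
  assert (ccont g) as Cg.
  { apply (ccont_ext (fun s => f (y, s) + (-(1)) * f (x, s))%C); [intros; unfold g; ring|].
    apply (ccont_plus (fun s => f (y, s))); auto.
    apply (ccont_mult (fun _ => (-(1))%C) (fun s => f (x, s))); auto using ccont_const. }
  assert (cint (fun t => f (y, t)) - cint (fun t => f (x, t)) = cint g)%C as ->.
  { replace (cint (fun t => f (y, t))) with (cint (fun t => f (x, t) + g t)%C).
    - rewrite cint_plus by auto; ring.
    - apply cint_ext; intros t; exact (Cplus_minus_r (f (x, t)) (f (y, t))). }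
  (* Clamping [g] to the interval of integration makes the bound global. *)
  set (cl := fun s => Rmax 0 (Rmin (2 * PI) s)).
  assert (forall s, 0 <= cl s <= 2 * PI) as Hcl.
  { intros s; unfold cl, Rmax, Rmin; repeat destruct Rle_dec; lra. }
  assert (cint g = cint (fun s => g (cl s))) as ->.
  { apply (RInt_ext (V := C_R_CompleteNormedModule)); intros s Hs. rewrite Rmin_left, Rmax_right in Hs by lra.
    f_equal; unfold cl, Rmax, Rmin; repeat destruct Rle_dec; lra. }
  eapply Rle_lt_trans; [apply cint_bound with (B := 2 * e)|].
  - intros s eps' Heps'; destruct (Cg (cl s) eps' Heps') as [d1 K1]; exists d1; intros z Hz.
    apply K1. unfold ball in *; simpl in *.
    unfold AbsRing_ball, abs, minus, plus, opp in *; simpl in *.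
    eapply Rle_lt_trans; [|exact Hz].
    unfold cl, Rmax, Rmin, Rabs; repeat destruct Rle_dec; repeat destruct Rcase_abs; lra.
  - intros s; apply HU, Hcl.
  - unfold e. apply Rle_lt_trans with (eps / 2); [right; field; lra|lra].
Qed.

Notation TR d := (Rn_UniformSpace d).

Lemma torus_mean_S {d} (f : Tn (S d) R -> C) :
  torus_mean f = (RtoC (/ (2 * PI)) * cint (fun t => torus_mean (fun y : Tn d R => f (t, y))))%C.
Proof. reflexivity. Qed.

Lemma torus_mean_ext {d} (f g : Tn d R -> C) : (forall x, f x = g x) -> torus_mean f = torus_mean g.
Proof.
  revert f g; induction d as [|d IH]; intros f g E; [apply E|].
  rewrite !torus_mean_S; f_equal; apply cint_ext; intros t; apply IH; intros y; apply E.
Qed.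

(** The parameter space is generalized in the induction: the integration variable of the outer layer
    joins the parameters of the inner mean. *)
Lemma ccont_torus_mean_param {d} {X : UniformSpace} (f : prod_UniformSpace X (TR d) -> C) :
  ccont f -> ccont (fun x => torus_mean (fun y : Tn d R => f (x, y))).
Proof.
  revert X f; induction d as [|d IH]; intros X f Hf.
  - intros x eps Heps; destruct (Hf (x, tt) eps Heps) as [dl Hd]; exists dl; intros y Hy.
    apply Hd; split; [exact Hy|exact I].
  - assert (ccont (fun p : prod_UniformSpace (prod_UniformSpace X R_UniformSpace) (TR d) =>
      f (fst (fst p), (snd (fst p), snd p)))) as Hf'.
    { intros [[x t] y] eps Heps; destruct (Hf (x, (t, y)) eps Heps) as [dl Hd]; exists dl.
      intros [[x' t'] y'] [[H1 H2] H3]; apply Hd; repeat split; auto. }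
    pose proof (ccont_cint_param _ (IH _ _ Hf')) as H.
    apply (ccont_mult (fun _ => RtoC (/ (2 * PI)))) in H; [|apply ccont_const].
    exact H.
Qed.

Lemma ccont_inner_mean {d} (f : Tn (S d) R -> C) :
  ccont (X := TR (S d)) f -> ccont (fun t : R => torus_mean (fun y : Tn d R => f (t, y))).
Proof. apply (ccont_torus_mean_param (X := R_UniformSpace) f). Qed.

Lemma ccont_Tn_slice {d} (f : Tn (S d) R -> C) t :
  ccont (X := TR (S d)) f -> ccont (X := TR d) (fun y => f (t, y)).
Proof. apply (ccont_slice (X := R_UniformSpace) (Y := TR d) f t). Qed.

Lemma torus_mean_plus {d} (f g : Tn d R -> C) : ccont (X := TR d) f -> ccont (X := TR d) g ->
  torus_mean (fun x => f x + g x)%C = (torus_mean f + torus_mean g)%C.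
Proof.
  revert f g; induction d as [|d IH]; intros f g Hf Hg; [reflexivity|].
  rewrite !torus_mean_S, <- Cmult_plus_distr_l, <- cint_plus by now apply ccont_inner_mean.
  f_equal; apply cint_ext; intros t; apply IH; now apply ccont_Tn_slice.
Qed.

Lemma torus_mean_scal {d} c (f : Tn d R -> C) : ccont (X := TR d) f ->
  torus_mean (fun x => c * f x)%C = (c * torus_mean f)%C.
Proof.
  revert f; induction d as [|d IH]; intros f Hf; [reflexivity|].
  rewrite !torus_mean_S.
  rewrite (cint_ext _ (fun t => c * torus_mean (fun y => f (t, y)))%C)
    by (intros t; apply IH; now apply ccont_Tn_slice).
  rewrite cint_scal by now apply ccont_inner_mean. ring.
Qed.

Lemma torus_mean_bound {d} (f : Tn d R -> C) B : ccont (X := TR d) f ->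
  (forall x, Cmod (f x) <= B) -> Cmod (torus_mean f) <= B.
Proof.
  revert f; induction d as [|d IH]; intros f Hf HB; [apply HB|].
  rewrite torus_mean_S, Cmod_mult, Cmod_R. pose proof PI_RGT_0.
  assert (0 < / (2 * PI)) by (apply Rinv_0_lt_compat; lra).
  rewrite Rabs_pos_eq by lra.
  apply Rle_trans with (/ (2 * PI) * (2 * PI * B)); [|right; field; lra].
  apply Rmult_le_compat_l; [lra|]. apply cint_bound; [now apply ccont_inner_mean|].
  intros t; apply IH; [now apply ccont_Tn_slice|auto].
Qed.

Lemma torus_mean_conj {d} (f : Tn d R -> C) : ccont (X := TR d) f ->
  torus_mean (fun x => Cconj (f x)) = Cconj (torus_mean f).
Proof.
  revert f; induction d as [|d IH]; intros f Hf; [reflexivity|].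
  rewrite !torus_mean_S, Cmult_conj.
  rewrite (cint_ext _ (fun t => Cconj (torus_mean (fun y => f (t, y)))))
    by (intros t; apply IH; now apply ccont_Tn_slice).
  rewrite cint_conj by now apply ccont_inner_mean.
  f_equal. apply injective_projections; simpl; ring.
Qed.

Lemma torus_mean_lsum {d} {I} (f : I -> Tn d R -> C) l : (forall i, ccont (X := TR d) (f i)) ->
  torus_mean (fun x => lsum (fun i => f i x) l) = lsum (fun i => torus_mean (f i)) l.
Proof.
  intros H; induction l as [|i l IH]; cbn [lsum].
  - assert (torus_mean (fun _ : Tn d R => (RtoC 0 * 0)%C) = (0 * torus_mean (fun _ : Tn d R => RtoC 0))%C) as E
      by (apply torus_mean_scal, ccont_const).
    rewrite !Cmult_0_l in E; exact E.
  - unfold plus at 1; simpl. rewrite torus_mean_plus; auto.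
    + now rewrite IH.
    + now apply ccont_lsum.
Qed.

(** * Fourier series on the torus *)

Lemma ei_2piZ (n : Z) : ei (2 * PI * IZR n) = 1%C.
Proof.
  assert (forall m : nat, ei (2 * PI * INR m) = 1%C) as H.
  { intros m; unfold ei. replace (2 * PI * INR m) with (0 + 2 * INR m * PI) by ring.
    rewrite cos_period, sin_period, cos_0, sin_0; reflexivity. }
  destruct (Z_le_dec 0 n) as [Hn|Hn].
  - rewrite <- (Z2Nat.id n Hn), <- INR_IZR_INZ; apply H.
  - replace (2 * PI * IZR n) with (- (2 * PI * INR (Z.to_nat (- n)))).
    + rewrite <- ei_conj, H. apply injective_projections; simpl; ring.
    + rewrite INR_IZR_INZ, Z2Nat.id, opp_IZR by lia; ring.
Qed.

Lemma Cmod_ei_minus_le a b : Cmod (ei a - ei b) <= Rabs (a - b).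
Proof.
  rewrite Cmod_ei_minus. pose proof (Rabs_sin_le ((a - b) / 2)) as H.
  unfold Rdiv in H at 2; rewrite Rabs_mult, (Rabs_pos_eq (/ 2)) in H by lra. lra.
Qed.

Lemma dot_continuous {d} (k : Tn d Z) (x : Tn d R) eps : 0 < eps ->
  exists delta : posreal, forall y : Tn d R, ball (M := TR d) x delta y -> Rabs (dot k y - dot k x) < eps.
Proof.
  revert x eps; induction d as [|d IH]; intros x eps Heps.
  - exists (mkposreal 1 Rlt_0_1); intros y _; simpl; rewrite Rminus_diag, Rabs_R0; auto.
  - destruct (IH (snd k) (snd x) (eps / 2) ltac:(lra)) as [d1 K1].
    set (A := Rabs (IZR (fst k)) + 1).
    assert (0 < A) as HA by (unfold A; pose proof (Rabs_pos (IZR (fst k))); lra).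
    assert (0 < eps / 2 / A) as H2 by (apply Rdiv_lt_0_compat; lra).
    exists (posmin d1 (mkposreal _ H2)); intros y [Y1 Y2].
    specialize (K1 (snd y) (ball_le _ _ _ (Rmin_l _ _) _ Y2)).
    unfold ball in Y1; simpl in Y1; unfold AbsRing_ball, abs, minus, plus, opp in Y1; simpl in Y1.
    pose proof (Rlt_le_trans _ _ _ Y1 (Rmin_r _ _)) as Y1'.
    cbn [dot].
    replace (IZR (fst k) * fst y + dot (snd k) (snd y) - (IZR (fst k) * fst x + dot (snd k) (snd x)))
      with (IZR (fst k) * (fst y + - fst x) + (dot (snd k) (snd y) - dot (snd k) (snd x))) by ring.
    eapply Rle_lt_trans; [apply Rabs_triang|]. rewrite Rabs_mult.
    assert (Rabs (IZR (fst k)) * Rabs (fst y + - fst x) <= A * (eps / 2 / A)).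
    { apply Rmult_le_compat; try apply Rabs_pos; [unfold A; lra|left; exact Y1']. }
    replace (A * (eps / 2 / A)) with (eps / 2) in H by (field; lra). lra.
Qed.

Lemma ccont_ei_dot {d} (k : Tn d Z) : ccont (X := TR d) (fun x => ei (dot k x)).
Proof.
  intros x eps Heps; destruct (dot_continuous k x eps Heps) as [dl Hd]; exists dl; intros y Hy.
  eapply Rle_lt_trans; [apply Cmod_ei_minus_le|apply Hd, Hy].
Qed.

Lemma ccont_ei_dot_opp {d} (k : Tn d Z) : ccont (X := TR d) (fun x => ei (- dot k x)).
Proof.
  apply (ccont_ext (X := TR d) (fun x => ei (dot (kopp k) x))).
  - intros x; now rewrite dot_kopp.
  - apply ccont_ei_dot.
Qed.

Lemma dot_translate {d} (k j : Tn d Z) x : exists n : Z,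
  dot k (translate x j) = dot k x + 2 * PI * IZR n.
Proof.
  induction d as [|d IH]; [exists 0%Z; simpl; ring|].
  destruct (IH (snd k) (snd j) (snd x)) as [n Hn].
  exists (fst k * fst j + n)%Z; cbn [dot translate fst snd].
  rewrite Hn, plus_IZR, mult_IZR; ring.
Qed.

Lemma ei_dot_translate {d} (k j : Tn d Z) x : ei (dot k (translate x j)) = ei (dot k x).
Proof.
  destruct (dot_translate k j x) as [n ->]. rewrite ei_plus, ei_2piZ; ring.
Qed.

Lemma ccont_ei_lin (c : R) : ccont (X := R_UniformSpace) (fun t => ei (c * t)).
Proof.
  intros x eps Heps.
  assert (0 < eps / (Rabs c + 1)) as H by (apply Rdiv_lt_0_compat; [lra|pose proof (Rabs_pos c); lra]).
  exists (mkposreal _ H); intros y Hy.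
  unfold ball in Hy; simpl in Hy; unfold AbsRing_ball, abs, minus, plus, opp in Hy; simpl in Hy.
  eapply Rle_lt_trans; [apply Cmod_ei_minus_le|].
  replace (c * y - c * x) with (c * (y + - x)) by ring. rewrite Rabs_mult.
  pose proof (Rabs_pos c); pose proof (Rabs_pos (y + - x)).
  apply Rle_lt_trans with ((Rabs c + 1) * Rabs (y + - x)); [nra|].
  apply Rlt_le_trans with ((Rabs c + 1) * (eps / (Rabs c + 1))); [|right; field; lra].
  apply Rmult_lt_compat_l; lra.
Qed.

Lemma cint_ei (n : Z) : n <> 0%Z -> cint (fun t => ei (IZR n * t)) = 0%C.
Proof.
  intros Hn. assert (IZR n <> 0) as Hn' by now apply not_0_IZR.
  pose proof (ei_2piZ n) as E.
  assert (cos (IZR n * (2 * PI)) = 1 /\ sin (IZR n * (2 * PI)) = 0) as [E1 E2].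
  { rewrite Rmult_comm; split; [now apply (f_equal fst) in E|now apply (f_equal snd) in E]. }
  rewrite cint_pair by apply ccont_ei_lin. unfold ei, Re, Im; cbn [fst snd].
  assert (is_RInt (fun t => cos (IZR n * t)) 0 (2 * PI)
    (minus (sin (IZR n * (2 * PI)) / IZR n) (sin (IZR n * 0) / IZR n))) as H1.
  { apply (is_RInt_derive (V := R_CompleteNormedModule) (fun t => sin (IZR n * t) / IZR n)).
    - intros; auto_derive; auto. field; auto.
    - intros; apply (ex_derive_continuous (V := R_NormedModule)); auto_derive; auto. }
  assert (is_RInt (fun t => sin (IZR n * t)) 0 (2 * PI)
    (minus (- cos (IZR n * (2 * PI)) / IZR n) (- cos (IZR n * 0) / IZR n))) as H2.
  { apply (is_RInt_derive (V := R_CompleteNormedModule) (fun t => - cos (IZR n * t) / IZR n)).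
    - intros; auto_derive; auto. field; auto.
    - intros; apply (ex_derive_continuous (V := R_NormedModule)); auto_derive; auto. }
  rewrite (is_RInt_unique (V := R_CompleteNormedModule) _ _ _ _ H1).
  rewrite (is_RInt_unique (V := R_CompleteNormedModule) _ _ _ _ H2).
  rewrite E1, E2, Rmult_0_r, sin_0, cos_0. unfold RtoC, minus, plus, opp; simpl.
  f_equal; field; auto.
Qed.

Lemma torus_mean_ei {d} (k : Tn d Z) :
  torus_mean (fun x => ei (dot k x)) = if freq_eq_dec k kzero then 1%C else 0%C.
Proof.
  induction d as [|d IH].
  - simpl. rewrite ei_0. destruct k; destruct (freq_eq_dec (d := 0) tt tt); congruence.
  - rewrite torus_mean_S. destruct k as [n k]; cbn [dot fst snd]. pose proof PI_RGT_0.
    rewrite (cint_ext _ (fun t => torus_mean (fun x : Tn d R => ei (dot k x)) * ei (IZR n * t))%C).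
    2:{ intros t. rewrite Cmult_comm, <- torus_mean_scal by apply ccont_ei_dot.
        apply torus_mean_ext; intros y; apply ei_plus. }
    rewrite cint_scal by apply ccont_ei_lin. rewrite IH.
    destruct (freq_eq_dec (d := S d) (n, k) kzero) as [E|E].
    + injection E as -> ->. destruct (freq_eq_dec (kzero (d := d)) kzero) as [_|]; [|congruence].
      rewrite (cint_ext _ (fun _ => 1%C)) by (intros; now rewrite Rmult_0_l, ei_0).
      unfold cint. rewrite (RInt_const (V := C_R_CompleteNormedModule)).
      unfold scal; simpl; unfold prod_scal, scal; simpl; unfold mult; simpl.
      apply injective_projections; simpl; field; lra.
    + destruct (freq_eq_dec k kzero) as [->|Hk]; [|ring].
      rewrite cint_ei; [ring|]. intros ->; apply E; reflexivity.
Qed.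

(** * Uniqueness of Fourier coefficients *)

Section Unique1D.

Variable g : R -> C.
Hypothesis Hg : ccont (X := R_UniformSpace) g.
Hypothesis Hz : forall n : Z, cint (fun t => g t * ei (- IZR n * t))%C = 0%C.

(** The function c + cos(t - x0) is a trigonometric polynomial of degree one, so one more factor
    only mixes the frequencies n - 1, n and n + 1. This is why the induction on [m] keeps [n]
    general. *)
Lemma cint_trig_power (x0 c : R) (m : nat) (n : Z) :
  cint (fun t => g t * RtoC ((c + cos (t - x0)) ^ m) * ei (- IZR n * t))%C = 0%C /\
  ccont (X := R_UniformSpace) (fun t => g t * RtoC ((c + cos (t - x0)) ^ m))%C.
Proof.
  revert n; induction m as [|m IH]; intros n.
  - split.
    + rewrite <- (Hz n); apply cint_ext; intros t; simpl; ring.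
    + eapply ccont_ext; [|apply Hg]; intros t; simpl; ring.
  - set (G := fun t => (g t * RtoC ((c + cos (t - x0)) ^ m))%C).
    assert (forall t, RtoC (c + cos (t - x0)) =
      (c + (/ 2 * ei (- x0)) * ei (1 * t) + (/ 2 * ei x0) * ei (- (1) * t))%C) as E.
    { intros t; rewrite cos_minus; unfold ei. rewrite Rmult_1_l.
      replace (- (1) * t) with (- t) by ring. rewrite !cos_neg, !sin_neg.
      apply injective_projections; simpl; field. }
    assert (ccont (X := R_UniformSpace) G) as HG by (apply (proj2 (IH 0%Z))).
    assert (forall q r, ccont (X := R_UniformSpace) (fun t => q * (G t * ei (r * t)))%C) as HGe.
    { intros q r. apply (ccont_mult (X := R_UniformSpace) (fun _ => q)); [apply ccont_const|].
      apply (ccont_mult (X := R_UniformSpace)); [apply HG|apply ccont_ei_lin]. }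
    split.
    + rewrite (cint_ext _ (fun t => RtoC c * (G t * ei (- IZR n * t))
        + ((/ 2 * ei (- x0)) * (G t * ei (- IZR (n - 1) * t))
        + (/ 2 * ei x0) * (G t * ei (- IZR (n + 1) * t))))%C).
      * rewrite !cint_plus; auto.
        2:{ apply (ccont_plus (X := R_UniformSpace)); auto. }
        rewrite !cint_scal by (apply (ccont_mult (X := R_UniformSpace)); [apply HG|apply ccont_ei_lin]).
        assert (forall n, cint (fun t => G t * ei (- IZR n * t))%C = 0%C) as I0
          by exact (fun n => proj1 (IH n)).
        rewrite !I0. ring.
      * intros t. rewrite <- tech_pow_Rmult, RtoC_mult, E.
        replace (- IZR (n - 1) * t) with (1 * t + - IZR n * t) by (rewrite minus_IZR; ring).
        replace (- IZR (n + 1) * t) with (- (1) * t + - IZR n * t) by (rewrite plus_IZR; ring).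
        rewrite !ei_plus. unfold G; ring.
    + apply (ccont_ext (X := R_UniformSpace) (fun t => RtoC c * (G t * ei (0 * t))
        + ((/ 2 * ei (- x0)) * (G t * ei (1 * t)) + (/ 2 * ei x0) * (G t * ei (- (1) * t))))%C).
      * intros t. rewrite <- tech_pow_Rmult, RtoC_mult, E, Rmult_0_l, ei_0. unfold G; ring.
      * repeat apply (ccont_plus (X := R_UniformSpace)); auto.
Qed.

(** If [g x0 <> 0], testing against high powers of [1 + cos (t - x0) - cos delta],
    which exceeds 1 near [x0] and is bounded by 1 elsewhere, is absurd. *)
Lemma unique_interior x0 : 0 < x0 < 2 * PI -> g x0 = 0%C.
Proof.
  intros Hx0. apply NNPP; intros Hne. pose proof PI_RGT_0 as HPI.
  set (G := fun t => (Cconj (g x0) * g t)%C).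
  assert (ccont (X := R_UniformSpace) G) as HG
    by (apply (ccont_mult (X := R_UniformSpace)); [apply ccont_const|apply Hg]).
  set (h := fun t => Re (G t)).
  assert (forall x, continuous h x) as Hh by (apply ccont_Re, HG).
  set (c := Cmod (g x0) ^ 2 / 2).
  assert (0 < c) as Hc.
  { unfold c; apply Cmod_gt_0 in Hne. nra. }
  assert (h x0 = 2 * c) as Hhx.
  { unfold h, G, c; rewrite Cmod_sqr; simpl; unfold Re, Im; simpl; field. }
  destruct (HG x0 c Hc) as [d0 Hd0].
  (* The bounds by x0/2 and (2 pi - x0)/2 keep the neighbourhood inside the period and give |t - x0|
     <= 2 pi - dl throughout [0, 2 pi], so that the cosine stays below cos(dl) away from [x0]. Being
     at most 1, [dl] lies where the cosine decreases. *)
  set (dl := Rmin (d0 / 2) (Rmin 1 (Rmin (x0 / 2) ((2 * PI - x0) / 2)))).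
  assert (0 < dl /\ dl <= d0 / 2 /\ dl <= 1 /\ dl <= x0 / 2 /\ dl <= (2 * PI - x0) / 2) as (D0 & D1 & D2 & D3 & D4).
  { pose proof (cond_pos d0). unfold dl. repeat split.
    - repeat apply Rmin_pos; lra.
    - apply Rmin_l.
    - eapply Rle_trans; [apply Rmin_r|apply Rmin_l].
    - eapply Rle_trans; [apply Rmin_r|]; eapply Rle_trans; [apply Rmin_r|apply Rmin_l].
    - eapply Rle_trans; [apply Rmin_r|]; eapply Rle_trans; [apply Rmin_r|apply Rmin_r]. }
  assert (forall t, Rabs (t - x0) <= dl -> c <= h t) as Hnear.
  { intros t Ht. assert (Cmod (G t - G x0) < c) as K.
    { apply Hd0. unfold ball; simpl; unfold AbsRing_ball, abs, minus, plus, opp; simpl.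
      apply Rle_lt_trans with dl; [exact Ht|]. pose proof (cond_pos d0); lra. }
    pose proof (Rle_lt_trans _ _ _ (Rabs_Re_le _) K) as K'. apply Rabs_def2 in K'.
    change (Re (G t - G x0)) with (h t - h x0) in K'. lra. }
  set (p := fun t => (1 - cos dl) + cos (t - x0)).
  pose proof PI2_1 as HP2.
  assert (0 < cos dl) as Hcd by (apply cos_gt_0; lra).
  assert (forall t, Rabs (t - x0) <= dl -> 1 <= p t) as Pnear.
  { intros t Ht; unfold p.
    assert (cos dl <= cos (t - x0)); [|lra].
    replace (cos (t - x0)) with (cos (Rabs (t - x0))).
    - apply cos_decr_1; try lra; pose proof (Rabs_pos (t - x0)); lra.
    - unfold Rabs; destruct Rcase_abs; auto; apply cos_neg. }
  assert (forall t, 0 <= t <= 2 * PI -> dl <= Rabs (t - x0) -> Rabs (p t) <= 1) as Pfar.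
  { intros t Ht Hd. assert (cos (t - x0) <= cos dl) as K.
    { replace (cos (t - x0)) with (cos (Rabs (t - x0)))
        by (unfold Rabs; destruct Rcase_abs; auto; apply cos_neg).
      assert (Rabs (t - x0) <= 2 * PI - dl) by (apply Rabs_le; lra).
      destruct (Rle_dec (Rabs (t - x0)) PI).
      - apply cos_decr_1; lra.
      - replace (cos (Rabs (t - x0))) with (cos (2 * PI - Rabs (t - x0))).
        + apply cos_decr_1; lra.
        + rewrite cos_minus, cos_2PI, sin_2PI; ring. }
    unfold p; pose proof (COS_bound (t - x0)); pose proof (COS_bound dl).
    apply Rabs_le; lra. }
  (* A lower bound for [p] on the half-size neighbourhood; since q > 1, the contribution from there
     grows geometrically with the power. *)
  set (q := 1 - cos dl + cos (dl / 2)).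
  assert (1 < q) as Hq.
  { unfold q. assert (cos dl < cos (dl / 2)) by (apply cos_decreasing_1; lra). lra. }
  assert (forall t, Rabs (t - x0) <= dl / 2 -> q <= p t) as Pq.
  { intros t Ht; unfold p, q. assert (cos (dl / 2) <= cos (t - x0)); [|lra].
    replace (cos (t - x0)) with (cos (Rabs (t - x0)))
      by (unfold Rabs; destruct Rcase_abs; auto; apply cos_neg).
    apply cos_decr_1; try lra; pose proof (Rabs_pos (t - x0)); lra. }
  assert (exists H, 0 <= H /\ forall t, 0 <= t <= 2 * PI -> Rabs (h t) <= H) as (H & HH0 & HH).
  { destruct (continuity_ab_maj (fun t => Rabs (h t)) 0 (2 * PI)) as (tm & Htm & _); [lra| |].
    - intros t _. apply continuity_pt_filterlim.
      apply (continuous_comp h Rabs); [apply Hh|apply continuous_Rabs].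
    - exists (Rabs (h tm)); split; [apply Rabs_pos|exact Htm]. }
  assert (forall m, RInt (fun t => h t * p t ^ m) 0 (2 * PI) = 0
     /\ forall x, continuous (fun t => h t * p t ^ m) x) as Hint.
  { intros m. destruct (cint_trig_power x0 (1 - cos dl) m 0%Z) as [E1 E2].
    assert (ccont (X := R_UniformSpace) (fun t => Cconj (g x0) * (g t * RtoC (p t ^ m)))%C) as E3
      by (apply (ccont_mult (X := R_UniformSpace)); [apply ccont_const|apply E2]).
    assert (forall t, h t * p t ^ m = Re (Cconj (g x0) * (g t * RtoC (p t ^ m)))) as E4.
    { intros t; unfold h, G; simpl; unfold Re, Im; simpl; ring. }
    split.
    - rewrite (RInt_ext _ (fun t => Re (Cconj (g x0) * (g t * RtoC (p t ^ m))))) by (intros; apply E4).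
      change (Re (RInt (fun t => Re (Cconj (g x0) * (g t * RtoC (p t ^ m)))) 0 (2 * PI),
              RInt (fun t => Im (Cconj (g x0) * (g t * RtoC (p t ^ m)))) 0 (2 * PI)) = 0).
      rewrite <- cint_pair, cint_scal by auto.
      rewrite (cint_ext _ (fun t => g t * RtoC ((1 - cos dl + cos (t - x0)) ^ m) * ei (- IZR 0 * t))%C).
      + rewrite E1; simpl; unfold Re; simpl; ring.
      + intros t. replace (- IZR 0 * t) with 0 by (simpl; ring). rewrite ei_0. unfold p; ring.
    - intros x. eapply continuous_ext; [intros t; symmetry; apply E4|]. apply (ccont_Re _ E3). }
  set (A := x0 - dl / 2); set (B := x0 + dl / 2).
  assert (forall m a b k, a <= b -> (forall t, a < t < b -> k <= h t * p t ^ m) ->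
     k * (b - a) <= RInt (fun t => h t * p t ^ m) a b) as Hlow.
  { intros m a b k Hab Hk.
    replace (k * (b - a)) with (RInt (fun _ => k) a b).
    - apply RInt_le; auto; [apply ex_RInt_const|apply ex_RInt_Rcont, Hint].
    - rewrite RInt_const; unfold scal; simpl; unfold mult; simpl; ring. }
  assert (forall m t, 0 <= t <= 2 * PI -> - H <= h t * p t ^ m) as Hany.
  { intros m t Ht. destruct (Rle_dec (Rabs (t - x0)) dl) as [K|K].
    - pose proof (Hnear t K); pose proof (Pnear t K).
      assert (0 <= h t * p t ^ m) by (apply Rmult_le_pos; [lra|apply pow_le; lra]). lra.
    - assert (Rabs (h t * p t ^ m) <= H) as K2.
      { rewrite Rabs_mult, <- RPow_abs. rewrite <- (Rmult_1_r H).
        apply Rmult_le_compat; try apply Rabs_pos; [apply pow_le, Rabs_pos|auto|].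
        rewrite <- (pow1 m). apply pow_incr; split; [apply Rabs_pos|apply Pfar; auto; lra]. }
      apply Rabs_le_between in K2; lra. }
  (* The whole integral vanishes. The middle interval contributes at least q^m c dl and the outer
     ones at least -H times their length, so q^m would stay bounded. *)
  assert (forall m, q ^ m * (c * dl) <= 2 * PI * H) as Habs.
  { intros m. destruct (Hint m) as [I0 Ic].
    pose proof (Hlow m 0 A (- H) ltac:(unfold A; lra) ltac:(intros t Ht; apply Hany; unfold A in *; lra)) as L1.
    pose proof (Hlow m B (2 * PI) (- H) ltac:(unfold B; lra) ltac:(intros t Ht; apply Hany; unfold B in *; lra)) as L3.
    assert (q ^ m * c * (B - A) <= RInt (fun t => h t * p t ^ m) A B) as L2.
    { apply Hlow; [unfold A, B; lra|]. intros t Ht.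
      assert (Rabs (t - x0) <= dl / 2) as K by (apply Rabs_le; unfold A, B in *; lra).
      rewrite Rmult_comm. apply Rmult_le_compat; [lra|apply pow_le; lra|apply Hnear; lra|].
      apply pow_incr; split; [lra|auto]. }
    assert (RInt (fun t => h t * p t ^ m) 0 A + (RInt (fun t => h t * p t ^ m) A B
      + RInt (fun t => h t * p t ^ m) B (2 * PI)) = 0) as E.
    { assert (forall a b, ex_RInt (fun t => h t * p t ^ m) a b) as Ex
        by (intros; apply ex_RInt_Rcont, Ic).
      pose proof (RInt_Chasles (V := R_CompleteNormedModule) _ A B (2 * PI) (Ex _ _) (Ex _ _)) as C1.
      pose proof (RInt_Chasles (V := R_CompleteNormedModule) _ 0 A (2 * PI) (Ex _ _) (Ex _ _)) as C2.
      unfold plus in C1, C2; simpl in C1, C2. rewrite I0 in C2; lra. }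
    replace (B - A) with dl in L2 by (unfold A, B; field).
    assert (A - 0 = x0 - dl / 2) as EA by (unfold A; ring). rewrite EA in L1.
    assert (2 * PI - B = 2 * PI - x0 - dl / 2) as EB by (unfold B; ring). rewrite EB in L3.
    assert (0 <= H * dl) by (apply Rmult_le_pos; lra).
    lra. }
  destruct (Pow_x_infinity q ltac:(rewrite Rabs_pos_eq; lra) ((2 * PI * H + 1) / (c * dl))) as [N HN].
  specialize (HN N (Nat.le_refl _)). specialize (Habs N).
  rewrite Rabs_pos_eq in HN by (apply pow_le; lra).
  assert (0 < c * dl) as Hcdl by (apply Rmult_lt_0_compat; lra).
  apply Rge_le in HN. apply Rmult_le_compat_r with (r := c * dl) in HN; [|lra].
  replace ((2 * PI * H + 1) / (c * dl) * (c * dl)) with (2 * PI * H + 1) in HN by (field; lra).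
  lra.
Qed.

Hypothesis Hper : forall t (n : Z), g (t + 2 * PI * IZR n) = g t.

(** Periodicity moves [t] into [0, 2 pi). Interior points are settled by [unique_interior], and the
    end point 0 follows by continuity from the right. *)
Lemma fourier_unique_1d t : g t = 0%C.
Proof.
  pose proof PI_RGT_0 as HPI.
  set (n := Int_part (t / (2 * PI))). set (s := t + 2 * PI * IZR (- n)).
  assert (0 <= s < 2 * PI) as Hs.
  { destruct (base_Int_part (t / (2 * PI))) as [B1 B2]. fold n in B1, B2.
    assert (t = 2 * PI * (t / (2 * PI))) as Et by (field; lra).
    unfold s; rewrite opp_IZR. nra. }
  rewrite <- (Hper t (- n)); fold s.
  destruct (Req_dec s 0) as [->|Hs0]; [|apply unique_interior; lra].
  apply NNPP; intros Hne. apply Cmod_gt_0 in Hne.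
  destruct (Hg 0 (Cmod (g 0)) Hne) as [dl Hd].
  set (r := Rmin (dl / 2) PI).
  assert (0 < r /\ r <= dl / 2 /\ r <= PI) as (R1 & R2 & R3).
  { pose proof (cond_pos dl); unfold r; repeat split; [apply Rmin_pos; lra|apply Rmin_l|apply Rmin_r]. }
  assert (Cmod (g r - g 0) < Cmod (g 0)) as K.
  { apply Hd. unfold ball; simpl; unfold AbsRing_ball, abs, minus, plus, opp; simpl.
    pose proof (cond_pos dl). apply Rabs_def1; lra. }
  rewrite unique_interior in K by lra.
  replace (0 - g 0)%C with (- g 0)%C in K by ring. rewrite Cmod_opp in K; lra.
Qed.

End Unique1D.

Definition periodic {d} (f : Tn d R -> C) : Prop := forall x k, f (translate x k) = f x.

Lemma cexp_opp_dot (r : R) : cexp (- Ci * r) = ei (- r).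
Proof.
  rewrite <- cexp_Ci; f_equal. apply injective_projections; simpl; ring.
Qed.

Lemma fourier_coef_ei {d} (f : Tn d R -> C) k :
  fourier_coef f k = torus_mean (fun x => f x * ei (- dot k x))%C.
Proof. apply torus_mean_ext; intros x; now rewrite cexp_opp_dot. Qed.

Lemma translate_kzero {d} (x : Tn d R) : translate x kzero = x.
Proof.
  induction d as [|d IH]; destruct x; simpl; auto.
  rewrite IH; f_equal; ring.
Qed.

Lemma Cmult_swap (a b c : C) : (a * (b * c))%C = (b * (a * c))%C.
Proof. ring. Qed.

(** Fixing a frequency in all but the first variable gives a continuous periodic function of the
    first variable whose one-dimensional coefficients vanish, so it is zero. Hence every slice has
    vanishing coefficients, and the induction hypothesis applies to it. *)
Lemma fourier_unique {d} (f : Tn d R -> C) : ccont (X := TR d) f -> periodic f ->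
  (forall k, fourier_coef f k = 0%C) -> forall x, f x = 0%C.
Proof.
  induction d as [|d IH]; intros Hf Hp Hz x.
  - specialize (Hz tt); rewrite fourier_coef_ei in Hz; simpl in Hz.
    rewrite Ropp_0, ei_0, Cmult_1_r in Hz. now destruct x.
  - destruct x as [t y]. revert y; apply (IH (fun y => f (t, y))).
    + now apply ccont_Tn_slice.
    + intros y k; specialize (Hp (t, y) (0%Z, k)). simpl in Hp.
      rewrite Rmult_0_r, Rplus_0_r in Hp; exact Hp.
    + intros k. rewrite fourier_coef_ei.
      set (F := fun x : Tn (S d) R => (f x * ei (- dot ((0%Z, k) : Tn (S d) Z) x))%C).
      assert (ccont (X := TR (S d)) F) as HF
        by (apply (ccont_mult (X := TR (S d))); [exact Hf|apply ccont_ei_dot_opp]).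
      set (g := fun t : R => torus_mean (fun y : Tn d R => F (t, y))).
      assert (forall t y, F (t, y) = (f (t, y) * ei (- dot k y))%C) as EF.
      { intros s z; unfold F; cbn [dot fst snd]. do 3 f_equal; ring. }
      rewrite <- (torus_mean_ext (fun y => F (t, y))) by (intros; apply EF).
      change (g t = 0%C). apply fourier_unique_1d.
      * now apply (ccont_inner_mean F).
      * intros n. specialize (Hz (n, k)). rewrite fourier_coef_ei, torus_mean_S in Hz.
        pose proof PI_RGT_0.
        replace (cint (fun t => g t * ei (- IZR n * t))%C) with
          (RtoC (2 * PI) * (RtoC (/ (2 * PI)) * cint (fun t => g t * ei (- IZR n * t))))%C.
        2:{ rewrite Cmult_assoc, <- RtoC_mult, Rinv_r by lra; ring. }
        rewrite <- (Cmult_0_r (RtoC (2 * PI))), <- Hz. do 2 f_equal.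
        apply cint_ext; intros s. unfold g. rewrite Cmult_comm, <- torus_mean_scal.
        2:{ now apply ccont_Tn_slice. }
        apply torus_mean_ext; intros z. rewrite EF. cbn [dot fst snd].
        replace (- (IZR n * s + dot k z)) with (- IZR n * s + - dot k z) by ring.
        rewrite ei_plus; exact (Cmult_swap _ _ _).
      * intros s n. apply torus_mean_ext; intros z. rewrite !EF. f_equal.
        pose proof (Hp (s, z) (n, kzero)) as E. simpl in E. now rewrite translate_kzero in E.
Qed.

Definition fsum {d} (c : Tn d Z -> C) (x : Tn d R) : C := csum (fun k => c k * ei (dot k x))%C.

Lemma fsum_terms {d} (c : Tn d Z -> C) B x : L1 (fun k => Cmod (c k)) B ->
  L1 (fun k => Cmod (c k * ei (dot k x))) B.
Proof.
  intros H; eapply L1_le; [|exact H]; intros k; rewrite Cmod_mult, Cmod_ei; lra.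
Qed.

Lemma fsum_tail {d} (c : Tn d Z -> C) B : L1 (fun k => Cmod (c k)) B -> forall eps, 0 < eps ->
  exists N0, forall N, (N0 <= N)%nat -> forall x,
    Cmod (fsum c x - lsum (fun k => c k * ei (dot k x))%C (boxl d N)) < eps.
Proof.
  intros HB eps Heps.
  destruct (rsum_tail_lim _ _ (fun k => Cmod_ge_0 (c k)) HB (mkposreal eps Heps)) as [N HN].
  exists N; intros M HM x.
  pose proof (csum_tail (fun k => c k * ei (dot k x))%C (fun k => Cmod (c k)) B M) as H.
  rewrite (box_sum_lsum (G := C_AbelianGroup)) in H.
  eapply Rle_lt_trans; [apply H; auto|].
  - intros k; rewrite Cmod_mult, Cmod_ei; lra.
  - simpl in HN. pose proof (box_sum_incr (fun k => Cmod (c k)) N M (fun k => Cmod_ge_0 (c k)) HM). lra.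
Qed.

Lemma ccont_trig {d} (c : C) (k : Tn d Z) : ccont (X := TR d) (fun x => c * ei (dot k x))%C.
Proof. apply (ccont_mult (X := TR d)); [apply ccont_const|apply ccont_ei_dot]. Qed.

Lemma ccont_fsum {d} (c : Tn d Z -> C) : csummable c -> ccont (X := TR d) (fsum c).
Proof.
  intros [B HB]; apply (ccont_uniform_limit (X := TR d)); intros eps Heps.
  destruct (fsum_tail c B HB eps Heps) as [N HN].
  exists (fun x => lsum (fun k => c k * ei (dot k x))%C (boxl d N)); split.
  - apply (ccont_lsum (X := TR d)); intros; apply ccont_trig.
  - intros x; apply HN; lia.
Qed.

Lemma periodic_fsum {d} (c : Tn d Z -> C) : periodic (fsum c).
Proof. intros x k; apply csum_ext; intros j; now rewrite ei_dot_translate. Qed.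

Lemma fsum_bound {d} (c : Tn d Z -> C) B x : L1 (fun k => Cmod (c k)) B -> Cmod (fsum c x) <= B.
Proof. intros H; now apply csum_bound, fsum_terms. Qed.

Lemma ccont_minus {X : UniformSpace} (f g : X -> C) : ccont f -> ccont g ->
  ccont (fun x => f x - g x)%C.
Proof.
  intros Hf Hg; apply (ccont_ext (fun x => f x + (-(1)) * g x)%C); [intros; ring|].
  apply ccont_plus; auto. apply ccont_mult; auto using ccont_const.
Qed.

Lemma torus_mean_minus {d} (f g : Tn d R -> C) : ccont (X := TR d) f -> ccont (X := TR d) g ->
  torus_mean (fun x => f x - g x)%C = (torus_mean f - torus_mean g)%C.
Proof.
  intros Hf Hg.
  rewrite (torus_mean_ext _ (fun x => f x + (-(1)) * g x)%C) by (intros; ring).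
  rewrite torus_mean_plus, torus_mean_scal; auto; [ring|].
  apply (ccont_mult (X := TR d)); auto; apply ccont_const.
Qed.

(** Termwise integration: a Fourier series with summable coefficients
    converges uniformly. *)
Lemma torus_mean_fsum_mult {d} (c : Tn d Z -> C) (phi : Tn d R -> C) B :
  csummable c -> ccont (X := TR d) phi -> (forall x, Cmod (phi x) <= B) ->
  torus_mean (fun x => fsum c x * phi x)%C
  = csum (fun k => c k * torus_mean (fun x => ei (dot k x) * phi x))%C.
Proof.
  intros Hc Hphi HB; destruct (Hc) as [A HA].
  assert (0 <= B) as HB0.
  { eapply Rle_trans; [apply Cmod_ge_0|apply (HB
      ((fix origin n : Tn n R := match n with O => tt | S n' => (0, origin n') end) d))]. }
  assert (forall k, ccont (X := TR d) (fun x => ei (dot k x) * phi x)%C) as Ck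
    by (intros k; apply (ccont_mult (X := TR d)); [apply ccont_ei_dot|auto]).
  assert (ccont (X := TR d) (fun x => fsum c x * phi x)%C) as Cf
    by (apply (ccont_mult (X := TR d)); [now apply ccont_fsum|auto]).
  symmetry; apply csum_unique.
  - exists (B * A); eapply L1_le; [|apply (L1_scal _ _ _ HB0 HA)].
    intros k; rewrite Cmod_mult, Rmult_comm. apply Rmult_le_compat_r; [apply Cmod_ge_0|].
    apply torus_mean_bound; [apply Ck|]. intros x; rewrite Cmod_mult, Cmod_ei, Rmult_1_l; auto.
  - set (z := torus_mean (fun x => (fsum c x * phi x)%C)).
    assert (forall eps : posreal, exists N0, forall N, (N0 <= N)%nat ->
      Cmod (box_sum N (fun k => c k * torus_mean (fun x => ei (dot k x) * phi x))%C - z) < eps) as H.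
    { intros eps.
      assert (0 < eps / 2 / (B + 1)) as He
        by (apply Rdiv_lt_0_compat; [pose proof (cond_pos eps)|]; lra).
      destruct (fsum_tail c A HA _ He) as [N0 HN]; exists N0; intros N HNN. specialize (HN N HNN).
      rewrite (box_sum_lsum (G := C_AbelianGroup)).
      assert (lsum (fun k => c k * torus_mean (fun x => ei (dot k x) * phi x))%C (boxl d N)
        = torus_mean (fun x => lsum (fun k => c k * ei (dot k x))%C (boxl d N) * phi x)%C) as ->.
      { rewrite (lsum_ext (G := C_AbelianGroup) _
          (fun k => torus_mean (fun x => c k * (ei (dot k x) * phi x))%C)).
        2:{ intros k; symmetry; now apply torus_mean_scal. }
        rewrite <- torus_mean_lsum.
        2:{ intros k; apply (ccont_mult (X := TR d)); [apply ccont_const|apply Ck]. }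
        apply torus_mean_ext; intros x. rewrite (Cmult_comm _ (phi x)), <- lsum_Cscal.
        apply (lsum_ext (G := C_AbelianGroup)); intros k.
        exact (eq_trans (Cmult_assoc _ _ _) (Cmult_comm _ _)). }
      unfold z; rewrite <- torus_mean_minus; auto.
      2:{ apply (ccont_mult (X := TR d)); auto. apply (ccont_lsum (X := TR d)); intros; apply ccont_trig. }
      apply Rle_lt_trans with (eps / 2 / (B + 1) * B).
      - apply torus_mean_bound.
        + apply (ccont_minus (X := TR d)); auto.
          apply (ccont_mult (X := TR d)); auto. apply (ccont_lsum (X := TR d)); intros; apply ccont_trig.
        + intros x. 
          replace (lsum (fun k => c k * ei (dot k x))%C (boxl d N) * phi x - fsum c x * phi x)%C
            with (- (fsum c x - lsum (fun k => c k * ei (dot k x))%C (boxl d N)) * phi x)%C by ring.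
          rewrite Cmod_mult, Cmod_opp. specialize (HN x).
          apply Rmult_le_compat; try apply Cmod_ge_0; [lra|auto].
      - apply Rle_lt_trans with (eps / 2 / (B + 1) * (B + 1)).
        + apply Rmult_le_compat_l; lra.
        + replace (eps / 2 / (B + 1) * (B + 1)) with (eps / 2) by (field; lra).
          pose proof (cond_pos eps); lra. }
    split; apply is_lim_seq_spec; intros eps; destruct (H eps) as [N0 HN]; exists N0; intros N HNN;
      specialize (HN N HNN); (eapply Rle_lt_trans; [|exact HN]).
    + exact (Rabs_Re_le (_ - z)).
    + exact (Rabs_Im_le (_ - z)).
Qed.

Lemma fourier_coef_fsum {d} (c : Tn d Z -> C) k : csummable c -> fourier_coef (fsum c) k = c k.
Proof.
  intros Hc; rewrite fourier_coef_ei.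
  rewrite (torus_mean_fsum_mult c (fun x => ei (- dot k x)) 1); auto.
  2:{ apply ccont_ei_dot_opp. }
  2:{ intros; rewrite Cmod_ei; lra. }
  rewrite (csum_ext _ (fun j => if freq_eq_dec j k then c k else 0%C)).
  - apply csum_unique.
    + destruct Hc as [B HB]; exists B; eapply L1_le; [|apply HB].
      intros j; destruct (freq_eq_dec j k) as [->|]; [lra|rewrite Cmod_0; apply Cmod_ge_0].
    + assert (forall l : list (Tn d Z), NoDup l ->
        lsum (G := C_AbelianGroup) (fun j => if freq_eq_dec j k then c k else RtoC 0) l
        = if in_dec freq_eq_dec k l then c k else RtoC 0) as H.
      { induction 1 as [|j l Hj Hl IH]; cbn [lsum]; [reflexivity|].
        rewrite IH. unfold plus; simpl.
        destruct (freq_eq_dec j k) as [->|Hjk].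
        - destruct (in_dec freq_eq_dec k l); [contradiction|]. exact (Cplus_0_r _).
        - destruct (in_dec freq_eq_dec k l); exact (Cplus_0_l _). }
      destruct (in_boxl k) as [N0 HN0].
      assert (forall N, (N0 <= N)%nat -> box_sum (G := C_AbelianGroup) N (fun j => if freq_eq_dec j k then c k else RtoC 0) = c k) as E.
      { intros N HN; rewrite (box_sum_lsum (G := C_AbelianGroup)), H by apply NoDup_boxl.
        destruct in_dec as [_|n]; auto. exfalso; apply n; revert HN0; now apply boxl_incr. }
      split; (eapply is_lim_seq_ext_loc; [|apply is_lim_seq_const]); exists N0; intros N HN; now rewrite E.
  - intros j. rewrite (torus_mean_ext _ (fun x => ei (dot (ksub j k) x))).
    2:{ intros x; unfold ksub; now rewrite dot_kadd, dot_kopp, ei_plus. }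
    rewrite torus_mean_ei. destruct (freq_eq_dec j k) as [->|Hjk].
    + replace (ksub k k) with (kzero (d := d)).
      * destruct freq_eq_dec; [ring|congruence].
      * unfold ksub; clear; induction d as [|d IH]; simpl; auto. rewrite <- IH; f_equal; lia.
    + destruct freq_eq_dec as [E|]; [|ring]. exfalso; apply Hjk.
      assert (ksub k k = kzero) as E'.
      { unfold ksub; clear; induction d as [|d IH]; simpl; [auto|]. rewrite IH; f_equal; lia. }
      rewrite <- E' in E. eapply ksub_inj_r; eauto.
Qed.

(** * Functions with summable Fourier coefficients *)

(** The class in which functions and coefficients are interchangeable: it is stable under every
    operation of the scheme, and its members equal their Fourier series pointwise. *)
Definition nice {d} (f : Tn d R -> C) : Prop :=
  periodic f /\ ccont (X := TR d) f /\ csummable (fourier_coef f).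

Lemma fourier_coef_plus {d} (f g : Tn d R -> C) k : ccont (X := TR d) f -> ccont (X := TR d) g ->
  fourier_coef (fun x => f x + g x)%C k = (fourier_coef f k + fourier_coef g k)%C.
Proof.
  intros Hf Hg; rewrite !fourier_coef_ei, <- torus_mean_plus;
    try (apply (ccont_mult (X := TR d)); auto; apply ccont_ei_dot_opp).
  apply torus_mean_ext; intros; ring.
Qed.

Lemma fourier_coef_scal {d} c (f : Tn d R -> C) k : ccont (X := TR d) f ->
  fourier_coef (fun x => c * f x)%C k = (c * fourier_coef f k)%C.
Proof.
  intros Hf; rewrite !fourier_coef_ei, <- torus_mean_scal;
    try (apply (ccont_mult (X := TR d)); auto; apply ccont_ei_dot_opp).
  apply torus_mean_ext; intros; ring.
Qed.

Lemma fourier_coef_ext {d} (f g : Tn d R -> C) k : (forall x, f x = g x) ->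
  fourier_coef f k = fourier_coef g k.
Proof. intros E; apply torus_mean_ext; intros; now rewrite E. Qed.

Lemma fourier_coef_minus {d} (f g : Tn d R -> C) k : ccont (X := TR d) f -> ccont (X := TR d) g ->
  fourier_coef (fun x => f x - g x)%C k = (fourier_coef f k - fourier_coef g k)%C.
Proof.
  intros Hf Hg.
  rewrite (fourier_coef_ext _ (fun x => f x + (-(1)) * g x)%C) by (intros; ring).
  rewrite fourier_coef_plus, fourier_coef_scal; auto; [ring|].
  apply (ccont_mult (X := TR d)); auto; apply ccont_const.
Qed.

(** The function and its absolutely convergent series are continuous, periodic and share all
    coefficients, so [fourier_unique] applies to their difference. *)
Lemma fourier_inversion {d} (f : Tn d R -> C) x : nice f -> f x = fsum (fourier_coef f) x.
Proof.
  intros (Hp & Hc & Hs).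
  assert (f x - fsum (fourier_coef f) x = 0)%C as E.
  { apply (fourier_unique (fun x => f x - fsum (fourier_coef f) x)%C).
    - apply (ccont_minus (X := TR d)); auto; now apply ccont_fsum.
    - intros y k. now rewrite Hp, periodic_fsum.
    - intros k. rewrite fourier_coef_minus, fourier_coef_fsum; auto; [ring|now apply ccont_fsum]. }
  replace (f x) with ((f x - fsum (fourier_coef f) x) + fsum (fourier_coef f) x)%C by ring.
  rewrite E; ring.
Qed.

Lemma csummable_ext {d} (c c' : Tn d Z -> C) : (forall k, c k = c' k) -> csummable c -> csummable c'.
Proof. intros E [B H]; exists B; eapply L1_le; [|apply H]; intros k; cbv beta; rewrite E; lra. Qed.

Lemma nice_fsum {d} (c : Tn d Z -> C) : csummable c -> nice (fsum c).
Proof.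
  intros Hc; split; [apply periodic_fsum|split; [now apply ccont_fsum|]].
  eapply csummable_ext; [|apply Hc]; intros; symmetry; now apply fourier_coef_fsum.
Qed.

Lemma nice_ext {d} (f g : Tn d R -> C) : (forall x, f x = g x) -> nice f -> nice g.
Proof.
  intros E (Hp & Hc & Hs); split; [|split].
  - intros x k; rewrite <- !E; apply Hp.
  - eapply (ccont_ext (X := TR d)); eauto.
  - eapply csummable_ext; [|apply Hs]; intros; now apply fourier_coef_ext.
Qed.

Lemma nice_plus {d} (f g : Tn d R -> C) : nice f -> nice g -> nice (fun x => f x + g x)%C.
Proof.
  intros (Hp & Hc & Hs) (Hp' & Hc' & Hs'); split; [|split].
  - intros x k; now rewrite Hp, Hp'.
  - now apply (ccont_plus (X := TR d)).
  - eapply csummable_ext; [|apply (csummable_plus _ _ Hs Hs')].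
    intros; symmetry; now apply fourier_coef_plus.
Qed.

Lemma nice_scal {d} c (f : Tn d R -> C) : nice f -> nice (fun x => c * f x)%C.
Proof.
  intros (Hp & Hc & Hs); split; [|split].
  - intros x k; now rewrite Hp.
  - apply (ccont_mult (X := TR d)); auto; apply ccont_const.
  - eapply csummable_ext; [|apply (csummable_scal _ c Hs)].
    intros; symmetry; now apply fourier_coef_scal.
Qed.

Lemma nice_minus {d} (f g : Tn d R -> C) : nice f -> nice g -> nice (fun x => f x - g x)%C.
Proof.
  intros Hf Hg; apply (nice_ext (fun x => f x + (-(1)) * g x)%C); [intros; ring|].
  now apply nice_plus, nice_scal.
Qed.

Lemma fourier_coef_conj {d} (f : Tn d R -> C) k : ccont (X := TR d) f ->
  fourier_coef (fun x => Cconj (f x)) k = cj (fourier_coef f) k.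
Proof.
  intros Hf; unfold cj; rewrite !fourier_coef_ei, <- torus_mean_conj.
  - apply torus_mean_ext; intros x. rewrite Cmult_conj, ei_conj, dot_kopp, Ropp_involutive; auto.
  - apply (ccont_mult (X := TR d)); auto; apply ccont_ei_dot_opp.
Qed.

Lemma nice_conj {d} (f : Tn d R -> C) : nice f -> nice (fun x => Cconj (f x)).
Proof.
  intros (Hp & Hc & Hs); split; [|split].
  - intros x k; now rewrite Hp.
  - now apply (ccont_conj (X := TR d)).
  - eapply csummable_ext; [|apply (csummable_cj _ _ Hs)].
    intros; symmetry; now apply fourier_coef_conj.
Qed.

(** Only [f] is expanded; [g] times a character stays a bounded test function in
    [torus_mean_fsum_mult]. Multiplying by the character of frequency j then shifts the coefficient
    of [g] to k - j. *)
Lemma fourier_coef_mult {d} (f g : Tn d R -> C) k : nice f -> nice g ->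
  fourier_coef (fun x => f x * g x)%C k = conv (fourier_coef f) (fourier_coef g) k.
Proof.
  intros Hf Hg. pose proof (Hg) as (_ & Cg & [B HB]). pose proof (Hf) as (_ & _ & Sf).
  rewrite fourier_coef_ei.
  rewrite (torus_mean_ext _ (fun x => fsum (fourier_coef f) x * (g x * ei (- dot k x)))%C).
  2:{ intros x; rewrite <- fourier_inversion by auto; ring. }
  rewrite (torus_mean_fsum_mult _ _ B); auto.
  - apply csum_ext; intros j; f_equal. rewrite fourier_coef_ei.
    apply torus_mean_ext; intros x.
    replace (- dot (ksub k j) x) with (dot j x + - dot k x)
      by (unfold ksub; rewrite dot_kadd, dot_kopp; ring).
    rewrite ei_plus; ring.
  - apply (ccont_mult (X := TR d)); auto; apply ccont_ei_dot_opp.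
  - intros x; rewrite Cmod_mult, Cmod_ei, Rmult_1_r, (fourier_inversion g x Hg).
    now apply fsum_bound.
Qed.

Lemma nice_mult {d} (f g : Tn d R -> C) : nice f -> nice g -> nice (fun x => f x * g x)%C.
Proof.
  intros Hf Hg; pose proof (Hf) as (Hp & Hc & Hs); pose proof (Hg) as (Hp' & Hc' & Hs').
  split; [|split].
  - intros x k; now rewrite Hp, Hp'.
  - now apply (ccont_mult (X := TR d)).
  - eapply csummable_ext; [|apply (csummable_conv _ _ _ Hs Hs')].
    intros; symmetry; now apply fourier_coef_mult.
Qed.

Lemma csummable_mult {d} (m c : Tn d Z -> C) B : (forall k, Cmod (m k) <= B) -> csummable c ->
  csummable (fun k => m k * c k)%C.
Proof.
  intros Hm [A HA].
  assert (0 <= B) as HB by (eapply Rle_trans; [apply Cmod_ge_0|apply (Hm kzero)]).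
  exists (B * A); eapply L1_le; [|apply (L1_scal _ _ _ HB HA)].
  intros k; rewrite Cmod_mult; apply Rmult_le_compat_r; [apply Cmod_ge_0|auto].
Qed.

Lemma lap_mult_fsum {d} (f : R -> C) (v : Tn d R -> C) x :
  lap_mult f v x = fsum (fun k => f (- sqnorm k)%R * fourier_coef v k)%C x.
Proof.
  unfold lap_mult, fsum, csum, rsum.
  f_equal; f_equal; apply Lim_seq_ext; intros N;
    rewrite !box_sum_lsum, ?Re_lsum, ?Im_lsum;
    apply lsum_Rext; intros k; now rewrite cexp_Ci.
Qed.

Lemma nice_lap_mult {d} (f : R -> C) (v : Tn d R -> C) B : (forall l, Cmod (f l) <= B) ->
  nice v -> nice (lap_mult f v).
Proof.
  intros HB (_ & _ & Hs).
  eapply nice_ext; [intros x; symmetry; apply lap_mult_fsum|].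
  eapply nice_fsum, csummable_mult; eauto.
Qed.

Lemma fourier_coef_lap_mult {d} (f : R -> C) (v : Tn d R -> C) B k : (forall l, Cmod (f l) <= B) ->
  nice v -> fourier_coef (lap_mult f v) k = (f (- sqnorm k)%R * fourier_coef v k)%C.
Proof.
  intros HB (_ & _ & Hs).
  rewrite (fourier_coef_ext _ _ k (fun x => lap_mult_fsum f v x)).
  apply (fourier_coef_fsum (fun k => f (- sqnorm k)%R * fourier_coef v k)%C).
  eapply csummable_mult; eauto.
Qed.

(** * Sobolev norms in terms of Fourier coefficients *)

Lemma sobolev_term {d} s (u : Tn d R -> C) (k : Tn d Z) :
  Rpower (1 + sqnorm k) s * Cmod (fourier_coef u k) ^ 2
  = (wt s k * Cmod (fourier_coef u k)) ^ 2.
Proof. now rewrite Rpow_mult_distr, wt_sqr. Qed.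

Lemma HB_sobolev_le {d} s (u : Tn d R -> C) B :
  HB s (fourier_coef u) B -> Rbar_le (sobolev_norm s u) B.
Proof.
  intros [HB0 H].
  assert (forall k, 0 <= Rpower (1 + sqnorm k) s * Cmod (fourier_coef u k) ^ 2) as Hp
    by (intros; rewrite sobolev_term; apply pow2_ge_0).
  assert (L1 (fun k => Rpower (1 + sqnorm k) s * Cmod (fourier_coef u k) ^ 2) (B ^ 2)) as H'
    by (eapply L1_le; [|apply H]; intros; rewrite sobolev_term; apply Rle_refl).
  unfold sobolev_norm, sobolev_sqnorm.
  rewrite (is_lim_seq_unique _ _ (rsum_lim_nonneg _ _ Hp H')). simpl.
  rewrite <- (sqrt_pow2 B HB0). apply sqrt_le_1_alt. now apply rsum_le.
Qed.

(** The cube sums increase, so their limit exists in the extended reals; the bound excludes infinity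
    and then dominates every partial sum. *)
Lemma sobolev_le_HB {d} s (u : Tn d R -> C) (B : R) :
  Rbar_le (sobolev_norm s u) B -> HB s (fourier_coef u) B.
Proof.
  unfold sobolev_norm, sobolev_sqnorm; intros H.
  set (f := fun k => Rpower (1 + sqnorm k) s * Cmod (fourier_coef u k) ^ 2) in H.
  assert (forall k, 0 <= f k) as Hp
    by (intros; unfold f; rewrite sobolev_term; apply pow2_ge_0).
  assert (forall n, box_sum n f <= box_sum (S n) f) as Hi
    by (intros n; apply box_sum_incr; auto).
  assert (is_lim_seq (fun N => box_sum N f) (Lim_seq (fun N => box_sum N f))) as L
    by (apply Lim_seq_correct, ex_lim_seq_incr, Hi).
  destruct (Lim_seq (fun N => box_sum N f)) as [r| |]; simpl in H; try contradiction.
  pose proof (is_lim_seq_incr_compare _ _ L Hi) as Hr.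
  assert (0 <= B) as HB0 by (eapply Rle_trans; [apply sqrt_pos|exact H]).
  assert (r <= B ^ 2) as HrB.
  { assert (0 <= r) as Hr0.
    { eapply Rle_trans; [|apply (Hr O)]. rewrite box_sum_lsum; now apply lsum_nonneg. }
    rewrite <- (pow2_sqrt r Hr0). apply pow_incr; split; [apply sqrt_pos|exact H]. }
  split; auto; intros l Hl; destruct (incl_boxl l) as [N HN].
  apply Rle_trans with (box_sum N f); [|specialize (Hr N); simpl in Hr; lra].
  rewrite box_sum_lsum. eapply Rle_trans; [|apply (lsum_incl f l); auto].
  apply lsum_le; intros k; unfold f; rewrite sobolev_term; apply Rle_refl.
Qed.

Lemma sobolev_norm_finite_HB {d} s (u : Tn d R -> C) :
  is_finite (sobolev_norm s u) -> HB s (fourier_coef u) (real (sobolev_norm s u)).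
Proof. intros H; apply sobolev_le_HB; rewrite H; apply Rbar_le_refl. Qed.

Lemma in_H_nice {d} alpha Zc (u : Tn d R -> C) : 0 <= Zc ->
  L1 (fun k : Tn d Z => Rpower (1 + sqnorm k) (- alpha)) (Zc ^ 2) ->
  in_H alpha u -> nice u.
Proof.
  intros HZ Hs (Hp & Hc & Hf); split; [exact Hp|split].
  - now apply (ccont_continuous (X := TR d)).
  - eapply (HB_csummable d alpha Zc); eauto; [apply Rle_refl|now apply sobolev_norm_finite_HB].
Qed.

Lemma sup_sobolev_HB {d} s T M (u : R -> Tn d R -> C) t : 0 <= t <= T ->
  sup_sobolev_norm s T u = Finite M -> HB s (fourier_coef (u t)) M.
Proof.
  intros Ht H; apply sobolev_le_HB; rewrite <- H; unfold sup_sobolev_norm, Rbar_lub.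
  destruct (Rbar_ex_lub _) as [l Hl]; simpl. apply (proj1 Hl); now exists t.
Qed.

(** * The solution *)

Lemma fourier_coef_cubic {d} (u : Tn d R -> C) k : nice u ->
  fourier_coef (fun x => (Cmod (u x) ^ 2)%R * u x)%C k = cubic d (fourier_coef u) k.
Proof.
  intros Hu. pose proof (nice_conj _ Hu) as Hu'.
  rewrite (fourier_coef_ext _ (fun x => u x * u x * Cconj (u x))%C).
  - rewrite (fourier_coef_mult (fun x => u x * u x)%C) by auto using nice_mult.
    apply conv_ext; intros j.
    + now apply fourier_coef_mult.
    + apply fourier_coef_conj, Hu.
  - intros x. rewrite Cmod_sqr. apply injective_projections; simpl; unfold Re, Im; ring.
Qed.

Section Solution.

Variables (d : nat) (alpha mu T Zc : R) (u0 : Tn d R -> C) (Tmax : Rbar) (u : R -> Tn d R -> C).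
Hypothesis Halpha : 0 <= alpha.
Hypothesis HZ : 0 <= Zc.
Hypothesis Hsum : L1 (fun k : Tn d Z => Rpower (1 + sqnorm k) (- alpha)) (Zc ^ 2).
Hypothesis Hsol : NLS_solution alpha mu u0 Tmax u.
Hypothesis HT : Rbar_lt T Tmax.

Lemma before_Tmax t : t <= T -> Rbar_lt t Tmax.
Proof. intros Ht; eapply Rbar_le_lt_trans; [|exact HT]; exact Ht. Qed.

Lemma solution_nice t : 0 <= t <= T -> nice (u t).
Proof.
  intros Ht; destruct Hsol as (_ & _ & H & _).
  eapply in_H_nice; eauto. apply H; [lra|apply before_Tmax; lra].
Qed.

Lemma solution_rcont k : rcont (fun t => fourier_coef (u t) k) 0 T.
Proof.
  intros t Ht eps Heps; destruct Hsol as (_ & _ & _ & H & _).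
  assert (0 < eps / 2) as He by lra.
  destruct (H t ltac:(lra) (before_Tmax t ltac:(lra)) (mkposreal _ He)) as [dl Hd].
  exists dl; split; [apply cond_pos|]; intros s Hs Hst.
  specialize (Hd s ltac:(lra) (before_Tmax s ltac:(lra)) Hst).
  apply Rbar_lt_le, sobolev_le_HB, (HB_single _ _ _ k Halpha) in Hd. simpl in Hd.
  rewrite fourier_coef_minus in Hd by (apply solution_nice; lra). lra.
Qed.

Lemma solution_cderive k t : 0 < t < T ->
  cderive (fun s => fourier_coef (u s) k) t
    (- Ci * (sqnorm k * fourier_coef (u t) k + mu * cubic d (fourier_coef (u t)) k))%C.
Proof.
  intros Ht; destruct Hsol as (_ & _ & _ & _ & H).
  destruct (H t ltac:(lra) (before_Tmax t ltac:(lra)) k) as (w & Hw & E).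
  apply cderive_is_derive in Hw. eapply cderive_val; [|exact Hw].
  rewrite fourier_coef_cubic in E by (apply solution_nice; lra).
  replace (sqnorm k * fourier_coef (u t) k + mu * cubic d (fourier_coef (u t)) k)%C with (Ci * w)%C.
  - apply injective_projections; simpl; ring.
  - rewrite E; unfold lap_symbol. rewrite RtoC_opp; ring.
Qed.

End Solution.

(** * The numerical scheme *)

Lemma Cmod_exp_i_lap (a l : R) : Cmod (cexp (Ci * (a * l)%R)) <= 1.
Proof. rewrite cexp_Ci, Cmod_ei; lra. Qed.

Lemma nice_exp_i_lap {d} a (v : Tn d R -> C) : nice v -> nice (exp_i_lap a v).
Proof. apply nice_lap_mult with 1; intros; apply Cmod_exp_i_lap. Qed.

Lemma fourier_coef_exp_i_lap {d} a (v : Tn d R -> C) k : nice v ->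
  fourier_coef (exp_i_lap a v) k = sg a (fourier_coef v) k.
Proof.
  intros Hv; unfold exp_i_lap; rewrite (fourier_coef_lap_mult _ _ 1); auto.
  - unfold sg. rewrite cexp_Ci. do 2 f_equal; ring.
  - intros; apply Cmod_exp_i_lap.
Qed.

(** tau phi_1 is the integral [gmul] of unit complex numbers over an interval of length tau. *)
Lemma Cmod_phi_1_le tau l : 0 < tau -> Cmod (phi_1 (- (2) * Ci * (tau * l)%R)) <= 1.
Proof.
  intros Ht. pose proof (gmul_phi_1 (- l) tau) as E. rewrite Ropp_involutive in E.
  pose proof (Cmod_gmul_le (- l) tau) as H. rewrite E, Cmod_mult, Cmod_R in H.
  rewrite Rabs_pos_eq in H by lra. nra.
Qed.

Lemma Cmod_gmul_sym_le tau q : 0 < tau -> Cmod (gmul q tau - gmul q (- tau)) <= 2 * tau.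
Proof.
  intros Ht. unfold Cminus; eapply Rle_trans; [apply Cmod_triangle|]. rewrite Cmod_opp.
  pose proof (Cmod_gmul_le q tau) as H1; pose proof (Cmod_gmul_le q (- tau)) as H2.
  rewrite Rabs_Ropp in H2. rewrite Rabs_pos_eq in H1, H2 by lra. lra.
Qed.

Lemma Cmod_phi_s_le tau l : 0 < tau -> Cmod (RtoC (phi_s (2 * tau * l))) <= 1.
Proof.
  intros Ht. pose proof (gmul_phi_s (- l) tau) as E. rewrite Ropp_involutive in E.
  pose proof (Cmod_gmul_sym_le tau (- l) Ht) as H. rewrite E, !Cmod_mult, !(Cmod_R _) in H.
  rewrite !(Rabs_pos_eq) in H by lra. rewrite Cmod_R. nra.
Qed.

Section Scheme.

Variables (d : nat) (mu tau : R).
Hypothesis Htau : 0 < tau.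

Lemma nice_sLRI1_start (v : Tn d R -> C) : nice v -> nice (sLRI1_start mu tau v).
Proof.
  intros Hv; apply nice_minus; [now apply nice_exp_i_lap|].
  apply nice_scal, nice_exp_i_lap, nice_mult; [now apply nice_mult|].
  apply nice_lap_mult with 1; [intros; now apply Cmod_phi_1_le|now apply nice_conj].
Qed.

Lemma nice_sLRI1_step (v w : Tn d R -> C) : nice v -> nice w -> nice (sLRI1_step mu tau v w).
Proof.
  intros Hv Hw; apply nice_minus; [now apply nice_exp_i_lap|].
  apply nice_scal, nice_exp_i_lap, nice_mult; [now apply nice_mult|].
  apply nice_lap_mult with 1; [intros; now apply Cmod_phi_s_le|now apply nice_conj].
Qed.

Lemma nice_sLRI1 (u0 : Tn d R -> C) n : nice u0 -> nice (sLRI1 mu tau u0 n).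
Proof.
  intros H0.
  enough (nice (sLRI1 mu tau u0 n) /\ nice (sLRI1 mu tau u0 (S n))) by tauto.
  induction n as [|n [IH1 IH2]]; split; auto.
  - now apply nice_sLRI1_start.
  - now apply nice_sLRI1_step.
Qed.

Lemma fourier_coef_nonlinear (v : Tn d R -> C) (m : R -> C) k : nice v ->
  (forall l, Cmod (m l) <= 1) ->
  let L := lap_mult m (fun z => Cconj (v z)) in
  nice (fun y => v y * v y * L y)%C /\
  fourier_coef (fun y => v y * v y * L y)%C k
  = tri d (fourier_coef v) (fourier_coef v)
      (fun j => m (- sqnorm j)%R * cj (fourier_coef v) j)%C k.
Proof.
  intros Hv Hm L. pose proof (nice_conj _ Hv) as Hv'. pose proof (nice_mult _ _ Hv Hv) as Hvv.
  assert (nice L) as HL by (now apply nice_lap_mult with 1).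
  split; [now apply nice_mult|].
  rewrite (fourier_coef_mult (fun y => v y * v y)%C L) by auto.
  apply conv_ext; intros j.
  - now apply fourier_coef_mult.
  - unfold L; rewrite (fourier_coef_lap_mult _ _ 1) by auto.
    f_equal. apply fourier_coef_conj, Hv.
Qed.

Lemma fourier_coef_exp_i_lap_minus (v w : Tn d R -> C) a b c k : nice v -> nice w ->
  fourier_coef (fun x => exp_i_lap a v x - c * exp_i_lap b w x)%C k
  = (sg a (fourier_coef v) k - c * sg b (fourier_coef w) k)%C.
Proof.
  intros Hv Hw.
  pose proof (nice_exp_i_lap a v Hv) as (_ & C1 & _).
  pose proof (nice_exp_i_lap b w Hw) as (_ & C2 & _).
  rewrite fourier_coef_minus, fourier_coef_scal, !fourier_coef_exp_i_lap; auto.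
  apply (ccont_mult (X := TR d)); auto; apply ccont_const.
Qed.

Lemma fourier_coef_start (v : Tn d R -> C) k : nice v ->
  let x := fourier_coef v in
  fourier_coef (sLRI1_start mu tau v) k
  = (sg tau x k - Ci * mu * sg tau (tri d x x (gm d tau (cj x))) k)%C.
Proof.
  intros Hv x. pose proof (proj2 (proj2 Hv)) as Sx. fold x in Sx.
  pose proof (csummable_cj d _ Sx) as Sx'.
  pose proof (fun l => Cmod_phi_1_le tau l Htau) as Hm.
  destruct (fourier_coef_nonlinear v (fun l => phi_1 (- (2) * Ci * (tau * l)%R)) k Hv Hm) as [N1 N2].
  unfold sLRI1_start; rewrite fourier_coef_exp_i_lap_minus by auto.
  fold x. unfold sg at 2 4. rewrite N2; fold x.
  replace (tri d x x (gm d tau (cj x)) k) with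
    (tau * tri d x x (fun j => phi_1 (- (2) * Ci * (tau * - sqnorm j)%R) * cj x j)%C k)%C; [ring|].
  rewrite <- tri_scal_3 by (auto; apply csummable_mult with 1; auto).
  apply tri_ext; auto; intros j; unfold gm; rewrite gmul_phi_1; ring.
Qed.

Lemma fourier_coef_step (v w : Tn d R -> C) k : nice v -> nice w ->
  let x := fourier_coef w in
  fourier_coef (sLRI1_step mu tau v w) k
  = (sg (2 * tau) (fourier_coef v) k - Ci * mu * sg tau
      (tri d x x (fun j => (gmul (sqnorm j) tau - gmul (sqnorm j) (- tau)) * cj x j)%C) k)%C.
Proof.
  intros Hv Hw x. pose proof (proj2 (proj2 Hw)) as Sx. fold x in Sx.
  pose proof (csummable_cj d _ Sx) as Sx'.
  pose proof (fun l => Cmod_phi_s_le tau l Htau) as Hm.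
  destruct (fourier_coef_nonlinear w (fun l => RtoC (phi_s (2 * tau * l))) k Hw Hm) as [N1 N2].
  unfold sLRI1_step; rewrite fourier_coef_exp_i_lap_minus by auto.
  fold x. unfold sg at 2 4. rewrite N2; fold x.
  replace (tri d x x (fun j => (gmul (sqnorm j) tau - gmul (sqnorm j) (- tau)) * cj x j)%C k) with
    (2 * tau * tri d x x (fun j => RtoC (phi_s (2 * tau * - sqnorm j)) * cj x j)%C k)%C; [ring|].
  rewrite <- tri_scal_3 by (auto; apply csummable_mult with 1; auto).
  apply tri_ext; auto; intros j; rewrite gmul_phi_s; ring.
Qed.

End Scheme.

(** * Stability and the global error *)

Section Stability.

Variables (d : nat) (alpha mu tau Zc : R).
Hypothesis Halpha : 0 <= alpha.
Hypothesis HZ : 0 <= Zc.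
Hypothesis Hsum : L1 (fun k : Tn d Z => Rpower (1 + sqnorm k) (- alpha)) (Zc ^ 2).
Hypothesis Htau : 0 < tau.

Definition gs (x : Tn d Z -> C) (j : Tn d Z) : C :=
  ((gmul (sqnorm j) tau - gmul (sqnorm j) (- tau)) * x j)%C.

Lemma HB_gs x B : HB alpha x B -> HB alpha (gs x) (2 * tau * B).
Proof. apply HB_mult; [lra|intros; now apply Cmod_gmul_sym_le]. Qed.

(** E <= 1 places [y] in the ball of radius M + 1, where the cubic map is Lipschitz. The 6 is three
    slots times the factor 2 tau of the filter. *)
Lemma scheme_lipschitz (x y : Tn d Z -> C) M E : 0 <= M -> E <= 1 -> HB alpha x M ->
  HB alpha (fun k => x k - y k)%C E ->
  HB alpha (fun k => tri d x x (gs (cj x)) k - tri d y y (gs (cj y)) k)%C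
    (tau * (6 * tri_cst alpha Zc * (M + 1) ^ 2) * E).
Proof.
  intros HM HE Hx Hxy.
  pose proof (HB_nonneg _ _ _ Hxy) as HE0.
  assert (HB alpha y (M + E)) as Hy.
  { eapply HB_ext; [|apply (HB_minus _ _ _ _ _ Hx Hxy)]; intros; cbv beta; ring. }
  assert (HB alpha y (M + 1)) as Hy1 by (eapply HB_weaken; [|apply Hy]; lra).
  assert (HB alpha x (M + 1)) as Hx1 by (eapply HB_weaken; [|apply Hx]; lra).
  assert (HB alpha (fun k => gs (cj x) k - gs (cj y) k)%C (2 * tau * E)) as Hg.
  { eapply HB_ext; [|apply HB_gs, HB_cj, Hxy].
    intros k; unfold gs, cj. rewrite Cminus_conj; ring. }
  pose proof (HB_tri_minus d alpha Zc Halpha HZ Hsum alpha x y x y (gs (cj x)) (gs (cj y))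
    _ _ _ _ _ _ _ (Rle_refl _) Hxy Hxy Hg Hy1 Hx1 Hy1 (HB_gs _ _ (HB_cj _ _ _ Hx1))) as H.
  eapply HB_weaken; [|exact H]. unfold tri_cst; right; ring.
Qed.

End Stability.

(** [c] and [lam] are chosen before the trajectory, so they serve all solutions with the same bound
    [M]. The smallness condition on [tau] keeps the predicted error below 1 up to time [T], as
    [scheme_lipschitz] requires. *)
Lemma sobolev_error_bound {d} (alpha g mu T M Zc : R) :
  0 <= alpha -> 0 <= g <= 1 -> 0 <= Zc -> 0 <= M ->
  L1 (fun k : Tn d Z => Rpower (1 + sqnorm k) (- alpha)) (Zc ^ 2) ->
  exists c lam, 0 < c /\ 0 < lam /\
  forall (a : R -> Tn d Z -> C) (b : nat -> Tn d Z -> C) (tau : R),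
  (forall k, rcont (fun t => a t k) 0 T) ->
  (forall k t, 0 < t < T ->
    cderive (fun s => a s k) t (- Ci * (sqnorm k * a t k + mu * cubic d (a t) k))%C) ->
  (forall t, 0 <= t <= T -> HB (alpha + 1 + 2 * g) (a t) M) ->
  0 < tau <= 1 ->
  c * exp (lam * T) * Rpower tau (1 + g) <= 1 ->
  (forall k, b 0%nat k = a 0 k) ->
  (forall k, b 1%nat k = (sg tau (b 0%nat) k
     - Ci * mu * sg tau (tri d (b 0%nat) (b 0%nat) (gm d tau (cj (b 0%nat)))) k)%C) ->
  (forall n k, b (S (S n)) k = (sg (2 * tau) (b n) k
     - Ci * mu * sg tau (tri d (b (S n)) (b (S n)) (gs d tau (cj (b (S n))))) k)%C) ->
  forall n, INR n * tau <= T ->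
    HB alpha (fun k => a (INR n * tau)%R k - b n k)%C
      (c * exp (lam * (INR n * tau)) * Rpower tau (1 + g)).
Proof.
  intros Ha Hg HZ HM Hsum.
  set (C6 := Rabs mu * even_defect_cst alpha g mu Zc M). set (C7 := Rabs mu * defect_cst alpha g mu Zc M).
  destruct (defect_cst_nonneg alpha g mu Zc M HM) as [P6 P7].
  assert (0 <= C6) as Q6 by (apply Rmult_le_pos; auto; apply Rabs_pos).
  assert (0 <= C7) as Q7 by (apply Rmult_le_pos; auto; apply Rabs_pos).
  set (kp := Rabs mu * (6 * tri_cst alpha Zc * (M + 1) ^ 2)).
  assert (0 <= kp) as Hkp.
  { pose proof (tri_cst_nonneg alpha Zc). unfold kp. apply Rmult_le_pos; [apply Rabs_pos|].
    apply Rmult_le_pos; [lra|apply pow2_ge_0]. }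
  (* [c] dominates the constants of both local errors. In the rate, [kp] is the Lipschitz constant
     of the nonlinear part and the additional 1 absorbs the local error of each step. *)
  exists (C6 + C7 + 1), (kp + 1). split; [lra|]. split; [lra|].
  set (c := C6 + C7 + 1). set (lam := kp + 1).
  intros a b tau Hc Hd Hb Htau Hsmall E0 E1 E2.
  set (P := Rpower tau (1 + g)) in *.
  assert (0 < P) as HP by apply Rpower_pos.
  assert (P = tau * Rpower tau g) as EP.
  { unfold P; rewrite Rpower_plus, Rpower_1; lra. }
  (* The Gronwall majorant: it never falls below c P, and it grows by at least the factor 1 + lam
     tau per step. *)
  set (bd := fun n => c * exp (lam * (INR n * tau)) * P).
  assert (forall n, c * P <= bd n) as Hbd0.
  { intros n; unfold bd. apply Rmult_le_compat_r; [lra|].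
    assert (1 <= exp (lam * (INR n * tau))).
    { rewrite <- exp_0. assert (0 <= lam * (INR n * tau)) as [K|K].
      - apply Rmult_le_pos; [unfold lam; lra|]. apply Rmult_le_pos; [apply pos_INR|lra].
      - left; now apply exp_increasing.
      - rewrite <- K; lra. }
    unfold c in *; nra. }
  assert (forall n, bd n * (1 + lam * tau) <= bd (S n)) as HbdS.
  { intros n; unfold bd. rewrite S_INR.
    replace (lam * ((INR n + 1) * tau)) with (lam * (INR n * tau) + lam * tau) by ring.
    rewrite exp_plus. pose proof (exp_ineq1_le (lam * tau)) as K.
    pose proof (exp_pos (lam * (INR n * tau))) as K2.
    assert (0 <= c * exp (lam * (INR n * tau)) * P) as K3.
    { apply Rmult_le_pos; [apply Rmult_le_pos|]; unfold c; lra. }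
    replace (c * (exp (lam * (INR n * tau)) * exp (lam * tau)) * P)
      with (c * exp (lam * (INR n * tau)) * P * exp (lam * tau)) by ring.
    apply Rmult_le_compat_l; auto. }
  assert (forall n, INR n * tau <= T -> bd n <= 1) as Hbd1.
  { intros n Hn; eapply Rle_trans; [|exact Hsmall]. unfold bd.
    apply Rmult_le_compat_r; [lra|]. apply Rmult_le_compat_l; [unfold c; lra|].
    assert (lam * (INR n * tau) <= lam * T) as [K|K]
      by (apply Rmult_le_compat_l; [unfold lam; lra|auto]).
    - left; now apply exp_increasing.
    - rewrite K; lra. }
  set (err := fun n => HB alpha (fun k => a (INR n * tau)%R k - b n k)%C (bd n)).
  assert (forall n, (INR n * tau <= T -> err n) /\ (INR (S n) * tau <= T -> err (S n))) as Hind.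
  2:{ intros n Hn; exact (proj1 (Hind n) Hn). }
  induction n as [|n [IH1 IH2]].
  - split; intros Hn.
    + unfold err. apply HB_ext with (fun k => 0 * a 0 k)%C.
      { intros k; simpl INR; rewrite Rmult_0_l, E0; ring. }
      eapply HB_weaken; [|apply (HB_scal alpha 0 (a 0) M)].
      * rewrite Cmod_0, Rmult_0_l. eapply Rle_trans; [|apply (Hbd0 O)].
        apply Rmult_le_pos; unfold c; lra.
      * eapply HB_lower; [|apply Hb]; [lra|]. simpl in Hn; lra.
    + simpl INR in Hn. rewrite Rmult_1_l in Hn.
      assert (adm T 0 1 tau) as Ad by (unfold adm; repeat split; auto; lra).
      pose proof (local_error_start d alpha g mu Zc M Ha Hg HZ Hsum HM T a Hc Hd Hb 0
        ltac:(lra) tau Ad) as H.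
      unfold err; eapply HB_le; [exact H|lra| |].
      * fold C7. eapply Rle_trans; [|apply (Hbd0 1%nat)].
        (* The starting error tau^2 is at most tau^(1+g), and it enters only once. *)
        pose proof (Rpower_ge_id tau g Htau (proj2 Hg)) as K.
        rewrite EP. unfold c.
        assert (tau * tau <= tau * Rpower tau g) by (apply Rmult_le_compat_l; lra).
        assert (0 <= tau * tau) by nra. nra.
      * intros k; simpl INR. rewrite Rmult_1_l, Rplus_0_l, E1.
        unfold sg. rewrite E0.
        rewrite (tri_ext d (b 0%nat) (a 0) (b 0%nat) (a 0) (gm d tau (cj (b 0%nat))) (gm d tau (cj (a 0))));
          auto. intros j; unfold gm, cj; now rewrite E0.
  - split; auto. intros Hn.
    assert (0 <= INR n * tau) as N0 by (apply Rmult_le_pos; [apply pos_INR|lra]).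
    rewrite !S_INR in Hn.
    assert (err n) as H1 by (apply IH1; lra).
    assert (INR (S n) * tau <= T) as HSn by (rewrite S_INR; lra).
    assert (err (S n)) as H2 by (now apply IH2).
    unfold err in H1, H2 |- *.
    set (t := INR (S n) * tau) in *.
    assert (0 <= t - tau) as Ht1 by (unfold t; rewrite S_INR; lra).
    assert (t + tau <= T) as Ht2 by (unfold t; rewrite S_INR; lra).
    assert (adm T t 1 tau) as A1 by (unfold adm; repeat split; auto; lra).
    assert (adm T t (-1) tau) as A2 by (unfold adm; repeat split; auto; lra).
    pose proof (local_error_step d alpha g mu Zc M Ha Hg HZ Hsum HM T a Hc Hd Hb t
      ltac:(lra) tau A1 A2) as HL. fold C6 in HL.
    assert (HB alpha (a t) M) as Hat by (eapply HB_lower; [|apply Hb]; lra).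
    pose proof (scheme_lipschitz d alpha tau Zc Ha HZ Hsum (proj1 Htau) (a t) (b (S n)) M (bd (S n))
      HM (Hbd1 _ HSn) Hat H2) as HS.
    pose proof (HB_scal alpha (- Ci * mu) _ _ (HB_sg tau _ _ _ HS)) as HS'.
    pose proof (HB_sg (2 * tau) _ _ _ H1) as H1'.
    eapply HB_le; [apply (HB_plus _ _ _ _ _ (HB_plus _ _ _ _ _ HL H1') HS')|lra| |].
    + rewrite Cmod_Ci_mult.
      (* The isometric part carries the error of level n, not n + 1, so monotonicity of [bd] is used
         first. Then bd(n+1) + kp tau bd(n+1) + tau bd(n+1) = bd(n+1) (1 + lam tau) <= bd(n+2). *)
      pose proof (HbdS n) as B1. pose proof (HbdS (S n)) as B2. pose proof (Hbd0 (S n)) as B3.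
      pose proof (Hbd0 n) as B4.
      assert (0 < c * P) as HcP by (apply Rmult_lt_0_compat; unfold c; lra).
      assert (bd n <= bd (S n)) as B5.
      { eapply Rle_trans; [|apply B1]. assert (0 <= bd n * (lam * tau)); [|lra].
        apply Rmult_le_pos; [lra|apply Rmult_le_pos; unfold lam; lra]. }
      assert (Rabs mu * (tau * (6 * tri_cst alpha Zc * (M + 1) ^ 2) * bd (S n)) = kp * tau * bd (S n)) as ->
        by (unfold kp; ring).
      rewrite <- EP.
      assert (C6 * (tau * P) <= tau * bd (S n)) as B6.
      { replace (C6 * (tau * P)) with (tau * (C6 * P)) by ring.
        apply Rmult_le_compat_l; [lra|]. eapply Rle_trans; [|apply B3].
        apply Rmult_le_compat_r; unfold c; lra. }
      replace (bd (S n) * (1 + lam * tau)) with (bd (S n) + kp * tau * bd (S n) + tau * bd (S n)) in B2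
        by (unfold lam; ring).
      lra.
    + intros k. replace (INR (S (S n)) * tau) with (t + tau) by (unfold t; rewrite (S_INR (S n)); ring).
      rewrite E2. replace (INR n * tau) with (t - tau) by (unfold t; rewrite S_INR; ring).
      unfold sg, gs; ring.
Qed.

Theorem corollary3p7 (d : nat) (alpha gamma mu T M : R)
    (hd : (d = 1 \/ d = 2 \/ d = 3)%nat)
    (halpha : INR d / 2 < alpha)
    (hgamma : 0 <= gamma <= 1)
    (hmu : mu <> 0)
    (hT : 0 < T) :
  exists tau0 K : R, 0 < tau0 /\ 0 < K /\
    forall (u0 : Tn d R -> C) (u : R -> Tn d R -> C) (Tmax : Rbar),
      NLS_maximal_solution alpha mu u0 Tmax u ->
      Rbar_lt T Tmax ->
      sup_sobolev_norm (alpha + 1 + 2 * gamma) T u = Finite M ->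
      forall tau : R, 0 < tau <= tau0 ->
      forall n : nat, INR n <= T / tau ->
        Rbar_le
          (sobolev_norm alpha
             (fun x => (u (INR n * tau)%R x - sLRI1 mu tau u0 n x)%C))
          (K * Rpower tau (1 + gamma)).
Proof.
  assert (0 <= alpha) as Ha by (pose proof (pos_INR d); lra).
  destruct (wt_neg_summable d alpha halpha) as (Z2 & HZ2 & Hsum).
  pose proof (sqrt_pos Z2) as HZ.
  rewrite <- (pow2_sqrt Z2) in Hsum by lra. set (Zc := sqrt Z2) in *.
  (* The constants are fixed before any solution is given, when the sign of [M] is still unknown;
     |M| is nonnegative and also bounds the norms. *)
  destruct (sobolev_error_bound alpha gamma mu T (Rabs M) Zc Ha hgamma HZ (Rabs_pos M) Hsum)
    as (c & lam & Hc & Hlam & Hmain).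
  set (K := c * exp (lam * T)).
  assert (0 < K) as HK by (apply Rmult_lt_0_compat; [auto|apply exp_pos]).
  (* For tau <= 1 one has tau^(1+gamma) <= tau, so tau <= 1/K ensures K tau^(1+gamma) <= 1, the
     smallness condition of [sobolev_error_bound]. *)
  exists (Rmin 1 (/ K)), K. split; [apply Rmin_pos; [lra|now apply Rinv_0_lt_compat]|].
  split; [exact HK|].
  intros u0 u Tmax [Hsol _] HT HM tau [Ht0 Ht1] n Hn.
  pose proof (Rmin_l 1 (/ K)) as Hm1; pose proof (Rmin_r 1 (/ K)) as Hm2.
  assert (tau <= 1) as Ht1' by lra.
  assert (INR n * tau <= T) as HnT.
  { apply Rmult_le_compat_r with (r := tau) in Hn; [|lra].
    replace (T / tau * tau) with T in Hn by (field; lra). exact Hn. }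
  assert (0 <= INR n * tau) as HnT0 by (apply Rmult_le_pos; [apply pos_INR|lra]).
  pose proof (solution_nice d alpha mu T Zc u0 Tmax u HZ Hsum Hsol HT) as Hnice.
  assert (forall x, u 0 x = u0 x) as Hu0 by apply Hsol.
  assert (nice u0) as Hn0 by (eapply nice_ext; [apply Hu0|apply Hnice; lra]).
  assert (forall t, 0 <= t <= T -> HB (alpha + 1 + 2 * gamma) (fourier_coef (u t)) (Rabs M)) as Hbd.
  { intros t Ht; eapply HB_weaken; [apply Rle_abs|eapply sup_sobolev_HB; eauto]. }
  assert (Rpower tau (1 + gamma) <= tau) as Hpow.
  { rewrite Rpower_plus, Rpower_1 by lra.
    assert (Rpower tau gamma <= 1); [|pose proof (Rpower_pos tau gamma); nra].
    unfold Rpower; rewrite <- exp_0.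
    assert (ln tau <= 0) by (rewrite <- ln_1; apply ln_le; lra).
    assert (gamma * ln tau <= 0) as [L|L] by nra; [left; now apply exp_increasing|rewrite L; lra]. }
  assert (K * Rpower tau (1 + gamma) <= 1) as Hsmall.
  { apply Rle_trans with (K * / K); [apply Rmult_le_compat_l; lra|rewrite Rinv_r; lra]. }
  pose proof (Hmain (fun t => fourier_coef (u t)) (fun n => fourier_coef (sLRI1 mu tau u0 n)) tau
    (solution_rcont d alpha mu T Zc u0 Tmax u Ha HZ Hsum Hsol HT)
    (solution_cderive d alpha mu T Zc u0 Tmax u HZ Hsum Hsol HT)
    Hbd (conj Ht0 Ht1') Hsmall) as H.
  specialize (H (fun k => fourier_coef_ext _ _ k (fun x => eq_sym (Hu0 x)))
    (fun k => fourier_coef_start d mu tau Ht0 u0 k Hn0)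
    (fun m k => fourier_coef_step d mu tau Ht0 _ _ k (nice_sLRI1 d mu tau Ht0 u0 m Hn0)
                  (nice_sLRI1 d mu tau Ht0 u0 (S m) Hn0)) n HnT).
  apply HB_sobolev_le. eapply HB_le; [exact H|lra| |].
  - apply Rmult_le_compat_r; [left; apply Rpower_pos|].
    apply Rmult_le_compat_l; [lra|].
    assert (lam * (INR n * tau) <= lam * T) as [L|L] by (apply Rmult_le_compat_l; lra).
    + left; now apply exp_increasing.
    + rewrite L; lra.
  - pose proof (Hnice _ (conj HnT0 HnT)) as (_ & C1 & _).
    pose proof (nice_sLRI1 d mu tau Ht0 u0 n Hn0) as (_ & C2 & _).
    intros k; exact (fourier_coef_minus (u (INR n * tau)) (sLRI1 mu tau u0 n) k C1 C2).
Qed.
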